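(* Let $\Omega\subset\mathbb{C}^n$ be a domain and let $\phi:\Omega\to[-\infty,+\infty)$ be an upper semi-continuous function. Put $\mathrm{Pole}(\phi):=\phi^{-1}(-\infty)$. Assume that $\mathrm{Pole}(\phi)$ is closed and that $\phi$ is locally Hölder continuous on $\Omega\setminus\mathrm{Pole}(\phi)$, i.e. for every $\Omega'\Subset\Omega\setminus\mathrm{Pole}(\phi)$ there exist constants $\alpha=\alpha_{\Omega'}\in(0,1]$ and $C=C_{\Omega'}>0$ such that $|\phi(z)-\phi(w)|\le C|z-w|^{\alpha}$ for all $z,w\in\Omega'$. If $(\Omega,\phi)$ satisfies the twisted Hörmander condition, then $\phi$ is plurisubharmonic on $\Omega$.
   Context: Twisted Hörmander condition for $(\Omega,\phi)$: for every positive integer $m$, every smooth strictly plurisubharmonic function $\psi$ on $\Omega$, and every smooth $\bar\partial$-closed $(0,1)$-form $\alpha$ on $\Omega$ with compact support and finite norm $\int_\Omega|\alpha|^2_{\sqrt{-1}\partial\bar\partial\psi}\,e^{-(m\phi+\psi)}<+\infty$, there exists a smooth function $u$ on $\Omega$ such that $\bar\partial u=\alpha$ and $$\int_\Omega|u|^2e^{-(m\phi+\psi)}\le\int_\Omega|\alpha|^2_{\sqrt{-1}\partial\bar\partial\psi}\,e^{-(m\phi+\psi)}.$$ Integrals are with respect to Lebesgue measure. For $\alpha=\sum_j\alpha_j\,d\bar z_j$, $|\alpha|^2_{\sqrt{-1}\partial\bar\partial\psi}=\sum_{i,j}\psi^{(i\bar j)}\alpha_i\overline{\alpha_j}$, where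 $(\psi^{(i\bar j)})$ is the inverse matrix of $\left(\frac{\partial^2\psi}{\partial z_i\partial\bar z_j}\right)$. Conventions: $e^{-(m\phi+\psi)}=+\infty$ where $\phi=-\infty$, and $0\cdot\infty=0$. The function identically $-\infty$ is counted as plurisubharmonic. $A\Subset B$ means $A$ is relatively compact in $B$. *)

(* Defs.v *)
From HB Require Import structures.
From mathcomp Require Import all_boot all_order all_algebra.
From mathcomp Require Import complex.
From mathcomp Require Import all_classical all_reals all_analysis.

Set Implicit Arguments.
Unset Strict Implicit.
Unset Printing Implicit Defensive.
Import Order.TTheory GRing.Theory Num.Theory.
Import numFieldNormedType.Exports.
Local Open Scope classical_set_scope.
Local Open Scope ring_scope.

(* C^n is 'rV[R[i]]_n over the MathComp complex numbers R[i]. The instance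
   below gives R[i] the topology of its modulus, hence 'rV[R[i]]_n the product
   topology. *)
#[warnings="-redundant-canonical-projection"]
HB.instance Definition _ (R : realType) := NormedModule.copy R[i] (R[i]^o).

Lemma product_sigma_finite d1 d2 (T1 : measurableType d1)
    (T2 : measurableType d2) (R : realType)
    (m1 : {sigma_finite_measure set T1 -> \bar R})
    (m2 : {sigma_finite_measure set T2 -> \bar R}) :
  sigma_finite setT (m1 \x m2)%E.
Proof.
have /sigma_finiteP[F [TF ndF Foo]] := sigma_finiteT m1.
have /sigma_finiteP[G [TG ndG Goo]] := sigma_finiteT m2.
exists (fun n => F n `*` G n).
  rewrite -setXTT TF TG predeqE => -[x y]; split.
    move=> [/= [n _ Fnx] [k _ Gky]]; exists (maxn n k) => //; split.
    - by move: x Fnx; exact/subsetPset/ndF/leq_maxl.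
    - by move: y Gky; exact/subsetPset/ndG/leq_maxr.
  by move=> [n _ []/= ? ?]; split; exists n.
move=> k; have [? ?] := Foo k; have [? ?] := Goo k.
split; first exact: measurableX.
by rewrite product_measure1E// lte_mul_pinfty// ge0_fin_numE.
Qed.

(* n-fold product of a measure on T, by recursion on n. *)
Section power_measure.
Context d (T : measurableType d) (R : realType).
Local Open Scope ereal_scope.

Definition tcons n (p : T * n.-tuple T) : n.+1.-tuple T :=
  [the n.+1.-tuple T of p.1 :: p.2].

Fixpoint power_measure_rec (mu : set T -> \bar R) (n : nat) {struct n} :
    set (n.-tuple T) -> \bar R :=
  match n with
  | 0 => \d_([tuple] : 0.-tuple T)
  | n'.+1 => pushforward (mu \x @power_measure_rec mu n') (@tcons n')
  end.

Variable mu : {sigma_finite_measure set T -> \bar R}.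

Definition power_measure (n : nat) : set (n.-tuple T) -> \bar R :=
  @power_measure_rec mu n.

Lemma measurable_tcons n : measurable_fun [set: T * n.-tuple T] (@tcons n).
Proof. exact: measurable_cons measurable_fst measurable_snd. Qed.

Let sigma_finite_measure_pack d' (U : measurableType d') (q : set U -> \bar R) :
    q set0 = 0 -> (forall A, 0 <= q A) -> semi_sigma_additive q ->
    sigma_finite setT q ->
  exists m : {sigma_finite_measure set U -> \bar R}, q = m :> (set _ -> _).
Proof.
move=> q0 q_ge0 q_add q_fin.
pose Q := isMeasure.Build _ _ _ q q0 q_ge0 q_add.
pose Qm : {measure set _ -> \bar R} := HB.pack q Q.
pose S := Measure_isSigmaFinite.Build _ _ _ Qm q_fin.
pose Qs : {sigma_finite_measure set _ -> \bar R} := HB.pack q Q S.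
by exists Qs.
Qed.

Let power_measureS n (m : {sigma_finite_measure set (n.-tuple T) -> \bar R}) :
  exists m' : {sigma_finite_measure set (n.+1.-tuple T) -> \bar R},
    pushforward (mu \x m) (@tcons n) = m' :> (set _ -> _).
Proof.
pose q := pushforward (mu \x m) (@tcons n).
have q0 : q set0 = 0 by rewrite /q /pushforward preimage_set0 measure0.
have q_ge0 A : 0 <= q A by rewrite /q /pushforward; exact: measure_ge0.
have q_add : semi_sigma_additive q.
  exact: (@measure_semi_sigma_additive _ _ _
    (measure_function_pushforward__canonical__measure_function_Measure
       (mu \x m) (@measurable_tcons n))).
have q_fin : sigma_finite setT q.
  have [F FT Ffin] := product_sigma_finite mu m.
  pose u (t : n.+1.-tuple T) : T * n.-tuple T := (thead t, [tuple of behead t]).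
  have mu_ : measurable_fun setT u.
    apply/measurable_fun_pairP; split; first exact: measurable_tnth.
    exact: measurable_behead.
  exists (fun i => u @^-1` F i).
    by rewrite -preimage_bigcup -FT preimage_setT.
  move=> i; have [mF Fi] := Ffin i; split.
    by rewrite -[X in measurable X]setTI; exact: mu_.
  rewrite /q /pushforward -comp_preimage.
  suff -> : u \o @tcons n = id by [].
  by apply/funext => -[x t]; rewrite /u /tcons/=; congr pair; exact/val_inj.
exact: sigma_finite_measure_pack.
Qed.

Let power_measureP n :
  exists m : {sigma_finite_measure set (n.-tuple T) -> \bar R},
    @power_measure n = m :> (set _ -> _).
Proof.
elim: n => [|n [m IH]]; first by exists (\d_([tuple] : 0.-tuple T)).
rewrite /power_measure /= -/(@power_measure n) IH.
exact: power_measureS.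
Qed.

Let pm0 n : @power_measure n set0 = 0.
Proof. by have [m ->] := power_measureP n. Qed.

Let pm_ge0 n A : 0 <= @power_measure n A.
Proof. by have [m ->] := power_measureP n. Qed.

Let pm_additive n : semi_sigma_additive (@power_measure n).
Proof.
by have [m ->] := power_measureP n; exact: measure_semi_sigma_additive.
Qed.

#[warnings="-redundant-canonical-projection"]
HB.instance Definition _ n := isMeasure.Build _ _ _ (@power_measure n)
  (pm0 n) (@pm_ge0 n) (@pm_additive n).

Let pm_sigma_finite n : sigma_finite setT (@power_measure n).
Proof. by have [m ->] := power_measureP n; exact: sigma_finiteT. Qed.

#[warnings="-redundant-canonical-projection"]
HB.instance Definition _ n := Measure_isSigmaFinite.Build _ _ _
  (@power_measure n) (@pm_sigma_finite n).

End power_measure.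

Arguments power_measure {d T R} mu n A.

(* Named, because the canonical structures found for \x itself are those of a
   product of finite measures. *)
Definition lebesgue_C (R : realType) :
    set (measurableTypeR R * measurableTypeR R) -> \bar R :=
  (@lebesgue_measure R \x @lebesgue_measure R)%E.

#[warnings="-redundant-canonical-projection"]
HB.instance Definition _ (R : realType) := Measure.copy (@lebesgue_C R)
  (@lebesgue_measure R \x @lebesgue_measure R)%E.

#[warnings="-redundant-canonical-projection"]
HB.instance Definition _ (R : realType) := Measure_isSigmaFinite.Build _ _ _
  (@lebesgue_C R)
  (product_sigma_finite (@lebesgue_measure R) (@lebesgue_measure R)).

Section complex_space.
Context (R : realType) (n : nat).
Implicit Types (z w v : 'rV[R[i]]_n) (Omega : set 'rV[R[i]]_n).

Definition domain Omega := [/\ open Omega, connected Omega & Omega !=set0].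

Definition cnorm z : R :=
  Num.sqrt (\sum_(j < n) (complex.Re (z 0 j) ^+ 2 + complex.Im (z 0 j) ^+ 2)).

Definition lebesgue_Cn := power_measure (@lebesgue_C R) n.

#[warnings="-redundant-canonical-projection"]
HB.instance Definition _ := SigmaFiniteMeasure.copy lebesgue_Cn
  (power_measure (@lebesgue_C R) n).

(* lebesgue_Cn lives on (R x R)^n; integrals over C^n are read along Cn_of. *)
Definition Cn_of (t : n.-tuple (measurableTypeR R * measurableTypeR R)) :
    'rV[R[i]]_n :=
  \row_j Complex (tnth t j).1 (tnth t j).2.

Definition integral_Cn Omega (f : 'rV[R[i]]_n -> \bar R) : \bar R :=
  (\int[lebesgue_Cn]_(t in Cn_of @^-1` Omega) f (Cn_of t))%E.

(* Real directional derivatives, along the line t |-> z + t v with t real. *)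
Definition rderivable v (g : 'rV[R[i]]_n -> R) z : Prop :=
  derivable (fun t : R => g (z + (t%:C)%C *: v)) 0 1.

Definition rderive v (g : 'rV[R[i]]_n -> R) z : R :=
  derive1 (fun t : R => g (z + (t%:C)%C *: v)) 0.

(* The directions of the real coordinates x_j and y_j, where z_j = x_j + i y_j. *)
Definition xdir (j : 'I_n) : 'rV[R[i]]_n := delta_mx 0 j.
Definition ydir (j : 'I_n) : 'rV[R[i]]_n := 'i%C *: delta_mx 0 j.

Fixpoint Ck (k : nat) Omega (g : 'rV[R[i]]_n -> R) : Prop :=
  (forall z, Omega z -> {for z, continuous g}) /\
  match k with
  | 0 => True
  | k'.+1 => forall v, (exists j, v = xdir j \/ v = ydir j) ->
      (forall z, Omega z -> rderivable v g z) /\ Ck k' Omega (rderive v g)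
  end.

Definition smooth Omega (g : 'rV[R[i]]_n -> R) : Prop :=
  forall k, Ck k Omega g.

Definition csmooth Omega (f : 'rV[R[i]]_n -> R[i]) : Prop :=
  smooth Omega (fun z => complex.Re (f z)) /\
  smooth Omega (fun z => complex.Im (f z)).

Definition cderive v (f : 'rV[R[i]]_n -> R[i]) z : R[i] :=
  Complex (rderive v (fun w => complex.Re (f w)) z)
          (rderive v (fun w => complex.Im (f w)) z).

Definition dz (j : 'I_n) (f : 'rV[R[i]]_n -> R[i]) z : R[i] :=
  (cderive (xdir j) f z - 'i%C * cderive (ydir j) f z) / 2.

Definition dzbar (j : 'I_n) (f : 'rV[R[i]]_n -> R[i]) z : R[i] :=
  (cderive (xdir j) f z + 'i%C * cderive (ydir j) f z) / 2.

Definition levi (psi : 'rV[R[i]]_n -> R) z : 'M[R[i]]_n :=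
  \matrix_(i, j) dz i (dzbar j (fun w => ((psi w)%:C)%C)) z.

(* The order of R[i] is partial: 0 < x means that x is real and positive. *)
Definition strictly_psh Omega (psi : 'rV[R[i]]_n -> R) : Prop :=
  forall z, Omega z -> forall xi : 'rV[R[i]]_n, xi != 0 ->
    0 < \sum_i \sum_j levi psi z i j * xi 0 i * conjc (xi 0 j).

(* A (0,1)-form sum_j alpha_j d\bar z_j is the family of its coefficients. *)
Definition form01 := 'I_n -> 'rV[R[i]]_n -> R[i].
Implicit Type alpha : form01.

Definition smooth_form Omega alpha : Prop := forall j, csmooth Omega (alpha j).

Definition dbar_closed Omega alpha : Prop :=
  forall i j z, Omega z -> dzbar i (alpha j) z = dzbar j (alpha i) z.

(* The support is the closure in Omega of the nonvanishing set. *)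
Definition compact_support Omega alpha : Prop :=
  compact (Omega `&` closure [set z | Omega z /\ exists j, alpha j z != 0]).

Definition form_sqnorm (psi : 'rV[R[i]]_n -> R) alpha z : R :=
  complex.Re (\sum_i \sum_j
    invmx (levi psi z) i j * alpha i z * conjc (alpha j z)).

Definition sqmod (a : R[i]) : R := complex.Re a ^+ 2 + complex.Im a ^+ 2.

(* expeR +oo = +oo and 0 * +oo = 0 in \bar R. *)
Definition weight (m : nat) (phi : 'rV[R[i]]_n -> \bar R)
    (psi : 'rV[R[i]]_n -> R) z : \bar R :=
  expeR (- (m%:R%:E * phi z + (psi z)%:E))%E.

Definition twisted_hormander Omega (phi : 'rV[R[i]]_n -> \bar R) : Prop :=
  forall (m : nat) (psi : 'rV[R[i]]_n -> R) alpha,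
    (0 < m)%N ->
    smooth Omega psi -> strictly_psh Omega psi ->
    smooth_form Omega alpha -> dbar_closed Omega alpha ->
    compact_support Omega alpha ->
    (integral_Cn Omega
      (fun z => (form_sqnorm psi alpha z)%:E * weight m phi psi z) < +oo)%E ->
    exists u : 'rV[R[i]]_n -> R[i],
      [/\ csmooth Omega u,
          forall j z, Omega z -> dzbar j u z = alpha j z &
          (integral_Cn Omega (fun z => (sqmod (u z))%:E * weight m phi psi z) <=
           integral_Cn Omega
             (fun z => (form_sqnorm psi alpha z)%:E * weight m phi psi z))%E].

Definition upper_semicontinuous_on Omega (phi : 'rV[R[i]]_n -> \bar R) : Prop :=
  forall z, Omega z -> forall a : R, (phi z < a%:E)%E ->
    \forall w \near z, Omega w -> (phi w < a%:E)%E.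

Definition Pole Omega (phi : 'rV[R[i]]_n -> \bar R) : set 'rV[R[i]]_n :=
  [set z | Omega z /\ phi z = -oo%E].

Definition closed_in Omega (A : set 'rV[R[i]]_n) : Prop :=
  exists2 F, closed F & A = Omega `&` F.

Definition relatively_compact (A B : set 'rV[R[i]]_n) : Prop :=
  compact (closure A) /\ closure A `<=` B.

Definition locally_holder (D : set 'rV[R[i]]_n)
    (phi : 'rV[R[i]]_n -> \bar R) : Prop :=
  forall D', relatively_compact D' D ->
    exists (a C : R), [/\ 0 < a, a <= 1, 0 < C &
      forall z w, D' z -> D' w ->
        (`|phi z - phi w| <= (C * cnorm (z - w) `^ a)%:E)%E].

Definition circle_mean (phi : 'rV[R[i]]_n -> \bar R) z w : \bar R :=
  (((2 * pi)^-1)%R%:E *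
   \int[@lebesgue_measure R]_(th in `[0%R, (2 * pi)%R])
     phi (z + Complex (cos th) (sin th) *: w)%R)%E.

(* The integral in circle_mean is that of an extended-real function whose
   positive part is bounded, by upper semicontinuity; it may be -oo. *)
Definition psh Omega (phi : 'rV[R[i]]_n -> \bar R) : Prop :=
  [/\ forall z, Omega z -> (phi z < +oo)%E,
      upper_semicontinuous_on Omega phi &
      forall z w, (forall t : R[i], `|t| <= 1 -> Omega (z + t *: w)) ->
        (phi z <= circle_mean phi z w)%E].

End complex_space.

Arguments lebesgue_Cn R n A : clear implicits.

(* Main.v *)
(* Fix w with phi w finite.  Near w the function phi oscillates by at most C/m
   on the ball of radius e = r0 / m^K, because phi is Hoelder continuous there.
   Solve dbar u = dbar chi for a cutoff chi living on that ball, with the twist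
   m phi and psi z = |z - w|^2 + (n+1) log (|z - w|^2 + d); for d a suitable power
   of e the weight forces |u w| <= 1/2, so f_m = chi - u is holomorphic on Omega,
   |f_m w| >= 1/2, and the L^2 norm of f_m with weight e^(- m phi) is at most
   e^(- m phi w) times a power of m.  The area mean value inequality then gives
     |f_m z|^2 <= poly(m) exp (m (sup_(|y - z| <= c/m) phi y - phi w)).

   On the circle w + e^(i th) v this is poly(m) exp (m (h th - phi w)) for every
   Lipschitz majorant h of phi.  No Jensen formula is needed to exploit it: the
   product of the m functions t |-> f_m (w + e^(2 i pi j / m) t v) obeys the
   maximum principle, and its m-th root turns the pointwise bound into a Riemann
   sum of h, so phi w is at most the mean of h as m tends to infinity.  Finally h
   decreases to phi along the sup-convolutions of phi. *)
Require Import Defs.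
From HB Require Import structures.
From mathcomp Require Import all_boot all_order all_algebra.
From mathcomp Require Import complex.
From mathcomp Require Import all_classical all_reals all_analysis.
From mathcomp Require Import measurable_realfun.
From mathcomp Require Import ring lra.
Set Implicit Arguments.
Unset Strict Implicit.
Unset Printing Implicit Defensive.
Import Order.TTheory GRing.Theory Num.Theory.
Import numFieldNormedType.Exports.
Local Open Scope classical_set_scope.
Local Open Scope ring_scope.

(** * One complex variable *)

(** The m-th root taken at the end forgives every power of m but no factor exp (eps m) with eps
    fixed, and this budget fixes all constants. With Hoelder exponent a, the oscillation is O(1/m)
    on the ball of radius e as soon as K a >= 1; then exp (m * C0 / m) is bounded and 1/e costs only
    a power of m. The coefficient n+1 of the logarithm comes from the mean value inequality at w: on
    a box of side about sqrt d it loses d^-n, while the weight gains d^(n+1), and the surplus factor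
    d absorbs the powers of 1/e. A true pole would force u w = 0, but psi must be smooth, hence the
    shift by d. Since chi is constant near w, psi is bounded below on the support of dbar chi by a
    bound that does not involve d. Hoelder continuity is used only between w and points near it.
    Elsewhere only upper bounds of phi enter, since these bound the weight from below; so poles away
    from w do no harm and upper semicontinuity is enough there. *)

Section chain.
Context {R : realType}.
Implicit Types (F Fx : R * R -> R).

Lemma mvt_between (f df : R -> R) (a b : R) :
  (forall s, `|s - a| <= `|b - a| -> is_derive s 1 f (df s)) ->
  exists2 c, `|c - a| <= `|b - a| & f b - f a = df c * (b - a).
Proof.
move=> dfE; have [ab|ba] := leP a b.
  have h s : s \in `[a, b] -> `|s - a| <= `|b - a|.
    by rewrite in_itv/= => /andP[as_ sb]; rewrite !ger0_norm ?subr_ge0// lerD2r.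
  have [| |c /h cab ->] := @MVT_segment _ f df _ _ ab.
  - by move=> s sab; apply/dfE/h; exact: subset_itv_oo_cc sab.
  - by apply: derivable_within_continuous => s sab; have [] := dfE _ (h _ sab).
  - by exists c.
have h s : s \in `[b, a] -> `|s - a| <= `|b - a|.
  rewrite in_itv/= => /andP[bs sa].
  by rewrite !ler0_norm ?subr_le0 ?(ltW ba)// lerN2 lerD2r.
have [| |c /h cab e] := @MVT_segment _ f df _ _ (ltW ba).
- by move=> s sab; apply/dfE/h; exact: subset_itv_oo_cc sab.
- by apply: derivable_within_continuous => s sab; have [] := dfE _ (h _ sab).
- by exists c => //; rewrite -opprB e -mulrN opprB.
Qed.

(** A chain rule without total differentiability. The increment is split at [(x t, y s)]: the second
    piece moves only the second variable, where a derivative at one point suffices; the first is a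
    mean value quotient, controlled by continuity of [Fx] at the point. *)
Lemma is_derive_comp_curve F Fx (x y : R -> R) (t dx dy fy : R) :
  is_derive t 1 x dx -> is_derive t 1 y dy ->
  (\forall p \near ((x t, y t) : R * R), is_derive (p.1 : R) 1 (fun s : R => F (s, p.2)) (Fx p)) ->
  {for ((x t, y t) : R * R), continuous Fx} ->
  is_derive (y t) 1 (fun s : R => F (x t, s)) fy ->
  is_derive t 1 (fun s : R => F (x s, y s)) (Fx (x t, y t) * dx + fy * dy).
Proof.
move=> hx hy hFx cFx hFy.
have cx : {for t, continuous x}.
  by apply/differentiable_continuous; rewrite -derivable1_diffP; case: hx.
have cy : {for t, continuous y}.
  by apply/differentiable_continuous; rewrite -derivable1_diffP; case: hy.
pose A s := F (x s, y s) - F (x t, y s).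
have -> : (fun s => F (x s, y s)) = A \+ ((fun s => F (x t, s)) \o y).
  by apply/funext => s; rewrite /A /= subrK.
have hB : is_derive t 1 ((fun s => F (x t, s)) \o y) (fy * dy).
  exact: is_derive1_comp.
apply: is_deriveD.
have /is_derive1_caratheodory [gx [gxE cgx gxt]] := hx.
apply/is_derive1_caratheodory.
(* The difference quotient in the first variable, replaced by its limit wherever [x s = x t], which
   makes it continuous at [t] as Caratheodory's criterion requires. *)
pose k s := if x s == x t then Fx (x t, y t) else A s / (x s - x t).
exists (fun s => k s * gx s); split.
- move=> s; rewrite -mulrA -gxE {2}/A subrr subr0 /k.
  case: ifPn => [/eqP e|ne]; first by rewrite /A e !subrr mulr0.
  by rewrite mulfVK// subr_eq0.
- apply: cvgM => //.
  rewrite /k eqxx; apply/cvgrPdist_lt => e e0.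
  move/cvgrPdist_lt : cFx => /(_ _ e0) cFx'.
  have [[U1 U2] [U1t U2t] UF] : nbhs (x t, y t)
    [set p : R * R | is_derive (p.1 : R) 1 (fun s : R => F (s, p.2)) (Fx p) /\
             `|Fx (x t, y t) - Fx p| < e].
    by apply: filterI.
  have [d dU1] := nbhs_ex U1t.
  have dx' : \forall s \near t, `|x s - x t| < d%:num.
    have dp : 0 < d%:num by [].
    move/cvgrPdist_lt : cx => /(_ _ dp).
    by apply: filterS => s; rewrite distrC.
  have dy' : \forall s \near t, U2 (y s) by exact: cy.
  near=> s.
  have xs : `|x s - x t| < d%:num by near: s.
  have ys : U2 (y s) by near: s.
  rewrite /k; case: ifPn => [_|ne]; first by rewrite subrr normr0.
  have [|c cx' e'] := @mvt_between (fun s' => F (s', y s)) (fun s' => Fx (s', y s)) (x t) (x s).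
    move=> s' hs'; have [] // := UF (s', y s); split => //=; apply: dU1.
    by rewrite /ball/= distrC; apply: le_lt_trans hs' xs.
  rewrite /A e' mulfK ?subr_eq0//.
  have [] // := UF (c, y s); split => //=; apply: dU1.
  by rewrite /ball/= distrC; apply: le_lt_trans cx' xs.
- by rewrite /k eqxx gxt.
Unshelve. all: by end_near. Qed.


Lemma isdC (c t : R) : is_derive t 1 (fun _ : R => c) 0.
Proof. exact: is_derive_cst. Qed.

Lemma isdI (t : R) : is_derive t 1 (fun s : R => s) 1.
Proof. exact: is_derive_id. Qed.

Lemma isdD (f g : R -> R) (t a b : R) :
  is_derive t 1 f a -> is_derive t 1 g b ->
  is_derive t 1 (fun s => f s + g s) (a + b).
Proof. exact: is_deriveD. Qed.

Lemma isdB (f g : R -> R) (t a b : R) :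
  is_derive t 1 f a -> is_derive t 1 g b ->
  is_derive t 1 (fun s => f s - g s) (a - b).
Proof. exact: is_deriveB. Qed.

Lemma isdM (f g : R -> R) (t a b : R) :
  is_derive t 1 f a -> is_derive t 1 g b ->
  is_derive t 1 (fun s => f s * g s) (a * g t + f t * b).
Proof.
move=> fa gb; have := is_deriveM fa gb.
by rewrite addrC /GRing.scale/= [g t * a]mulrC.
Qed.

Lemma isdX2 (f : R -> R) (t a : R) :
  is_derive t 1 f a -> is_derive t 1 (fun s => f s ^+ 2) (2 * f t * a).
Proof.
move=> fa; apply: is_derive_eq (isdM fa fa) _; ring.
Qed.

Lemma isd_comp (f g : R -> R) (t a b : R) :
  is_derive (g t) 1 f a -> is_derive t 1 g b ->
  is_derive t 1 (fun s => f (g s)) (a * b).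
Proof. exact: is_derive1_comp. Qed.

Lemma isd_cont (f : R -> R) (t a : R) :
  is_derive t 1 f a -> {for t, continuous f}.
Proof.
by case=> ? _; apply/differentiable_continuous; rewrite -derivable1_diffP.
Qed.

Lemma isd_eq (f : R -> R) (t a b : R) :
  is_derive t 1 f a -> a = b -> is_derive t 1 f b.
Proof. by move=> ? <-. Qed.

End chain.

Lemma continuous_for_ext (T U : topologicalType) (f g : T -> U) p :
  f =1 g -> {for p, continuous g} -> {for p, continuous f}.
Proof. by move=> /funext ->. Qed.

Section continuity_at_a_point.
Context {T : topologicalType} {R : realType}.
Implicit Types (f g : T -> R) (p : T).

Lemma cont_cst (c : R) p : {for p, continuous (fun=> c)}.
Proof. exact: cvg_cst. Qed.

Lemma contD f g p : {for p, continuous f} -> {for p, continuous g} ->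
  {for p, continuous (fun q => f q + g q)}.
Proof. exact: cvgD. Qed.

Lemma contB f g p : {for p, continuous f} -> {for p, continuous g} ->
  {for p, continuous (fun q => f q - g q)}.
Proof. exact: cvgB. Qed.

Lemma contM f g p : {for p, continuous f} -> {for p, continuous g} ->
  {for p, continuous (fun q => f q * g q)}.
Proof. exact: cvgM. Qed.

Lemma contX f n p : {for p, continuous f} -> {for p, continuous (fun q => f q ^+ n)}.
Proof.
move=> cf; elim: n => [|n ih]; first exact: cont_cst.
by apply: continuous_for_ext (contM cf ih) => q; rewrite exprS.
Qed.

Lemma cont_comp (U V : topologicalType) (h : T -> U) (k : U -> V) p :
  {for p, continuous h} -> {for h p, continuous k} ->
  {for p, continuous (fun q => k (h q))}.
Proof. exact: continuous_comp. Qed.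

Lemma cont_pair (U V : topologicalType) (h : T -> U) (k : T -> V) p :
  {for p, continuous h} -> {for p, continuous k} ->
  {for p, continuous (fun q => (h q, k q))}.
Proof. exact: cvg_pair. Qed.

Lemma cont_fst (U V : topologicalType) (p : U * V) : {for p, continuous fst}.
Proof. exact: cvg_fst. Qed.

Lemma cont_snd (U V : topologicalType) (p : U * V) : {for p, continuous snd}.
Proof. exact: cvg_snd. Qed.

End continuity_at_a_point.

Section holomorphic.
Context {R : realType}.
Local Notation C := R[i].
Local Notation Re := (@complex.Re R).
Local Notation Im := (@complex.Im R).

(** Complex-valued notions are kept as pairs of real ones, the form in which [csmooth] and [cderive]
    provide them. *)
Definition is_cder (f : R -> C) (t : R) (d : C) :=
  is_derive t 1 (fun s => Re (f s)) (Re d) /\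
  is_derive t 1 (fun s => Im (f s)) (Im d).

Definition ccont (T : topologicalType) (f : T -> C) (p : T) :=
  {for p, continuous (fun q => Re (f q))} /\
  {for p, continuous (fun q => Im (f q))}.

Lemma CReM (a b : C) : Re (a * b) = Re a * Re b - Im a * Im b.
Proof. by case: a b => [a1 a2] [b1 b2]. Qed.

Lemma CImM (a b : C) : Im (a * b) = Re a * Im b + Im a * Re b.
Proof. by case: a b => [a1 a2] [b1 b2]. Qed.

Lemma CReD (a b : C) : Re (a + b) = Re a + Re b.
Proof. by case: a b => [a1 a2] [b1 b2]. Qed.

Lemma CImD (a b : C) : Im (a + b) = Im a + Im b.
Proof. by case: a b => [a1 a2] [b1 b2]. Qed.

Lemma CReB (a b : C) : Re (a - b) = Re a - Re b.
Proof. by case: a b => [a1 a2] [b1 b2]. Qed.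

Lemma CImB (a b : C) : Im (a - b) = Im a - Im b.
Proof. by case: a b => [a1 a2] [b1 b2]. Qed.

Lemma Ceq (a b : C) : Re a = Re b -> Im a = Im b -> a = b.
Proof. by case: a b => [a1 a2] [b1 b2] /= -> ->. Qed.

Lemma sqmodM (a b : C) : sqmod (a * b) = sqmod a * sqmod b.
Proof. rewrite /sqmod CReM CImM; ring. Qed.

Lemma sqmod_ge0 (a : C) : 0 <= sqmod a.
Proof. by rewrite /sqmod addr_ge0 ?sqr_ge0. Qed.

Lemma is_cderM f g t a b : is_cder f t a -> is_cder g t b ->
  is_cder (fun s => f s * g s) t (a * g t + f t * b).
Proof.
move=> [f1 f2] [g1 g2]; split.
  under eq_fun do rewrite CReM.
  apply: isd_eq (isdB (isdM f1 g1) (isdM f2 g2)) _.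
  rewrite CReD !CReM; ring.
under eq_fun do rewrite CImM.
apply: isd_eq (isdD (isdM f1 g2) (isdM f2 g1)) _.
rewrite CImD !CImM; ring.
Qed.

Lemma ccontM (T : topologicalType) (f g : T -> C) p :
  ccont f p -> ccont g p -> ccont (fun q => f q * g q) p.
Proof.
move=> [f1 f2] [g1 g2]; split.
  by apply: (continuous_for_ext (fun=> CReM _ _)); apply: cvgB; apply: cvgM.
by apply: (continuous_for_ext (fun=> CImM _ _)); apply: cvgD; apply: cvgM.
Qed.

Lemma ccontD (T : topologicalType) (f g : T -> C) p :
  ccont f p -> ccont g p -> ccont (fun q => f q + g q) p.
Proof.
move=> [f1 f2] [g1 g2]; split.
  by apply: (continuous_for_ext (fun=> CReD _ _)); apply: cvgD.
by apply: (continuous_for_ext (fun=> CImD _ _)); apply: cvgD.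
Qed.

(* The plane R * R stands for C: [G' (x, y)] is the complex derivative at x + iy. *)
Definition hol (D : set (R * R)) (G G' : R * R -> C) := forall p, D p ->
  [/\ is_cder (fun s => G (s, p.2)) p.1 (G' p),
      is_cder (fun s => G (p.1, s)) p.2 ('i%C * G' p),
      ccont G p & ccont G' p].

Lemma hol_cst D c : hol D (fun=> c) (fun=> 0).
Proof.
move=> p _; rewrite mulr0.
split; by [split; exact: isdC|split; exact: cvg_cst].
Qed.

Lemma holM D F F' G G' : hol D F F' -> hol D G G' ->
  hol D (fun p => F p * G p) (fun p => F' p * G p + F p * G' p).
Proof.
move=> hF hG p Dp; have [f1 f2 f3 f4] := hF p Dp; have [g1 g2 g3 g4] := hG p Dp.
split.
- by have := is_cderM f1 g1; rewrite -surjective_pairing.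
- have := is_cderM f2 g2; rewrite -surjective_pairing.
  by rewrite mulrDr -!mulrA [F p * ('i%C * _)]mulrCA.
- exact: ccontM.
- by apply: ccontD; apply: ccontM.
Qed.

Lemma hol_prod D (I : Type) (s : seq I) (F F' : I -> R * R -> C) :
  (forall i, hol D (F i) (F' i)) ->
  exists G', hol D (fun p => \prod_(i <- s) F i p) G'.
Proof.
move=> hF; elim: s => [|i s [G' hG']].
  exists (fun=> 0); under eq_fun do rewrite big_nil.
  exact: hol_cst.
have := holM (hF i) hG'.
set H' := (X in hol _ _ X) => hH; exists H'.
by under eq_fun do rewrite big_cons.
Qed.

Variables (D : set (R * R)) (G G' : R * R -> C).
Hypotheses (oD : open D) (hG : hol D G G').

Lemma hol_curve (x y : R -> R) (t dx dy : R) : D (x t, y t) ->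
  is_derive t 1 x dx -> is_derive t 1 y dy ->
  is_cder (fun s => G (x s, y s)) t (Complex dx dy * G' (x t, y t)).
Proof.
move=> Dt hx hy.
have nD : \forall p \near ((x t, y t) : R * R), D p by exact: open_nbhs_nbhs.
have [_ [f2 g2] _ [f4 g4]] := hG Dt; split.
  have := @is_derive_comp_curve _ (fun p => Re (G p)) (fun p => Re (G' p)) x y t dx dy
    (Re ('i%C * G' (x t, y t))) hx hy _ f4 f2.
  move=> /(_ _) H; apply: isd_eq (H _) _.
    by near=> p; have [] // := hG (near nD p _) => -[].
  by rewrite !CReM/=; ring.
have := @is_derive_comp_curve _ (fun p => Im (G p)) (fun p => Im (G' p)) x y t dx dy
  (Im ('i%C * G' (x t, y t))) hx hy _ g4 g2.
move=> H; apply: isd_eq (H _) _.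
  by near=> p; have [] // := hG (near nD p _) => -[].
by rewrite !CImM/=; ring.
Unshelve. all: by end_near. Qed.

End holomorphic.

(** Upper semicontinuity gives measurability once a countable measurable family refines the
    neighbourhoods, for then sublevel sets are countable unions of its members. This avoids
    comparing product sigma-algebras with Borel ones. *)
Lemma measurable_fun_basis d (T : measurableType d) (R : realType) (I : countType)
    (B : I -> set T) (D : set T) (f : T -> \bar R) :
  (forall i, measurable (B i)) ->
  (forall x (a : R), D x -> (f x < a%:E)%E ->
    exists i, B i x /\ forall y, B i y -> D y -> (f y < a%:E)%E) ->
  measurable_fun (D : set T) (f : T -> \bar R).
Proof.
move=> mB hB mD.
apply: (measurability _ (ErealGenInftyO.measurableE R)) => // _ [_ [a ->] <-].
pose J := [set i | forall y, B i y -> D y -> (f y < a%:E)%E].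
rewrite (_ : _ `&` _ = D `&` \bigcup_(i in J) B i).
  apply: measurableI => //; rewrite bigcup_mkcond.
  by apply: countable_bigcupT_measurable => [|i]; [exact: countableP|case: ifPn].
apply/seteqP; split => x [Dx].
  by rewrite /= in_itv/= => /(hB _ _ Dx)[i [Bi hi]]; split => //; exists i.
by move=> [i Ji Bi]; split => //; rewrite /= in_itv/=; exact: Ji.
Qed.

Lemma compact_bounded_for (T : topologicalType) (R : realType) (K : set T)
    (f : T -> R) : compact K -> (forall x, K x -> {for x, continuous f}) ->
  exists M, forall x, K x -> `|f x| <= M.
Proof.
move=> /compact_near_coveringP cK cf.
suff : \forall M \near +oo, K `<=` [set x | `|f x| <= M].
  by move=> [M [_ /(_ (M + 1))]]; rewrite ltrDl ltr01 => /(_ isT) h; exists (M + 1).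
apply: (cK _ +oo (fun M => [set x | `|f x| <= M])) => x Kx.
exists ([set y | `|f x - f y| < 1], [set M | `|f x| + 1 <= M]) => /=.
  split; last by exists (`|f x| + 1); split; [exact: num_real|move=> ? /ltW].
  by move/cvgrPdist_lt : (cf x Kx); exact.
move=> [y M] /= [/ltW fxy fM]; apply: le_trans fM.
rewrite -[f y](subrK (f x)) addrC; apply: le_trans (ler_normD _ _) _.
by rewrite lerD2l distrC.
Qed.

Section one_variable.
Context {R : realType}.
Local Notation C := R[i].
Local Notation Re := (@complex.Re R).
Local Notation Im := (@complex.Im R).
Local Notation mu := (@lebesgue_measure R).

Lemma FTC_der (F f : R -> R) (a b : R) : a < b ->
  (forall x, x \in `[a, b] -> is_derive x 1 F (f x)) ->
  (forall x, x \in `[a, b] -> {for x, continuous f}) ->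
  (\int[mu]_(x in `[a, b]) (f x)%:E = (F b - F a)%:E)%E.
Proof.
move=> ab dF cf; rewrite EFinB; apply: continuous_FTC2 => //.
- by apply: continuous_in_subspaceT => x; rewrite inE => /cf.
- split.
  + by move=> x /subset_itv_oo_cc /dF [].
  + apply: cvg_at_right_filter; apply: isd_cont (dF a _).
    by rewrite in_itv/= lexx ltW.
  + apply: cvg_at_left_filter; apply: isd_cont (dF b _).
    by rewrite in_itv/= lexx ltW.
- by move=> x /subset_itv_oo_cc /dF [_ <-]; rewrite derive1E.
Qed.

(** Differentiation under the integral sign, then the mean value theorem on [0, 1]. Domination on
    the larger interval []u, v[] gives continuity at the endpoints. The derivative is required to
    vanish only for 0 < t < 1 because the applications divide by t. *)
Lemma Rintegral_const_param d (Y : measurableType d) (nu : {measure set Y -> \bar R})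
    (B : set Y) (f df : R -> Y -> R) (u v M : R) :
  measurable B -> (nu B < +oo)%E -> u < 0 -> 1 < v ->
  (forall t, u < t < v -> nu.-integrable B (EFin \o f t)) ->
  (forall t y, u < t < v -> B y -> is_derive t 1 (f ^~ y) (df t y)) ->
  (forall t y, u < t < v -> B y -> `|df t y| <= M) ->
  (forall t, 0 < t < 1 -> (\int[nu]_(y in B) (df t y)%:E = 0)%E) ->
  (\int[nu]_(y in B) f 0 y = \int[nu]_(y in B) f 1 y)%R.
Proof.
move=> mB fB u0 v1 intf df_ dM df0.
pose F t := (\int[nu]_(y in B) f t y)%R.
have uv t : t \in `[0, 1] -> `]u, v[%classic t.
  rewrite !in_itv/= => /andP[t0 t1].
  by rewrite /= in_itv/= (lt_le_trans u0 t0) (le_lt_trans t1 v1).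
have I2 t : `]u, v[%classic t -> u < t < v by rewrite /= in_itv.
have d1 t y : `]u, v[%classic t -> B y -> partial1of2 f t y = df t y.
  by move=> /I2 tI By; rewrite partial1of2E; have [_ ->] := df_ t y tI By.
have intM : nu.-integrable B (EFin \o cst `|M|).
  by apply: measurable_bounded_integrable => //; exact: bounded_cst.
have M1 t y : `]u, v[%classic t -> B y -> `|partial1of2 f t y| <= cst `|M| y.
  move=> It By; rewrite d1//=; apply: le_trans (dM _ _ (I2 _ It) By) _.
  exact: ler_norm.
have intf' t : `]u, v[%classic t -> nu.-integrable B (EFin \o f t).
  by move=> /I2; exact: intf.
have derf t y : `]u, v[%classic t -> B y -> derivable (f ^~ y) t 1.
  by move=> /I2 tI By; have [] := df_ t y tI By.
have derF (t : R) : t \in `[0, 1] -> derivable F t 1.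
  move=> /uv It.
  by apply: (derivable_under_integral mB It intf' derf _ intM M1) => y /=.
have derF0 (t : R) : t \in `]0, 1[ -> is_derive t 1 F 0.
  move=> t01; have It := uv _ (subset_itv_oo_cc t01).
  apply: DeriveDef; first by apply: derF; exact: subset_itv_oo_cc.
  rewrite -derive1E (differentiation_under_integral mB It intf' derf _ intM M1)//.
  rewrite /Rintegral (eq_integral (fun y => (df t y)%:E)).
    by rewrite df0//; move: t01; rewrite in_itv.
  by move=> y; rewrite inE => By; rewrite d1.
have [|c _] := @MVT R F (fun=> 0) 0 1 ltr01 derF0.
  exact: derivable_within_continuous.
by rewrite mul0r => /eqP; rewrite subr_eq0 => /eqP /esym.
Qed.

Definition disc (r : R) : set (R * R) := [set p | p.1 ^+ 2 + p.2 ^+ 2 < r ^+ 2].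
(** Area integrals run over squares, which are products: Fubini then applies with no change of
    variables. *)
Definition sq (r : R) : set (R * R) := `[- r, r] `*` `[- r, r].
Definition osq (r : R) : set (R * R) := `]- r, r[ `*` `]- r, r[.

Section disc.
Variables (r : R) (G G' : R * R -> C).
Hypotheses (r1 : 1 < r) (hG : hol (disc r) G G').

Let open_disc : open (disc r).
Proof.
rewrite (_ : disc r = (fun p : R * R => p.1 ^+ 2 + p.2 ^+ 2) @^-1` [set x | x < r ^+ 2])//.
apply: open_comp; last exact: open_lt.
have h (p : R * R) : {for p, continuous (fun p : R * R => p.1 ^+ 2 + p.2 ^+ 2)}.
  by apply: contD; apply: contX; [exact: cont_fst|exact: cont_snd].
by move=> p _; exact: h.
Qed.

Let disc_polar t th : `|t| < r -> disc r (t * cos th, t * sin th).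
Proof.
move=> tr; rewrite /disc/= !exprMn -mulrDr cos2Dsin2 mulr1.
by rewrite -[t ^+ 2]real_normK ?num_real// ltrXn2r//= ?nnegrE ?(ltW (lt_trans _ r1)).
Qed.

Let isd_cos (t th : R) : is_derive th 1 (fun s => t * cos s) (- (t * sin th)).
Proof. by apply: isd_eq (isdM (isdC t th) (is_derive_cos th)) _; ring. Qed.

Let isd_sin (t th : R) : is_derive th 1 (fun s => t * sin s) (t * cos th).
Proof. by apply: isd_eq (isdM (isdC t th) (is_derive_sin th)) _; ring. Qed.

Let isd_id (c t : R) : is_derive t 1 (fun s => s * c) c.
Proof. by apply: isd_eq (isdM (isdI t) (isdC c t)) _; ring. Qed.

Let dr (t th : R) : R :=
  cos th * Re (G' (t * cos th, t * sin th)) - sin th * Im (G' (t * cos th, t * sin th)).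

Let contP (p : R * R) : {for p, continuous (fun q : R * R => (q.1 * cos q.2, q.1 * sin q.2))}.
Proof.
apply: cont_pair; apply: contM; try exact: cont_fst.
  by apply: cont_comp; [exact: cont_snd|exact: continuous_cos].
by apply: cont_comp; [exact: cont_snd|exact: continuous_sin].
Qed.

Let cont_dr (p : R * R) : `|p.1| < r -> {for p, continuous (fun q => dr q.1 q.2)}.
Proof.
move=> /(disc_polar p.2) Dp; have [_ _ _ [c1 c2]] := hG Dp.
have cc : {for p, continuous (fun q : R * R => cos q.2)}.
  by apply: cont_comp; [exact: cont_snd|exact: continuous_cos].
have cs : {for p, continuous (fun q : R * R => sin q.2)}.
  by apply: cont_comp; [exact: cont_snd|exact: continuous_sin].
apply: contB; apply: contM => //.
  exact: (@cont_comp _ _ _ (fun q : R * R => (q.1 * cos q.2, q.1 * sin q.2)) (fun q => Re (G' q)) p (@contP p) c1).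
exact: (@cont_comp _ _ _ (fun q : R * R => (q.1 * cos q.2, q.1 * sin q.2)) (fun q => Im (G' q)) p (@contP p) c2).
Qed.

(* By Cauchy-Riemann t times the radial derivative [dr] of Re G is the angular
   derivative of Im G, whose integral over the circle vanishes. *)
Lemma circle_mean_Re :
  (\int[mu]_(th in `[0, 2 * pi]) Re (G (cos th, sin th)) = 2 * pi * Re (G (0, 0)))%R.
Proof.
have pi0 : 0 < 2 * pi :> R by rewrite mulr_gt0 ?pi_gt0.
pose f t th := Re (G (t * cos th, t * sin th)).
(* A radius strictly between 1 and r, so that [dr] is bounded on a compact set containing all the
   circles used. *)
pose v := (1 + r) / 2.
have v1 : 1 < v by have /midf_lt[] := r1.
have vr : v < r by have /midf_lt[] := r1.
have rr t : - v < t < v -> `|t| < r by move=> ?; rewrite ltr_norml; lra.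
have cK : compact (`[- v, v] `*` `[0, 2 * pi] : set (R * R)).
  by apply: compact_setX; exact: segment_compact.
have [|M hM] := @compact_bounded_for _ _ _ (fun q => dr q.1 q.2) cK.
  move=> p [/=]; rewrite in_itv/= => /andP[? ?] _; apply: cont_dr.
  by rewrite ltr_norml; lra.
have fth t th : `|t| < r -> is_cder (fun s => G (t * cos s, t * sin s)) th
    (Complex (- (t * sin th)) (t * cos th) * G' (t * cos th, t * sin th)).
  by move=> tr; apply: (hol_curve open_disc hG) => //; exact: disc_polar.
have fin : (mu `[0%R, (2 * pi)%R]%classic < +oo)%E.
  by rewrite lebesgue_measure_itv/= lte_fin pi0 -EFinD ltry.
have := @Rintegral_const_param _ _ mu `[0%R, (2 * pi)%R]%classic f dr (- v) v M _ fin _ v1.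
rewrite (_ : (\int[mu]_(y in _) f 1 y)%R = (\int[mu]_(th in `[0, 2 * pi]) Re (G (cos th, sin th)))%R); last first.
  by apply: eq_Rintegral => th _; rewrite /f !mul1r.
rewrite (_ : (\int[mu]_(y in _) f 0 y)%R = 2 * pi * Re (G (0, 0))); last first.
  rewrite /f; under eq_Rintegral do rewrite !mul0r.
  rewrite Rintegral_cst//= lebesgue_measure_itv/= lte_fin pi0 -EFinD/= subr0.
  by rewrite mulrC.
move=> H; symmetry; apply: H => //.
- by rewrite oppr_lt0; lra.
- move=> t /rr tr; apply: continuous_compact_integrable; first exact: segment_compact.
  apply: continuous_subspaceT => th; exact: isd_cont (fth t th tr).1.
- move=> t th /rr tr _.
  have [h _] := @hol_curve _ _ _ _ open_disc hG (fun s => s * cos th) (fun s => s * sin th) _ _ _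
    (disc_polar th tr) (isd_id (cos th) t) (isd_id (sin th) t).
  by move: h; rewrite CReM.
- move=> t th tv Bth; apply: (hM (t, th)); split => //=.
  by rewrite in_itv/=; lra.
move=> t /andP[t0 t1]; have tr : `|t| < r by rewrite ltr_norml; lra.
have tdr (th : R) : is_derive th 1 (fun s => t^-1 * Im (G (t * cos s, t * sin s))) (dr t th).
  apply: isd_eq (isdM (isdC t^-1 th) (fth t th tr).2) _.
  by rewrite /dr CImM/=; field; rewrite gt_eqF.
rewrite (FTC_der pi0 (fun th _ => tdr th)).
  by rewrite mulr_natl cos2pi sin2pi cos0 sin0 subrr.
move=> th _.
apply: (@cont_comp _ _ _ (fun th => (t, th)) (fun q => dr q.1 q.2) th).
  by apply: cont_pair; [exact: cvg_cst|exact: cvg_id].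
exact: cont_dr.
Qed.

End disc.

Lemma max_principle (r M : R) (G G' : R * R -> C) : 1 < r -> hol (disc r) G G' ->
  (forall th, sqmod (G (cos th, sin th)) <= M) -> sqmod (G (0, 0)) <= M.
Proof.
(* The mean value property is applied to conj (G 0) * G, and AM-GM replaces |a| |b|. *)
move=> r1 hG hM; pose c : C := conjc (G (0, 0)).
have pi0 : 0 < 2 * pi :> R by rewrite mulr_gt0 ?pi_gt0.
have hcG := holM (hol_cst (D := disc r) c) hG.
have := circle_mean_Re r1 hcG.
have -> : Re (c * G (0, 0)) = sqmod (G (0, 0)).
  by rewrite /c /sqmod; case: (G (0, 0)) => a b /=; ring.
move=> E.
have h th : Re (c * G (cos th, sin th)) <= (sqmod (G (0, 0)) + M) / 2.
  apply: (@le_trans _ _ ((sqmod (G (0, 0)) + sqmod (G (cos th, sin th))) / 2)).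
    rewrite /c /sqmod; case: (G (0, 0)) => a b; case: (G _) => a' b' /=.
    have := sqr_ge0 (a - a'); have := sqr_ge0 (b - b'); nra.
  by rewrite ler_pM2r ?invr_gt0// lerD2l.
have : 2 * pi * sqmod (G (0, 0)) <= 2 * pi * ((sqmod (G (0, 0)) + M) / 2).
  have r0 : 0 < r by lra.
  have fin : (mu `[0%R, (2 * pi)%R]%classic < +oo)%E.
    by rewrite lebesgue_measure_itv/= lte_fin pi0 -EFinD ltry.
  rewrite -E; apply: (@le_trans _ _ (\int[mu]_(th in `[0, 2 * pi]) ((sqmod (G (0, 0)) + M) / 2))%R).
    apply: le_Rintegral => //.
    - apply: continuous_compact_integrable; first exact: segment_compact.
      apply: continuous_subspaceT => th.
      have D1 : disc r (cos th, sin th).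
        by rewrite /disc/= cos2Dsin2 exprn_egt1.
      have [_ _ [h1 _] _] := hcG _ D1.
      apply: (@cont_comp _ _ _ (fun th => (cos th, sin th)) (fun q => Re (c * G q)) th) => //.
      by apply: cont_pair; [exact: continuous_cos|exact: continuous_sin].
    - by apply: measurable_bounded_integrable => //; exact: bounded_cst.
  by rewrite Rintegral_cst//= lebesgue_measure_itv/= lte_fin pi0 -EFinD/= subr0 mulrC.
by rewrite ler_pM2l//; lra.
Qed.

End one_variable.

(** * Area mean value inequality *)

Section rational_boxes.
Context {R : realType}.
Local Notation P := (measurableTypeR R * measurableTypeR R)%type.

Lemma rat_approx (x d : R) : 0 < d -> exists q : rat, `|x - ratr q| < d.
Proof.
move=> d0; have [|q] := @rat_in_itvoo R (x - d) (x + d); first by lra.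
by rewrite in_itv/= => /andP[h1 h2]; exists q; rewrite ltr_norml; lra.
Qed.

Lemma rat_small (d : R) : 0 < d -> exists e : rat, 0 < (ratr e : R) < d.
Proof.
move=> d0; have [q] := @rat_in_itvoo R 0 d d0.
by rewrite in_itv/=; exists q.
Qed.

(** Countably many measurable boxes, to serve as the base in [measurable_fun_basis]. *)
Definition rbox n (i : n.-tuple (rat * rat) * rat) : set (n.-tuple P) :=
  [set t | forall j, `|(tnth t j).1 - ratr (tnth i.1 j).1| < ratr i.2 /\
                     `|(tnth t j).2 - ratr (tnth i.1 j).2| < ratr i.2].

Lemma measurable_ball_prod (a b e : R) :
  measurable [set p : P | `|p.1 - a| < e /\ `|p.2 - b| < e].
Proof.
rewrite (_ : [set p | _] = (ball a e `*` ball b e : set P)).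
  by apply: measurableX; exact: measurable_ball.
by apply/seteqP; split => -[x y] /=; rewrite /ball/= (distrC a) (distrC b).
Qed.

Lemma measurable_rbox n (i : n.-tuple (rat * rat) * rat) : measurable (rbox i).
Proof.
rewrite (_ : rbox i = \bigcap_(j in [set: 'I_n])
  ((fun t : n.-tuple P => tnth t j) @^-1` [set p : P | `|p.1 - ratr (tnth i.1 j).1| < ratr i.2 /\
                     `|p.2 - ratr (tnth i.1 j).2| < ratr i.2])).
  apply: fin_bigcap_measurable => // j _; rewrite -[X in measurable X]setTI.
  by apply: measurable_tnth => //; exact: measurable_ball_prod.
by apply/seteqP; split => [t h j _|t h j]; exact: (h j).
Qed.

Lemma rbox_basis n (t : n.-tuple P) (d : R) : 0 < d ->
  exists i, rbox i t /\ forall s, rbox i s -> forall j,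
    `|(tnth s j).1 - (tnth t j).1| < d /\ `|(tnth s j).2 - (tnth t j).2| < d.
Proof.
move=> d0; have d2 : 0 < d / 2 by rewrite divr_gt0.
have [e /andP[e0 ed]] := rat_small d2.
have /choice [a ha] : forall j : 'I_n, exists q : rat, `|(tnth t j).1 - ratr q| < ratr e.
  by move=> j; exact: rat_approx.
have /choice [b hb] : forall j : 'I_n, exists q : rat, `|(tnth t j).2 - ratr q| < ratr e.
  by move=> j; exact: rat_approx.
exists ([tuple (a j, b j) | j < n], e); split.
  by move=> j; rewrite !tnth_mktuple.
move=> s hs j; have [] := hs j; rewrite !tnth_mktuple/=.
move: (ha j) (hb j); rewrite !ltr_norml => h1 h2 h3 h4; lra.
Qed.

Lemma measurable_fun_tuple n (D : set (n.-tuple P)) (f : n.-tuple P -> \bar R) :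
  (forall t (a : R), D t -> (f t < a%:E)%E -> exists2 d : R, 0 < d &
    forall s, (forall j, `|(tnth s j).1 - (tnth t j).1| < d /\
                         `|(tnth s j).2 - (tnth t j).2| < d) ->
    D s -> (f s < a%:E)%E) ->
  measurable_fun D f.
Proof.
move=> hf; apply: (@measurable_fun_basis _ _ _ _ (@rbox n)).
  exact: measurable_rbox.
move=> t a Dt fta; have [d d0 hd] := hf t a Dt fta.
have [i [it hi]] := rbox_basis t d0.
by exists i; split => // s /hi hs Ds; exact: hd.
Qed.

Lemma measurable_fun_plane (D : set P) (f : R * R -> R) :
  (forall p, D p -> {for p, continuous f}) -> measurable_fun D (f : P -> R).
Proof.
move=> cf; apply/measurable_EFinP.
apply: (@measurable_fun_basis _ _ _ (rat * rat * rat)%type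
  (fun i => [set p : P | `|p.1 - ratr i.1.1| < ratr i.2 /\ `|p.2 - ratr i.1.2| < ratr i.2])).
  by move=> i; exact: measurable_ball_prod.
move=> [x y] a Dp; rewrite lte_fin => fa.
have : \forall q \near ((x, y) : R * R), f q < a.
  by have := cf _ Dp; rewrite /continuous_at => /cvgr_lt; exact.
move=> [[U V]] [/nbhs_ex[d1 hU] /nbhs_ex[d2 hV]] UV.
pose d := Num.min d1%:num d2%:num.
have d0 : 0 < d by rewrite lt_min; apply/andP; split.
have dh : 0 < d / 2 by rewrite divr_gt0.
have [e /andP[e0 ed]] := rat_small dh.
have [a1 k1] := rat_approx x e0; have [b1 k2] := rat_approx y e0.
exists (a1, b1, e); split => // -[x' y'] /= [h3 h4] _; rewrite lte_fin.
apply: (UV (x', y')); split => /=.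
  apply: hU; rewrite /ball/=; apply: (@lt_le_trans _ _ d); last by rewrite ge_min lexx.
  by move: k1 h3; rewrite !ltr_norml => k1 h3; lra.
apply: hV; rewrite /ball/=; apply: (@lt_le_trans _ _ d); last by rewrite ge_min lexx orbT.
by move: k2 h4; rewrite !ltr_norml => k2 h4; lra.
Qed.

End rational_boxes.

Section area.
Context {R : realType}.
Local Notation P := (measurableTypeR R * measurableTypeR R)%type.
Local Notation C := R[i].
Local Notation Re := (@complex.Re R).
Local Notation Im := (@complex.Im R).
Local Notation mu := (@lebesgue_measure R).

Lemma measurable_sq (r : R) : measurable (sq r : set P).
Proof. by apply: measurableX; exact: measurable_itv. Qed.

Lemma lebesgue_C_sq (r : R) : 0 <= r -> lebesgue_C (sq r : set P) = ((2 * r) ^+ 2)%:E.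
Proof.
move=> r0; have e : mu `[- r, r]%classic = (2 * r)%:E.
  rewrite lebesgue_measure_itv/= lte_fin; case: ifPn => h.
    by rewrite -EFinD opprK -mulr2n mulr_natl.
  by rewrite (_ : r = 0) ?mulr0//; lra.
rewrite /lebesgue_C product_measure1E; [|exact: measurable_itv..].
transitivity ((2 * r)%:E * (2 * r)%:E)%E; last by rewrite -EFinM expr2.
by congr (_ * _)%E; exact: e.
Qed.

Lemma integrable_sq (r : R) (f : R * R -> R) : 0 <= r ->
  (forall p, sq r p -> {for p, continuous f}) ->
  (@lebesgue_C R).-integrable (sq r : set P) (EFin \o (f : P -> R)).
Proof.
move=> r0 cf; apply: measurable_bounded_integrable.
- exact: measurable_sq.
- change (lebesgue_C (sq r : set P) < +oo)%E.
  by rewrite lebesgue_C_sq// ltry.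
- exact: measurable_fun_plane.
have cK : compact (sq r) by apply: compact_setX; exact: segment_compact.
have [M hM] := compact_bounded_for cK cf.
exists M; split; first exact: num_real.
by move=> x Mx p /hM /le_trans; apply; exact: ltW.
Qed.

Lemma integral_sq0_r (r : R) (h : R * R -> R) :
  (@lebesgue_C R).-integrable (sq r : set P) (EFin \o (h : P -> R)) ->
  (forall x, x \in `[- r, r] -> (\int[mu]_(y in `[(- r)%R, r]) (h (x, y))%:E = 0)%E) ->
  (\int[@lebesgue_C R]_(p in (sq r : set P)) (h p)%:E = 0)%E.
Proof.
move=> ih h0; rewrite integral_mkcond.
have ih' := (integrable_mkcond _ (measurable_sq r)).1 ih.
have := @integral12_prod_meas1 _ _ _ _ _ mu mu _ ih'.
rewrite /lebesgue_C => <-; apply: integral0_eq => x _; rewrite /fubini_F.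
have [xI|xI] := boolP (x \in `[- r, r]).
  rewrite -[RHS](h0 x xI) [RHS]integral_mkcond.
  apply: eq_integral => y _; rewrite /patch !mem_setE.
  by rewrite /sq in_setX !mem_setE xI.
apply: integral0_eq => y _; rewrite /patch /sq in_setX !mem_setE (negbTE xI)//.
Qed.

Lemma integral_sq0_l (r : R) (h : R * R -> R) :
  (@lebesgue_C R).-integrable (sq r : set P) (EFin \o (h : P -> R)) ->
  (forall y, y \in `[- r, r] -> (\int[mu]_(x in `[(- r)%R, r]) (h (x, y))%:E = 0)%E) ->
  (\int[@lebesgue_C R]_(p in (sq r : set P)) (h p)%:E = 0)%E.
Proof.
move=> ih h0; rewrite integral_mkcond.
have ih' := (integrable_mkcond _ (measurable_sq r)).1 ih.
have := @integral21_prod_meas1 _ _ _ _ _ mu mu _ ih'.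
rewrite /lebesgue_C => <-; apply: integral0_eq => y _; rewrite /fubini_G.
have [xI|xI] := boolP (y \in `[- r, r]).
  rewrite -[RHS](h0 y xI) [RHS]integral_mkcond.
  apply: eq_integral => x _; rewrite /patch !mem_setE.
  by rewrite /sq in_setX !mem_setE xI andbT.
by apply: integral0_eq => x _; rewrite /patch /sq in_setX !mem_setE (negbTE xI) andbF.
Qed.

(** Squaring makes the positive part continuously differentiable: at 0 the secant slope is the
    positive part itself. *)
Lemma isd_pos2 (u : R) : is_derive u 1 (fun s => Num.max s 0 ^+ 2) (2 * Num.max u 0).
Proof.
have [u0|u0|->] := ltgtP u 0.
- rewrite mulr0.
  apply: near_eq_is_derive (isdC 0 u); near=> s.
  have s0 : s < 0 by near: s; exact: lt_nbhsl.
  by rewrite (max_idPr (ltW s0)) expr0n.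
- apply: near_eq_is_derive (isd_eq (isdX2 (isdI u)) (mulr1 _)); near=> s.
  have s0 : 0 < s by near: s; exact: lt_nbhsr.
  by rewrite (max_idPl (ltW s0)).
rewrite mulr0; apply/is_derive1_caratheodory.
exists (fun s => Num.max s 0); split.
- move=> z; rewrite maxxx expr0n/= !subr0 expr2.
  by case: (leP z 0) => // z0; rewrite !mul0r.
- by apply: continuous_max; [exact: cvg_id|exact: cvg_cst].
- by rewrite maxxx.
Unshelve. all: by end_near. Qed.

Section kernel.
Variables (r r0 : R) (G G' : R * R -> C).
Hypotheses (rp : 0 < r) (rr0 : r < r0) (hG : hol (osq r0) G G').

(** [rho] replaces the indicator of the disc of radius r. It is radial, continuously differentiable,
    and zero on the edges of [sq r], so integration by parts over the square leaves no boundary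
    term. *)
Let pos (p : R * R) : R := Num.max (r ^+ 2 - p.1 ^+ 2 - p.2 ^+ 2) 0.
Let rho p := pos p ^+ 2.

Let cpos (p : R * R) : {for p, continuous pos}.
Proof.
apply: continuous_max; last exact: cvg_cst.
apply: contB; last by apply: contX; exact: cont_snd.
by apply: contB; [exact: cont_cst|apply: contX; exact: cont_fst].
Qed.

Let crho (p : R * R) : {for p, continuous rho}.
Proof. by apply: contX; exact: cpos. Qed.

Let open_osq : open (osq r0).
Proof. rewrite (_ : osq r0 = fst @^-1` `]- r0, r0[ `&` snd @^-1` `]- r0, r0[)//.
by apply: openI; apply: open_comp; try exact: interval_open; move=> p _;
  [exact: cont_fst|exact: cont_snd]. Qed.

Let tin t p : - (r0 / r) < t < r0 / r -> sq r p -> osq r0 (t * p.1, t * p.2).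
Proof.
move=> ht [] /=; rewrite !in_itv/= -!ler_norml => h1 h2.
have t0 : `|t| < r0 / r by rewrite ltr_norml.
have H x : `|x| <= r -> t * x \in `]- r0, r0[.
  move=> xr; rewrite in_itv/= -ltr_norml normrM.
  rewrite ltr_pdivlMr// in t0; apply: le_lt_trans t0.
  by rewrite ler_wpM2l.
by split; apply: H.
Qed.

Let isd_id (c t : R) : is_derive t 1 (fun s => s * c) c.
Proof. by apply: isd_eq (isdM (isdI t) (isdC c t)) _; ring. Qed.

Let isd_id' (c t : R) : is_derive t 1 (fun s => c * s) c.
Proof. by apply: isd_eq (isdM (isdC c t) (isdI t)) _; ring. Qed.

Let cmul (t : R) (p : R * R) : {for p, continuous (fun q : R * R => (t * q.1, t * q.2))}.
Proof.
by apply: cont_pair; apply: contM; [exact: cont_cst|exact: cont_fst|exact: cont_cst|exact: cont_snd].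
Qed.

Let cG t p (F : R * R -> R) : {for (t * p.1, t * p.2), continuous F} ->
  {for p, continuous (fun q : R * R => F (t * q.1, t * q.2))}.
Proof. exact: (@cont_comp _ _ _ (fun q : R * R => (t * q.1, t * q.2)) F p (@cmul t p)). Qed.

Let df (t : R) (p : R * R) : R :=
  rho p * (p.1 * Re (G' (t * p.1, t * p.2)) - p.2 * Im (G' (t * p.1, t * p.2))).

(* By Cauchy-Riemann t times [df] is [rho] times the angular derivative of
   Im (G (t p)), whose integral vanishes because [rho] is radial. *)
Lemma kernel_mean_Re :
  (\int[@lebesgue_C R]_(p in (sq r : set P)) (rho p * Re (G p)) =
   \int[@lebesgue_C R]_(p in (sq r : set P)) (rho p * Re (G (0, 0))))%R.
Proof.
pose f t (p : P) := rho p * Re (G (t * p.1, t * p.2)).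
have q1 : 1 < r0 / r by rewrite ltr_pdivlMr// mul1r.
pose v := (1 + r0 / r) / 2.
have v1 : 1 < v by have /midf_lt[] := q1.
have vr : v < r0 / r by have /midf_lt[] := q1.
have v0 : 0 < v by lra.
have tv t : - v < t < v -> - (r0 / r) < t < r0 / r by move=> ?; lra.
have cK : compact (`[- v, v] `*` sq r : set (R * (R * R))).
  apply: compact_setX; first exact: segment_compact.
  by apply: compact_setX; exact: segment_compact.
have [|M hM] := @compact_bounded_for _ _ _ (fun q => df q.1 q.2) cK.
  move=> [t p] [/=]; rewrite in_itv/= => /andP[? ?] sp.
  have /hG[_ _ _ [c1 c2]] : osq r0 (t * p.1, t * p.2) by apply: tin => //; lra.
  have cf : {for (t, p), continuous (fun q : R * (R * R) => (q.1 * q.2.1, q.1 * q.2.2))}.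
    apply: cont_pair; apply: contM; try exact: cont_fst.
      by apply: cont_comp; [exact: cont_snd|exact: cont_fst].
    by apply: cont_comp; [exact: cont_snd|exact: cont_snd].
  apply: contM; first by apply: cont_comp; [exact: cont_snd|exact: crho].
  apply: contB; apply: contM.
  - by apply: cont_comp; [exact: cont_snd|exact: cont_fst].
  - exact: (@cont_comp _ _ _ (fun q : R * (R * R) => (q.1 * q.2.1, q.1 * q.2.2)) (fun q => Re (G' q)) (t, p) cf c1).
  - by apply: cont_comp; [exact: cont_snd|exact: cont_snd].
  - exact: (@cont_comp _ _ _ (fun q : R * (R * R) => (q.1 * q.2.1, q.1 * q.2.2)) (fun q => Im (G' q)) (t, p) cf c2).
have fin : (lebesgue_C (sq r : set P) < +oo)%E by rewrite lebesgue_C_sq ?ltry// ltW.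
have H := @Rintegral_const_param _ _ _ (@lebesgue_C R) (sq r : set P) f df (- v) v M
  (measurable_sq r) fin _ v1.
transitivity (\int[@lebesgue_C R]_(p in (sq r : set P)) f 1 p)%R.
  by apply: eq_Rintegral => -[x y] _; rewrite /f !mul1r.
transitivity (\int[@lebesgue_C R]_(p in (sq r : set P)) f 0 p)%R; last first.
  by apply: eq_Rintegral => -[x y] _; rewrite /f !mul0r.
symmetry; apply: H.
- by rewrite oppr_lt0.
- move=> t /tv ht; apply: integrable_sq; first exact: ltW.
  move=> p sp; have /hG[_ _ [c1 c2] _] := tin ht sp.
  by apply: contM; [exact: crho|exact: (@cG t p (fun q => Re (G q)))].
- move=> t p /tv ht sp.
  have [h _] := @hol_curve _ _ _ _ open_osq hG (fun s => s * p.1) (fun s => s * p.2) _ _ _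
    (tin ht sp) (isd_id p.1 t) (isd_id p.2 t).
  apply: isd_eq (isdM (isdC (rho p) t) h) _.
  by rewrite mul0r add0r CReM.
- move=> t p /andP[t1 t2] sp; apply: (hM (t, p)); split => //=.
  by rewrite in_itv/=; apply/andP; split; exact: ltW.
move=> t /andP[t0 t1]; have ht : - (r0 / r) < t < r0 / r by lra.
have hGt p : sq r p -> ccont G (t * p.1, t * p.2) /\ ccont G' (t * p.1, t * p.2).
  by move=> /(tin ht) /hG[].
(* With (x, y) = p, [A] is the y-derivative of rho x Im (G (t p)) and [B] the x-derivative of rho y
   Im (G (t p)). The derivatives of [rho] cancel in A - B because [rho] is radial, which leaves t
   times [df]; [A] and [B] each integrate to 0 because [rho] vanishes on the edges. *)
pose A (p : R * R) := - 4 * pos p * p.2 * p.1 * Im (G (t * p.1, t * p.2)) +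
  rho p * p.1 * (t * Re (G' (t * p.1, t * p.2))).
pose B (p : R * R) := - 4 * pos p * p.1 * p.2 * Im (G (t * p.1, t * p.2)) +
  rho p * p.2 * (t * Im (G' (t * p.1, t * p.2))).
have dposr (x y : R) : is_derive y 1 (fun s => rho (x, s)) (- 4 * pos (x, y) * y).
  have h1 : is_derive y 1 (fun s => r ^+ 2 - x ^+ 2 - s ^+ 2) (- (2 * y)).
    by apply: isd_eq (isdB (isdC (r ^+ 2 - x ^+ 2) y) (isdX2 (isdI y))) _; ring.
  by apply: isd_eq (isd_comp (@isd_pos2 _) h1) _; rewrite /pos/=; ring.
have dposl (x y : R) : is_derive x 1 (fun s => rho (s, y)) (- 4 * pos (x, y) * x).
  have h1 : is_derive x 1 (fun s => r ^+ 2 - s ^+ 2 - y ^+ 2) (- (2 * x)).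
    by apply: isd_eq (isdB (isdB (isdC (r ^+ 2) x) (isdX2 (isdI x))) (isdC (y ^+ 2) x)) _; ring.
  by apply: isd_eq (isd_comp (@isd_pos2 _) h1) _; rewrite /pos/=; ring.
have cA p : sq r p -> {for p, continuous A}.
  move=> /hGt[[c1 c2] [c3 c4]]; apply: contD; last first.
    apply: contM; first by apply: contM; [exact: crho|exact: cont_fst].
    by apply: contM; [exact: cont_cst|exact: (@cG t p (fun q => Re (G' q)))].
  apply: contM; last exact: (@cG t p (fun q => Im (G q))).
  apply: contM; last exact: cont_fst.
  apply: contM; last exact: cont_snd.
  by apply: contM; [exact: cont_cst|exact: cpos].
have cB p : sq r p -> {for p, continuous B}.
  move=> /hGt[[c1 c2] [c3 c4]]; apply: contD; last first.
    apply: contM; first by apply: contM; [exact: crho|exact: cont_snd].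
    by apply: contM; [exact: cont_cst|exact: (@cG t p (fun q => Im (G' q)))].
  apply: contM; last exact: (@cG t p (fun q => Im (G q))).
  apply: contM; last exact: cont_snd.
  apply: contM; last exact: cont_fst.
  by apply: contM; [exact: cont_cst|exact: cpos].
have iA := integrable_sq (ltW rp) cA.
have iB := integrable_sq (ltW rp) cB.
have rr : - r < r by rewrite -subr_gt0 opprK addr_gt0.
have rho0r x : rho (x, r) = 0 /\ rho (x, - r) = 0.
  rewrite /rho /pos /= sqrrN; have -> : r ^+ 2 - x ^+ 2 - r ^+ 2 = - x ^+ 2 by ring.
  by rewrite (max_idPr _) ?oppr_le0 ?sqr_ge0// expr0n.
have rho0l x : rho (r, x) = 0 /\ rho (- r, x) = 0.
  rewrite /rho /pos /= sqrrN; have -> : r ^+ 2 - r ^+ 2 - x ^+ 2 = - x ^+ 2 by ring.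
  by rewrite (max_idPr _) ?oppr_le0 ?sqr_ge0// expr0n.
have A0 : (\int[@lebesgue_C R]_(p in (sq r : set P)) (A p)%:E = 0)%E.
  apply: integral_sq0_r => // x xI.
  have h1 (y : R) : y \in `[- r, r] ->
      is_derive y 1 (fun y => rho (x, y) * x * Im (G (t * x, t * y))) (A (x, y)).
    move=> yI; have sp : sq r (x, y) by [].
    have [_ h] := @hol_curve _ _ _ _ open_osq hG (fun s => t * x) (fun s => t * s) y _ _
      (tin ht sp) (isdC _ _) (isd_id' t y).
    apply: isd_eq (isdM (isdM (dposr x y) (isdC x y)) h) _.
    by rewrite /A CImM/=; ring.
  have h2 (y : R) : y \in `[- r, r] -> {for y, continuous (fun y => A (x, y))}.
    move=> yI; apply: (@cont_comp _ _ _ (fun y => (x, y)) A y); last exact: cA.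
    by apply: cont_pair; [exact: cvg_cst|exact: cvg_id].
  rewrite (FTC_der rr h1 h2).
  by have [-> ->] := rho0r x; rewrite !mul0r subrr.
have B0 : (\int[@lebesgue_C R]_(p in (sq r : set P)) (B p)%:E = 0)%E.
  apply: integral_sq0_l => // y yI.
  have h1 (x : R) : x \in `[- r, r] ->
      is_derive x 1 (fun x => rho (x, y) * y * Im (G (t * x, t * y))) (B (x, y)).
    move=> xI; have sp : sq r (x, y) by [].
    have [_ h] := @hol_curve _ _ _ _ open_osq hG (fun s => t * s) (fun s => t * y) x _ _
      (tin ht sp) (isd_id' t x) (isdC _ _).
    apply: isd_eq (isdM (isdM (dposl x y) (isdC y x)) h) _.
    by rewrite /B CImM/=; ring.
  have h2 (x : R) : x \in `[- r, r] -> {for x, continuous (fun x => B (x, y))}.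
    move=> xI; apply: (@cont_comp _ _ _ (fun x => (x, y)) B x); last exact: cB.
    by apply: cont_pair; [exact: cvg_id|exact: cvg_cst].
  rewrite (FTC_der rr h1 h2).
  by have [-> ->] := rho0l y; rewrite !mul0r subrr.
rewrite (eq_integral (fun p : P => (t^-1)%:E * ((A p)%:E - (B p)%:E))%E); last first.
  move=> p _; rewrite -EFinB -EFinM; congr EFin; rewrite /df /A /B.
  by field; rewrite gt_eqF.
rewrite integralZl//; [|exact: measurable_sq|].
  rewrite integralB ?A0 ?B0 ?subee ?mule0//; exact: measurable_sq.
by apply: integrableB => //; exact: measurable_sq.
Qed.

End kernel.

(** The kernel identity for conj (G 0) * G and AM-GM give the mean value inequality for |G|^2
    against [rho]. The constant comes from rho <= r^4 everywhere and rho >= r^4 / 4 on [sq (r / 2)],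
    a square of area r^2. *)
Lemma sqmod_area (r r0 : R) (G G' : R * R -> C) : 0 < r -> r < r0 ->
  hol (osq r0) G G' ->
  ((r ^+ 2 / 4 * sqmod (G (0, 0)))%:E <=
   \int[@lebesgue_C R]_(p in (sq r : set P)) (sqmod (G p))%:E)%E.
Proof.
move=> rp rr0 hG; pose c : C := conjc (G (0, 0)).
have hcG := holM (hol_cst (D := osq r0) c) hG.
have := kernel_mean_Re rp rr0 hcG.
set rho := fun p : R * R => Num.max (r ^+ 2 - p.1 ^+ 2 - p.2 ^+ 2) 0 ^+ 2.
set s0 := sqmod (G (0, 0)).
have e0 : Re (c * G (0, 0)) = s0.
  by rewrite /s0 /c /sqmod; case: (G (0, 0)) => a b /=; ring.
rewrite e0 => E.
have crho p : {for p, continuous rho}.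
  apply: contX; apply: continuous_max; last exact: cvg_cst.
  apply: contB; last by apply: contX; exact: cont_snd.
  by apply: contB; [exact: cont_cst|apply: contX; exact: cont_fst].
have sub p : sq r p -> osq r0 p.
  by move=> [] /=; rewrite !in_itv/= => h1 h2; split; rewrite /= in_itv/=; lra.
have cf p : sq r p -> {for p, continuous (fun p => sqmod (G p))}.
  by move=> /sub/hG[_ _ [c1 c2] _]; apply: contD; apply: contX.
have csq (h : R * R -> R) p : {for p, continuous h} ->
    {for p, continuous (fun p => rho p * h p)}.
  by move=> ch; apply: contM => //; exact: crho.
have icst c0 : (@lebesgue_C R).-integrable (sq r : set P) (EFin \o (fun p : P => rho p * c0)).
  by apply: integrable_sq; [exact: ltW|move=> p _; apply: csq; exact: cont_cst].
have iG : (@lebesgue_C R).-integrable (sq r : set P) (EFin \o (fun p : P => rho p * sqmod (G p))).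
  by apply: integrable_sq; [exact: ltW|move=> p sp; apply: csq; exact: cf].
have rho0 p : 0 <= rho p by exact: sqr_ge0.
have rhor p : rho p <= r ^+ 4.
  rewrite (_ : r ^+ 4 = (r ^+ 2) ^+ 2); last by rewrite -exprM.
  rewrite lerXn2r ?nnegrE ?le_max ?lexx ?orbT ?sqr_ge0// ge_max sqr_ge0 andbT.
  by have := sqr_ge0 p.1; have := sqr_ge0 p.2; lra.
have [m2 m4] : measurable (sq (r / 2) : set P) /\ measurable (sq r : set P).
  by split; exact: measurable_sq.
have s00 : 0 <= s0 by exact: sqmod_ge0.
have key : (\int[@lebesgue_C R]_(p in (sq r : set P)) (rho p * s0) <=
    \int[@lebesgue_C R]_(p in (sq r : set P)) (rho p * sqmod (G p)))%R.
  have : (\int[@lebesgue_C R]_(p in (sq r : set P)) (rho p * s0) <=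
    \int[@lebesgue_C R]_(p in (sq r : set P)) (2^-1 * (rho p * s0 + rho p * sqmod (G p))))%R.
    have i2 : (@lebesgue_C R).-integrable (sq r : set P)
        (EFin \o (fun p : P => 2^-1 * (rho p * s0 + rho p * sqmod (G p)))).
      apply: integrable_sq; first exact: ltW.
      move=> p sp; apply: contM; first exact: cont_cst.
      by apply: contD; apply: csq; [exact: cont_cst|exact: cf].
    rewrite -E; apply: le_Rintegral => //.
      apply: integrable_sq; first exact: ltW.
      by move=> p /sub/hcG[_ _ [c1 c2] _]; exact: csq.
    move=> p _; rewrite -mulrDr mulrCA ler_wpM2l ?rho0//.
    rewrite /s0 /c /sqmod; case: (G (0, 0)) => a b; case: (G p) => a' b' /=.
    by have := sqr_ge0 (a - a'); have := sqr_ge0 (b - b'); nra.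
  rewrite RintegralZl//; last first.
    apply: integrable_sq; first exact: ltW.
    by move=> p sp; apply: contD; apply: csq; [exact: cont_cst|exact: cf].
  by rewrite RintegralD//; lra.
have low : r ^+ 4 / 4 * r ^+ 2 * s0 <= (\int[@lebesgue_C R]_(p in (sq r : set P)) (rho p * s0))%R.
  rewrite -lee_fin /Rintegral fineK; last exact: integrable_fin_num (icst s0).
  apply: (@le_trans _ _ (\int[@lebesgue_C R]_(p in (sq (r / 2) : set P)) (r ^+ 4 / 4 * s0)%:E)%E).
    rewrite integral_cst//.
    have -> : Defs_lebesgue_C__canonical__measure_function_Measure R (sq (r / 2) : set P) = ((2 * (r / 2)) ^+ 2)%:E.
      by apply: lebesgue_C_sq; rewrite divr_ge0 ?ltW.
    by rewrite -EFinM lee_fin le_eqVlt; apply/orP; left; apply/eqP; field.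
  apply: (@le_trans _ _ (\int[@lebesgue_C R]_(p in (sq (r / 2) : set P)) (rho p * s0)%:E)%E).
    apply: ge0_le_integral => //.
    - by move=> p _; rewrite lee_fin mulr_ge0// divr_ge0// exprn_ge0// ltW.
    - apply/measurable_EFinP; apply: measurable_fun_plane => p _.
      by apply: csq; exact: cont_cst.
    - move=> p [] /=; rewrite !in_itv/= => h1 h2; rewrite lee_fin ler_wpM2r//.
      rewrite (_ : _ / 4 = (r ^+ 2 / 2) ^+ 2); last by field.
      rewrite lerXn2r ?nnegrE ?le_max ?lexx ?orbT// ?divr_ge0 ?sqr_ge0//.
      have h3 : p.1 ^+ 2 <= (r / 2) ^+ 2 by nra.
      have h4 : p.2 ^+ 2 <= (r / 2) ^+ 2 by nra.
      by move: h3 h4; rewrite expr_div_n; lra.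
  apply: ge0_subset_integral => //.
  - apply/measurable_EFinP; apply: measurable_fun_plane => p _.
    by apply: csq; exact: cont_cst.
  - by move=> p _; rewrite lee_fin mulr_ge0.
  - by move=> p [] /=; rewrite !in_itv/= => h1 h2; split; rewrite /= in_itv/=; lra.
have up : ((\int[@lebesgue_C R]_(p in (sq r : set P)) (rho p * sqmod (G p)))%R%:E <=
    (r ^+ 4)%:E * \int[@lebesgue_C R]_(p in (sq r : set P)) (sqmod (G p))%:E)%E.
  rewrite /Rintegral fineK; last exact: integrable_fin_num iG.
  rewrite -ge0_integralZl//.
  - apply: ge0_le_integral => //.
    + by move=> p _; rewrite lee_fin mulr_ge0// sqmod_ge0.
    + by apply/measurable_EFinP; apply: measurable_fun_plane => p sp; apply: csq; exact: cf.
    + apply/measurable_EFinP; apply: measurable_fun_plane => p sp.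
      by apply: contM; [exact: cont_cst|exact: cf].
    + by move=> p _; rewrite -EFinM lee_fin ler_wpM2r// sqmod_ge0.
  - by apply/measurable_EFinP; apply: measurable_fun_plane => p sp; exact: cf.
  - by move=> p _; rewrite lee_fin sqmod_ge0.
  - by rewrite lee_fin exprn_ge0// ltW.
have r40 : 0 < r ^+ 4 by rewrite exprn_gt0.
rewrite -(@lee_pmul2l _ (r ^+ 4)%:E) ?lte_fin//.
apply: le_trans up; rewrite -EFinM lee_fin; apply: le_trans key.
by apply: le_trans low; rewrite le_eqVlt; apply/orP; left; apply/eqP; ring.
Qed.

End area.

(** * Translation invariance and iterated mean value inequalities *)

Section translation.
Context {R : realType}.
Local Notation M := (measurableTypeR R).
Local Notation P := (measurableTypeR R * measurableTypeR R)%type.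
Local Notation C := R[i].
Local Notation mu := (@lebesgue_measure R).

Lemma lebesgue_measure_translate (c : R) (A : set M) : measurable A ->
  pushforward mu ((fun x : M => c + x) : M -> M) A = mu A.
Proof.
move=> mA.
have h : measurable_fun setT (fun x : M => (c + x : M)).
  by apply: measurable_funD; [exact: measurable_cst|exact: measurable_id].
have H := @lebesgue_measure_unique R
  (measure_function_pushforward__canonical__measure_function_Measure mu h).
symmetry; apply: H => //.
move=> _ [[a b] _ <-]; rewrite /= /pushforward.
have -> : (fun x : M => c + x) @^-1` `]a, b]%classic = (`]a - c, b - c]%classic : set M).
  by apply/seteqP; split => x /=; rewrite !in_itv/=; lra.
rewrite !lebesgue_measure_itv/= !lte_fin ltrD2r.
by case: ifPn => // _; rewrite -!EFinD; congr EFin; ring.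
Qed.

Definition translate (c : P) : P -> P := fun p => (c.1 + p.1, c.2 + p.2).

Lemma measurable_translate c : measurable_fun setT (translate c).
Proof.
have h (d : R) : measurable_fun setT (fun x : M => (d + x : M)).
  by apply: measurable_funD; [exact: measurable_cst|exact: measurable_id].
by apply/measurable_fun_pairP; split; apply: (measurableT_comp (h _)).
Qed.

Lemma lebesgue_C_translate (c : P) (A : set P) : measurable A ->
  pushforward (@lebesgue_C R) (translate c) A = lebesgue_C A.
Proof.
move=> mA; rewrite [RHS]/lebesgue_C; apply/esym.
apply: (@product_measure_unique _ _ _ _ _ mu mu
  (measure_function_pushforward__canonical__measure_function_Measure (@lebesgue_C R)
    (measurable_translate c))) => // {mA}A B mA mB.
rewrite /= /pushforward.
have -> : translate c @^-1` (A `*` B) =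
   ((fun x : M => c.1 + x) @^-1` A) `*` ((fun x : M => c.2 + x) @^-1` B) by [].
have h (d : R) : measurable_fun setT (fun x : M => (d + x : M)).
  by apply: measurable_funD; [exact: measurable_cst|exact: measurable_id].
rewrite /lebesgue_C product_measure1E//.
- by congr (_ * _)%E; exact: lebesgue_measure_translate.
- by rewrite -[X in measurable X]setTI; exact: h.
- by rewrite -[X in measurable X]setTI; exact: h.
Qed.

Lemma integral_translate (c : P) (f : P -> \bar R) :
  measurable_fun setT f -> (forall p, 0 <= f p)%E ->
  (\int[@lebesgue_C R]_p f p = \int[@lebesgue_C R]_p f (translate c p))%E.
Proof.
move=> mf f0.
have := @ge0_integral_pushforward _ _ _ _ R (translate c) (measurable_translate c)
  (@lebesgue_C R) setT f measurableT mf (fun x _ => f0 x).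
rewrite preimage_setT => <-.
apply: eq_measure_integral; first exact: measurable_translate.
by move=> mt A mA _; exact/esym/lebesgue_C_translate.
Qed.

End translation.

Section tuple_area.
Context {R : realType}.
Local Notation P := (measurableTypeR R * measurableTypeR R)%type.
Local Notation lam := (@lebesgue_C R).

Definition upd n (t : n.-tuple P) (j : 'I_n) (p : P) : n.-tuple P :=
  [tuple if k == j then p else tnth t k | k < n].

Lemma upd_tcons0 n (p q : P) (t : n.-tuple P) :
  upd (tcons (p, t)) ord0 q = tcons (q, t).
Proof.
apply/eq_from_tnth => k; rewrite tnth_mktuple.
by case: (unliftP ord0 k) => [k' ->|->]; rewrite ?eqxx// tnthS tnthS.
Qed.

Lemma upd_tconsS n (p q : P) (t : n.-tuple P) (j : 'I_n) :
  upd (tcons (p, t)) (lift ord0 j) q = tcons (p, upd t j q).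
Proof.
apply/eq_from_tnth => k; rewrite tnth_mktuple.
case: (unliftP ord0 k) => [k' ->|->] //.
by rewrite (inj_eq lift_inj) !tnthS tnth_mktuple.
Qed.

Lemma integral_tcons n (F : n.+1.-tuple P -> \bar R) :
  measurable_fun setT F -> (forall t, 0 <= F t)%E ->
  (\int[power_measure lam n.+1]_t F t =
   \int[power_measure lam n]_t \int[lam]_p F (tcons (p, t)))%E.
Proof.
move=> mF F0.
have mcomp : measurable_fun setT (F \o @tcons _ P n).
  by apply: measurableT_comp => //; exact: measurable_tcons.
transitivity (\int[(lam \x power_measure lam n)%E]_z (F \o @tcons _ P n) z)%E.
  have := @ge0_integral_pushforward _ _ _ _ R (@tcons _ P n) (@measurable_tcons _ P n)
    (lam \x power_measure lam n)%E setT F measurableT mF (fun x _ => F0 x).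
  by rewrite preimage_setT => <-.
rewrite (@fubini_tonelli2 _ _ _ _ _ lam (power_measure lam n))//.
by move=> z; exact: F0.
Qed.

(** Iterates a one-coordinate inequality. It is assumed for every [t], not only for [t] near [c], so
    that the induction may freeze the first entry at its centre and integrate the others; the
    application makes this true by cutting [F] off to a box. *)
Lemma tuple_area n (c : n.-tuple P) (K : R) (F : n.-tuple P -> \bar R) : 0 <= K ->
  measurable_fun setT F -> (forall t, 0 <= F t)%E ->
  (forall t j, K%:E * F (upd t j (tnth c j)) <= \int[lam]_p F (upd t j p))%E ->
  ((K ^+ n)%:E * F c <= \int[power_measure lam n]_t F t)%E.
Proof.
move=> K0; elim: n c F => [|n ih] c F mF F0 hF.
  rewrite expr0 mul1e tuple0.
  rewrite (_ : power_measure lam 0 = \d_([tuple] : 0.-tuple P) :> (set _ -> _))//.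
  by rewrite integral_dirac// diracT mul1e.
case/tupleP: c hF => p c hF; rewrite integral_tcons//.
have tc : [tuple of p :: c] = tcons (p, c) by exact: val_inj.
have mS (q : P) : measurable_fun setT (fun t : n.-tuple P => F (tcons (q, t))).
  apply: measurableT_comp => //; apply: measurableT_comp; first exact: measurable_tcons.
  exact: measurable_pair1.
have mF' : measurable_fun setT (F \o @tcons _ P n).
  by apply: measurableT_comp => //; exact: measurable_tcons.
have := ih c (fun t => F (tcons (p, t))) (mS p) (fun=> F0 _).
move=> /(_ _)H.
have {}H : ((K ^+ n)%:E * F (tcons (p, c)) <=
    \int[power_measure lam n]_t F (tcons (p, t)))%E.
  apply: H => t j; have := hF (tcons (p, t)) (lift ord0 j).
  rewrite upd_tconsS tnthS; under eq_integral do rewrite upd_tconsS.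
  exact.
rewrite tc exprS EFinM -muleA.
apply: (@le_trans _ _ (K%:E * \int[power_measure lam n]_t F (tcons (p, t)))%E).
  by rewrite lee_wpmul2l// lee_fin.
rewrite -ge0_integralZl//.
apply: ge0_le_integral => //.
- by move=> t _; rewrite mule_ge0.
- by apply: measurable_funeM; exact: mS.
- have := @measurable_fun_fubini_tonelli_G _ _ _ _ _ lam _ mF' (fun=> F0 _).
  exact.
- move=> t _; have := hF (tcons (p, t)) ord0.
  by rewrite upd_tcons0; under eq_integral do rewrite upd_tcons0.
Qed.

End tuple_area.

(** * Coordinate boxes and the topology of C^n *)

Section topology.
Context {R : realType} {n : nat}.
Local Notation C := R[i].
Local Notation Re := (@complex.Re R).
Local Notation Im := (@complex.Im R).
Local Notation V := 'rV[R[i]]_n.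
Implicit Types (z v : V).

Definition box z (e : R) : set V := [set y | forall j,
  `|Re (y 0 j) - Re (z 0 j)| < e /\ `|Im (y 0 j) - Im (z 0 j)| < e].

Definition cbox z (e : R) : set V := [set y | forall j,
  `|Re (y 0 j) - Re (z 0 j)| <= e /\ `|Im (y 0 j) - Im (z 0 j)| <= e].

Lemma normC_lt (a : C) (e : R) : `|Re a| < e / 2 -> `|Im a| < e / 2 -> `|a| < e%:C%C.
Proof.
move=> h1 h2; rewrite normc_def ltcR.
have e0 : 0 < e by have := normr_ge0 (Re a); lra.
rewrite -[ltRHS]ger0_norm ?(ltW e0)// -sqrtr_sqr ltr_sqrt ?exprn_gt0//.
rewrite -[Re a ^+ 2]real_normK ?num_real// -[Im a ^+ 2]real_normK ?num_real//.
have := normr_ge0 (Re a); have := normr_ge0 (Im a); nra.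
Qed.

Lemma ReIm_le_normC (a : C) (e : R) : `|a| < e%:C%C -> `|Re a| < e /\ `|Im a| < e.
Proof.
rewrite normc_def ltcR => h.
have h1 := sqrtr_ge0 (Re a ^+ 2 + Im a ^+ 2).
split; apply: le_lt_trans h; rewrite -sqrtr_sqr ler_sqrt ?addr_ge0 ?sqr_ge0//.
  by rewrite lerDl sqr_ge0.
by rewrite lerDr sqr_ge0.
Qed.

Lemma nbhs_boxP z (U : set V) : nbhs z U <-> exists2 e : R, 0 < e & box z e `<=` U.
Proof.
split.
  move=> /nbhs_ballP[e /= e0 eU]; have e0' := e0.
  (* The radius of a ball is an element of [R[i]]; being positive, it is real. *)
  move: e0; rewrite ltcE/= => /andP[/eqP ei er].
  exists (Re e / 2); first by rewrite divr_gt0.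
  move=> y zy; apply: eU; split => // i j; rewrite ord1.
  have -> : e = (Re e)%:C%C by apply: Ceq.
  rewrite -ball_normE /=; have [h1 h2] := zy j.
  by apply: normC_lt; rewrite ?CReB ?CImB distrC.
move=> [e e0 eU]; apply/nbhs_ballP; exists e%:C%C; first by rewrite /= ltcR.
move=> y [_ zy]; apply: eU => j; have := zy 0 j.
rewrite -ball_normE/= => /ReIm_le_normC.
by case: (z 0 j); case: (y 0 j) => ? ? ? ? /=; rewrite distrC [X in _ /\ X < _]distrC.
Qed.

Lemma cont_coordP (T : topologicalType) (h : T -> V) (p : T) :
  (forall j, ccont (fun q => h q 0 j) p) -> {for p, continuous h}.
Proof.
move=> ch U /nbhs_boxP[e e0 eU].
have : \forall q \near p, forall j, `|Re (h q 0 j) - Re (h p 0 j)| < e /\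
                              `|Im (h q 0 j) - Im (h p 0 j)| < e.
  apply: filter_forall => j; have [/cvgrPdist_lt/(_ _ e0) h1 /cvgrPdist_lt/(_ _ e0) h2] := ch j.
  by apply: filterS2 h1 h2 => q; rewrite distrC [X in _ -> X < _ -> _]distrC.
by apply: filterS => q hq; exact: eU.
Qed.

Lemma coord_ccont (j : 'I_n) z : ccont (fun y : V => y 0 j) z.
Proof.
split=> U /nbhs_ballP[e /= e0 eU].
  suff : nbhs z ((fun y : V => Re (y 0 j)) @^-1` U) by [].
  apply/nbhs_boxP; exists e => // y /(_ j)[h1 h2]; apply: eU.
  by rewrite /ball/= distrC.
suff : nbhs z ((fun y : V => Im (y 0 j)) @^-1` U) by [].
apply/nbhs_boxP; exists e => // y /(_ j)[h1 h2]; apply: eU.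
by rewrite /ball/= distrC.
Qed.

Lemma boxI z e : 0 < e -> box z e z.
Proof. by move=> e0 j; rewrite !subrr normr0. Qed.

Lemma box_cbox z e e' : e < e' -> cbox z e `<=` box z e'.
Proof. by move=> ee' y h j; have [h1 h2] := h j; split; apply: le_lt_trans ee'. Qed.

Lemma compact_cbox z e : compact (cbox z e).
Proof.
pose A j : set C := (fun p : R * R => Complex p.1 p.2) @`
  (`[Re (z 0 j) - e, Re (z 0 j) + e] `*` `[Im (z 0 j) - e, Im (z 0 j) + e]).
rewrite (_ : cbox z e = [set v : V | forall j, A j (v 0 j)]).
  apply: rV_compact => j; apply: continuous_compact; last first.
    by apply: compact_setX; exact: segment_compact.
  apply: continuous_subspaceT => p U /nbhs_ballP[d /= d0 dU].
  have d0' := d0.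
  move: d0; rewrite ltcE/= => /andP[/eqP di dr].
  have h : 0 < Re d / 2 by rewrite divr_gt0.
  exists (ball p.1 (Re d / 2), ball p.2 (Re d / 2)).
    by split; exact: nbhsx_ballx.
  move=> [x y] [/= h1 h2]; apply: dU; rewrite -ball_normE /=.
  have -> : d = (Re d)%:C%C by apply: Ceq.
  by apply: normC_lt.
apply/seteqP; split => y h j; have := h j.
  move=> [h1 h2]; exists (Re (y 0 j), Im (y 0 j)); last by case: (y 0 j).
  by split; rewrite /= in_itv/= -ler_distlC distrC.
move=> [[a b] [/=]]; rewrite !in_itv/= -!ler_distlC => h1 h2 <-/=.
by rewrite distrC [X in _ /\ X <= _]distrC.
Qed.

Lemma closed_cbox z e : closed (cbox z e).
Proof.
move=> y yc j; split; apply/ler_addgt0Pr => d d0.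
  have [x [xc xb]] := yc _ ((nbhs_boxP y (box y d)).2 (ex_intro2 _ _ d d0 (fun _ h => h))).
  have [h1 _] := xc j; have [h2 _] := xb j.
  by move: h1 h2; rewrite ltr_norml !ler_norml; lra.
have [x [xc xb]] := yc _ ((nbhs_boxP y (box y d)).2 (ex_intro2 _ _ d d0 (fun _ h => h))).
have [_ h1] := xc j; have [_ h2] := xb j.
by move: h1 h2; rewrite ltr_norml !ler_norml; lra.
Qed.

Lemma open_box (Om : set V) z : open Om -> Om z -> exists2 e, 0 < e & box z e `<=` Om.
Proof. by move=> oO Oz; apply/nbhs_boxP; exact: open_nbhs_nbhs. Qed.

End topology.

(** * Smooth and holomorphic functions of several variables *)

Section directional.
Context {R : realType} {n : nat}.
Local Notation C := R[i].
Local Notation Re := (@complex.Re R).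
Local Notation Im := (@complex.Im R).
Local Notation V := 'rV[R[i]]_n.
Implicit Types (z v u : V) (g : V -> R).
Variable Om : set V.
Hypothesis oOm : open Om.

Definition has_dder g v z (d : R) := is_derive (0 : R) 1 (fun t : R => g (z + t%:C%C *: v)) d.

Lemma has_dder_shift g v z (d t : R) : has_dder g v (z + t%:C%C *: v) d ->
  is_derive t 1 (fun s : R => g (z + s%:C%C *: v)) d.
Proof.
move=> h; have h' : is_derive (t - t) 1 (fun s : R => g (z + t%:C%C *: v + s%:C%C *: v)) d.
  by rewrite subrr.
have := isd_comp (g := fun s => s - t) h' (isdB (isdI t) (isdC t t)).
rewrite subr0 mulr1; congr is_derive.
by apply/funext => s; rewrite -addrA -scalerDl -rmorphD/= subrKC.
Qed.

Lemma has_dder_rderive g v z (d : R) : has_dder g v z d -> rderivable v g z /\ rderive v g z = d.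
Proof.
move=> [h1 h2]; split; first exact: h1.
by rewrite /rderive derive1E h2.
Qed.

Lemma rderivable_dder g v z : rderivable v g z -> has_dder g v z (rderive v g z).
Proof.
move=> h; split; first exact: h.
by rewrite /rderive derive1E.
Qed.

Lemma line2_cont (z u v : V) (p : R * R) :
  {for p, continuous (fun q : R * R => z + q.2%:C%C *: v + q.1%:C%C *: u)}.
Proof.
apply: cont_coordP => j; split.
  apply: (continuous_for_ext (g := fun q : R * R => Re (z 0 j) + q.2 * Re (v 0 j) + q.1 * Re (u 0 j))).
    move=> q; rewrite !mxE !CReD !CReM/=; ring.
  apply: contD; first apply: contD.
  - exact: cont_cst.
  - by apply: contM; [exact: cont_snd|exact: cont_cst].
  - by apply: contM; [exact: cont_fst|exact: cont_cst].
apply: (continuous_for_ext (g := fun q : R * R => Im (z 0 j) + q.2 * Im (v 0 j) + q.1 * Im (u 0 j))).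
  move=> q; rewrite !mxE !CImD !CImM/=; ring.
apply: contD; first apply: contD.
- exact: cont_cst.
- by apply: contM; [exact: cont_snd|exact: cont_cst].
- by apply: contM; [exact: cont_fst|exact: cont_cst].
Qed.

(** Directional derivatives are additive in the direction only under some continuity. That of [A]
    suffices: apply the two-variable chain rule to g (z + p.2 v + p.1 u) on the diagonal s |-> (s,
    s). *)
Lemma has_dderD g u v (A B : V -> R) :
  (forall z, Om z -> has_dder g u z (A z)) ->
  (forall z, Om z -> has_dder g v z (B z)) ->
  (forall z, Om z -> {for z, continuous A}) ->
  forall z, Om z -> has_dder g (u + v) z (A z + B z).
Proof.
move=> hA hB cA z Oz.
pose F (p : R * R) := g (z + p.2%:C%C *: v + p.1%:C%C *: u).
pose Fx (p : R * R) := A (z + p.2%:C%C *: v + p.1%:C%C *: u).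
have z0 : z + 0%:C%C *: v + 0%:C%C *: u = z by rewrite !scale0r !addr0.
have near_Om : \forall p \near ((0, 0) : R * R), Om (z + p.2%:C%C *: v + p.1%:C%C *: u).
  have H := @line2_cont z u v (0, 0) Om.
  by apply: H; rewrite /= z0; exact: open_nbhs_nbhs.
have := @is_derive_comp_curve _ F Fx (fun s => s) (fun s => s) 0 1 1 (B z)
  (isdI 0) (isdI 0).
have e0 : Fx (0, 0) = A z by rewrite -[in RHS]z0.
have cA' : {for z + 0%:C%C *: v + 0%:C%C *: u, continuous A} by rewrite z0; exact: cA.
rewrite e0 !mulr1 => H.
have {}H : is_derive (0 : R) 1 (fun s : R => g (z + s%:C%C *: v + s%:C%C *: u)) (A z + B z).
  apply: H.
  - apply: filterS near_Om => p Op.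
    exact: (@has_dder_shift g u (z + p.2%:C%C *: v) _ p.1 (hA _ Op)).
  - apply: (@cont_comp _ _ _ (fun p : R * R => z + p.2%:C%C *: v + p.1%:C%C *: u) A (0, 0)).
      exact: line2_cont.
    exact: cA'.
  - rewrite (_ : (fun s : R => F (0, s)) = fun s => g (z + s%:C%C *: v)); first exact: hB.
    apply/funext => s; have -> : F (0, s) = g (z + s%:C%C *: v + 0%:C%C *: u) by [].
    by rewrite scale0r addr0.
move: H; rewrite /has_dder; congr is_derive.
by apply/funext => s; rewrite scalerDr addrA addrAC.
Qed.

Lemma has_dderZ g u z (c d : R) : has_dder g u z d -> has_dder g (c%:C%C *: u) z (c * d).
Proof.
move=> h; have h' : is_derive (0 * c) 1 (fun s : R => g (z + s%:C%C *: u)) d by rewrite mul0r.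
have := isd_comp (g := fun s => s * c) h' (isdM (isdI 0) (isdC c 0)).
rewrite mul1r mulr0 addr0 mulrC; congr is_derive.
by apply/funext => s; rewrite scalerA rmorphM.
Qed.

(** The real differential of [g] at [z], evaluated on [v]. *)
Definition dder g v z : R :=
  \sum_(j < n) (Re (v 0 j) * rderive (xdir R j) g z + Im (v 0 j) * rderive (ydir R j) g z).

Lemma Ck_cont k g : Ck k Om g -> forall z, Om z -> {for z, continuous g}.
Proof. by case: k => [|k] []. Qed.

Lemma cont_sum (T : topologicalType) (I : Type) (s : seq I) (f : I -> T -> R) (p : T) :
  (forall i, {for p, continuous (f i)}) -> {for p, continuous (fun q => \sum_(i <- s) f i q)}.
Proof.
move=> cf; elim: s => [|i s ih].
  by apply: (continuous_for_ext (g := fun=> 0)); [move=> q; rewrite big_nil|exact: cont_cst].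
apply: (continuous_for_ext (g := fun q : T => f i q + \sum_(i <- s) f i q)).
  by move=> q; rewrite big_cons.
exact: contD.
Qed.

Section C1.
Variable g : V -> R.
Hypothesis C1g : Ck 1 Om g.

Let cx j z : Om z -> {for z, continuous (rderive (xdir R j) g)}.
Proof.
move=> Oz; have [_ /(_ (xdir R j))[|_ h]] := C1g; first by exists j; left.
exact: (@Ck_cont 0 _ h _ Oz).
Qed.

Let cy j z : Om z -> {for z, continuous (rderive (ydir R j) g)}.
Proof.
move=> Oz; have [_ /(_ (ydir R j))[|_ h]] := C1g; first by exists j; right.
exact: (@Ck_cont 0 _ h _ Oz).
Qed.

Let dx j z : Om z -> has_dder g (xdir R j) z (rderive (xdir R j) g z).
Proof.
by move=> Oz; apply: rderivable_dder; have [_ /(_ (xdir R j))[|+ _]] := C1g; [exists j; left|apply].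
Qed.

Let dy j z : Om z -> has_dder g (ydir R j) z (rderive (ydir R j) g z).
Proof.
by move=> Oz; apply: rderivable_dder; have [_ /(_ (ydir R j))[|+ _]] := C1g; [exists j; right|apply].
Qed.

Lemma dder_cont v z : Om z -> {for z, continuous (dder g v)}.
Proof.
move=> Oz; apply: cont_sum => j.
by apply: contD; apply: contM; [exact: cont_cst|exact: cx|exact: cont_cst|exact: cy].
Qed.

(** [Ck] speaks of coordinate directions only. An arbitrary [v] is reached by adding them one at a
    time, and the induction must hold at all points of [Om] because [has_dderD] needs the
    derivatives on an open set. *)
Lemma has_dder_dder v z : Om z -> has_dder g v z (dder g v z).
Proof.
have key (s : seq 'I_n) z' : Om z' -> has_dder g
    (\sum_(j <- s) ((Re (v 0 j))%:C%C *: xdir R j + (Im (v 0 j))%:C%C *: ydir R j)) z'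
    (\sum_(j <- s) (Re (v 0 j) * rderive (xdir R j) g z' + Im (v 0 j) * rderive (ydir R j) g z')).
  elim: s z' => [|j s ih] z' Oz.
    rewrite !big_nil /has_dder; under eq_fun do rewrite scaler0 addr0.
    exact: isdC.
  rewrite !big_cons.
  apply: (@has_dderD g _ _
    (fun z => Re (v 0 j) * rderive (xdir R j) g z + Im (v 0 j) * rderive (ydir R j) g z)
    (fun z => \sum_(j <- s) (Re (v 0 j) * rderive (xdir R j) g z + Im (v 0 j) * rderive (ydir R j) g z))) => //.
    apply: (@has_dderD g _ _ (fun z => Re (v 0 j) * rderive (xdir R j) g z)
      (fun z => Im (v 0 j) * rderive (ydir R j) g z)).
    - by move=> y Oy; apply: has_dderZ; exact: dx.
    - by move=> y Oy; apply: has_dderZ; exact: dy.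
    - by move=> y Oy; apply: contM; [exact: cont_cst|exact: cx].
  move=> y Oy.
  by apply: contD; apply: contM; [exact: cont_cst|exact: cx|exact: cont_cst|exact: cy].
move=> Oz; have := key (index_enum 'I_n) z Oz.
suff -> : \sum_(j <- index_enum 'I_n) ((Re (v 0 j))%:C%C *: xdir R j + (Im (v 0 j))%:C%C *: ydir R j) = v by [].
rewrite [RHS]row_sum_delta; apply: eq_bigr => j _.
rewrite /xdir /ydir scalerA -scalerDl; congr (_ *: _).
by rewrite mulrC -complexE.
Qed.

End C1.

Section hol_line.
Variable f : V -> C.
Hypotheses (Cf : csmooth Om f) (hf : forall j z, Om z -> dzbar j f z = 0).

Let a z := Re (f z).
Let b z := Im (f z).

Let CR j z : Om z -> rderive (xdir R j) a z = rderive (ydir R j) b z /\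
  rderive (xdir R j) b z = - rderive (ydir R j) a z.
Proof.
move=> /(hf j); rewrite /dzbar /cderive -/a -/b => /eqP.
rewrite mulf_eq0 invr_eq0 pnatr_eq0 orbF => /eqP e.
move: e; move: (rderive (xdir R j) a z) (rderive (xdir R j) b z)
  (rderive (ydir R j) a z) (rderive (ydir R j) b z) => p q r s e.
have := congr1 Re e; have := congr1 Im e.
rewrite CImD CReD CReM CImM/= => e1 e2; lra.
Qed.

Let dderi (v z : V) : Om z -> dder b ('i%C *: v) z = dder a v z /\
  dder a ('i%C *: v) z = - dder b v z.
Proof.
move=> Oz; rewrite /dder; split; last rewrite -sumrN; apply: eq_bigr => j _;
by have [h1 h2] := CR j Oz; rewrite !mxE CReM CImM/=; rewrite ?h1 ?h2; ring.
Qed.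

Definition cline z v (p : R * R) : V := z + (Complex p.1 p.2) *: v.

Lemma cline_cont z v p : {for p, continuous (cline z v)}.
Proof.
have -> : cline z v = fun q : R * R => z + q.2%:C%C *: ('i%C *: v) + q.1%:C%C *: v.
  apply/funext => q; rewrite /cline scalerA -addrA -scalerDl; congr (_ + _ *: _).
  by apply: Ceq; rewrite ?CReD ?CImD ?CReM ?CImM/=; ring.
exact: line2_cont.
Qed.

(** The passage from several variables to one: the area inequality and the maximum principle reach
    functions on C^n through this restriction to complex lines. *)
Lemma hol_line z v : exists G', hol (cline z v @^-1` Om) (fun p => f (cline z v p)) G'.
Proof.
have Ca : Ck 1 Om a by exact: Cf.1.
have Cb : Ck 1 Om b by exact: Cf.2.
exists (fun p => Complex (dder a v (cline z v p)) (dder b v (cline z v p))).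
move=> p Op; have [h1 h2] := dderi v Op; split.
- have hx g d : has_dder g v (cline z v p) d -> is_derive (p.1 : R) 1 (fun s => g (cline z v (s, p.2))) d.
    move=> h; have e : cline z v p = cline z v (0, p.2) + p.1%:C%C *: v.
      rewrite /cline/= -addrA -scalerDl; congr (_ + _ *: _).
      by apply: Ceq; rewrite ?CReD ?CImD/=; ring.
    rewrite e in h; have := has_dder_shift h; congr is_derive.
    apply/funext => s; congr g; rewrite /cline/= -addrA -scalerDl; congr (_ + _ *: _).
    by apply: Ceq; rewrite ?CReD ?CImD/=; ring.
  by split; [apply: (hx a); exact: has_dder_dder|apply: (hx b); exact: has_dder_dder].
- have hy g d : has_dder g ('i%C *: v) (cline z v p) d -> is_derive (p.2 : R) 1 (fun s => g (cline z v (p.1, s))) d.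
    move=> h; have e : cline z v p = cline z v (p.1, 0) + p.2%:C%C *: ('i%C *: v).
      rewrite /cline/= -addrA scalerA -scalerDl; congr (_ + _ *: _).
      by apply: Ceq; rewrite ?CReD ?CImD ?CReM ?CImM/=; ring.
    rewrite e in h; have := has_dder_shift h; congr is_derive.
    apply/funext => s; congr g; rewrite /cline/= -addrA scalerA -scalerDl; congr (_ + _ *: _).
    by apply: Ceq; rewrite ?CReD ?CImD ?CReM ?CImM/=; ring.
  split; rewrite ?CReM ?CImM/= ?mul0r ?mul1r ?add0r ?addr0.
    by apply: (hy a); rewrite -h2; exact: has_dder_dder.
  by apply: (hy b); rewrite -h1; exact: has_dder_dder.
- split.
    exact: (@cont_comp _ _ _ (cline z v) a p (@cline_cont z v p) (@Ck_cont 1 a Ca _ Op)).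
  exact: (@cont_comp _ _ _ (cline z v) b p (@cline_cont z v p) (@Ck_cont 1 b Cb _ Op)).
- split.
    exact: (@cont_comp _ _ _ (cline z v) (dder a v) p (@cline_cont z v p) (@dder_cont a Ca v _ Op)).
  exact: (@cont_comp _ _ _ (cline z v) (dder b v) p (@cline_cont z v p) (@dder_cont b Cb v _ Op)).
Qed.

End hol_line.
End directional.

(** * Measurability and the area inequality on C^n *)

Section Cn_measure.
Context {R : realType} {n : nat}.
Local Notation C := R[i].
Local Notation Re := (@complex.Re R).
Local Notation Im := (@complex.Im R).
Local Notation V := 'rV[R[i]]_n.
Local Notation P := (measurableTypeR R * measurableTypeR R)%type.

Definition of_Cn (z : V) : n.-tuple P := [tuple (Re (z 0 j), Im (z 0 j)) | j < n].

Lemma of_CnK (z : V) : Cn_of (of_Cn z) = z.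
Proof. by apply/rowP => j; rewrite !mxE tnth_mktuple/=; case: (z 0 j). Qed.

Lemma measurable_fun_Cn (D : set V) (f : V -> \bar R) :
  (forall z (a : R), D z -> (f z < a%:E)%E ->
     \forall y \near z, D y -> (f y < a%:E)%E) ->
  measurable_fun (@Cn_of R n @^-1` D) (f \o @Cn_of R n).
Proof.
move=> hf; apply: measurable_fun_tuple => t a Dt fta.
have /nbhs_boxP[e e0 he] := hf _ _ Dt fta.
exists e => // s hs Ds; apply: he => // j.
by have := hs j; rewrite !mxE.
Qed.

Lemma measurable_fun_Cn_cont (D : set V) (f : V -> R) :
  (forall z, D z -> {for z, continuous f}) ->
  measurable_fun (@Cn_of R n @^-1` D) (fun t => (f (Cn_of t))%:E).
Proof.
move=> cf; apply: (@measurable_fun_Cn D (EFin \o f)) => z a Dz; rewrite lte_fin => fa.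
have : \forall y \near z, f y < a by have := cf _ Dz; rewrite /continuous_at => /cvgr_lt; exact.
by apply: filterS => y; rewrite lte_fin.
Qed.

Lemma measurable_Cn_open (U : set V) : open U -> measurable (@Cn_of R n @^-1` U).
Proof.
move=> oU.
(* The function equal to 0 on the open set [U] and to 1 off it is upper semicontinuous, hence
   measurable. *)
have h : measurable_fun (@Cn_of R n @^-1` setT)
    ((fun z => if `[< U z >] then 0%:E else 1%:E) \o @Cn_of R n : _ -> \bar R).
  apply: measurable_fun_Cn => z a _ /=; case: asboolP => Uz ha.
    have : \forall y \near z, U y by exact: open_nbhs_nbhs.
    by apply: filterS => y Uy _; rewrite asboolT.
  apply/nbhs_boxP; exists 1 => // y _ _; apply: le_lt_trans ha.
  by case: asboolP => //; rewrite lee_fin.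
have := h measurableT _ (emeasurable_set1 0%:E); rewrite setTI => m0.
rewrite (_ : @Cn_of R n @^-1` U = @Cn_of R n @^-1` setT `&`
  ((fun z => if `[< U z >] then 0%:E else 1%:E) \o @Cn_of R n) @^-1` [set 0%:E : \bar R]) //.
  by rewrite preimage_setT setTI.
apply/seteqP; split => t /=; first by move=> Ut; split => //; rewrite asboolT.
by case; case: asboolP => // _ _ [] /eqP; rewrite oner_eq0.
Qed.

Lemma measurable_cbox (z : V) e : measurable (@Cn_of R n @^-1` (cbox z e)).
Proof.
have := measurableC (measurable_Cn_open (closed_openC (@closed_cbox R n z e))).
by rewrite preimage_setC setCK.
Qed.

(** [sqmod_area] on each coordinate line, iterated by [tuple_area] for |f|^2 cut off to the closed
    box. The larger box of half-side r0 leaves the room beyond r that the one-variable inequality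
    asks for. *)
Lemma Cn_area (Om : set V) (f : V -> C) (z : V) (r r0 : R) : open Om ->
  csmooth Om f -> (forall j y, Om y -> dzbar j f y = 0) ->
  0 < r -> r < r0 -> box z r0 `<=` Om ->
  (((r ^+ 2 / 4) ^+ n * sqmod (f z))%:E <=
    integral_Cn (cbox z r) (fun y => (sqmod (f y))%:E))%E.
Proof.
move=> oO Cf hf rp rr0 zO.
have cO : cbox z r `<=` Om by move=> y /(box_cbox rr0); exact: zO.
pose F : n.-tuple P -> \bar R := (fun t => (sqmod (f (Cn_of t)))%:E) \_ (@Cn_of R n @^-1` cbox z r).
have cf y : Om y -> {for y, continuous (fun y => sqmod (f y))}.
  by move=> Oy; apply: contD; apply: contX; [exact: (Ck_cont (Cf.1 0%N))|exact: (Ck_cont (Cf.2 0%N))].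
have F0 t : (0 <= F t)%E by rewrite /F patchE; case: ifPn => // _; rewrite lee_fin sqmod_ge0.
have mF : measurable_fun setT F.
  have H := @measurable_fun_Cn_cont (cbox z r) (fun y => sqmod (f y)).
  have {}H := H (fun y yc => cf y (cO y yc)).
  by move/(measurable_restrictT _ (measurable_cbox z r)) : H.
have K0 : 0 <= r ^+ 2 / 4 by rewrite divr_ge0// sqr_ge0.
rewrite /integral_Cn integral_mkcond -/F.
have := @tuple_area R n (of_Cn z) (r ^+ 2 / 4) F K0 mF F0.
have Fz : F (of_Cn z) = (sqmod (f z))%:E.
  rewrite /F patchE of_CnK mem_set// => j /=.
  by rewrite of_CnK !subrr normr0 ltW.
rewrite Fz -EFinM => H; apply: H => t j.
have tz k : tnth (of_Cn z) k = (Re (z 0 k), Im (z 0 k)) by rewrite tnth_mktuple.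
pose B (k : 'I_n) (p : P) := `|p.1 - Re (z 0 k)| <= r /\ `|p.2 - Im (z 0 k)| <= r.
(* If some entry other than the j-th is already outside the box, the cut-off function vanishes on
   the whole line and so does the left-hand side. *)
have [tB|tB] := pselect (forall k, k != j -> B k (tnth t k)); last first.
  have Fupd p : F (upd t j p) = 0%E.
    rewrite /F patchE memNset//= => h; apply: tB => k kj.
    by have := h k; rewrite !mxE tnth_mktuple (negbTE kj).
  by rewrite Fupd mule0 integral_ge0.
pose y := Cn_of (upd t j (tnth (of_Cn z) j)).
have eline p : Cn_of (upd t j (translate (tnth (of_Cn z) j) p)) = cline y (xdir R j) p.
  apply/rowP => k; rewrite !mxE !tnth_mktuple eqxx/=.
  case: ifPn => _; first by rewrite mulr1; apply: Ceq; rewrite ?CReD ?CImD.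
  by rewrite mulr0 addr0.
have inbox p : osq r0 p -> Om (cline y (xdir R j) p).
  move=> [] /=; rewrite !in_itv/= -!ltr_norml => p1 p2; apply: zO => k.
  rewrite -eline !mxE tnth_mktuple; case: ifPn => [/eqP ->|kj].
    by rewrite tz/= ![_ + _ - _]addrAC !subrr !add0r.
  by have [h1 h2] := tB k kj; split; [apply: le_lt_trans h1 _|apply: le_lt_trans h2 _].
have incbox (p : P) : cbox z r (cline y (xdir R j) p) <-> sq r p.
  split => [/(_ j)|[] /=].
    rewrite -eline !mxE tnth_mktuple eqxx tz/= ![_ + _ - _]addrAC !subrr !add0r.
    by move=> [? ?]; split; rewrite /= in_itv/= -ler_norml.
  rewrite !in_itv/= -!ler_norml => p1 p2 k.
  rewrite -eline !mxE tnth_mktuple; case: ifPn => [/eqP ->|kj].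
    by rewrite tz/= ![_ + _ - _]addrAC !subrr !add0r.
  exact: tB.
have [G' hG] := hol_line oO Cf hf y (xdir R j).
have hG' : hol (osq r0) (fun p => f (cline y (xdir R j) p)) G' by move=> p /inbox; exact: hG.
have := sqmod_area rp rr0 hG'.
have c0 : cline y (xdir R j) (0, 0) = y by rewrite /cline/= scale0r addr0.
rewrite c0 EFinM => H.
rewrite [X in (_ * X <= _)%E]/F patchE mem_set; last first.
  rewrite /= -/y -c0; apply/incbox.
  by split; rewrite /= in_itv/=; apply/andP; split; rewrite ?oppr_le0 ltW.
rewrite -/y; apply: le_trans H _.
rewrite (@integral_translate _ (tnth (of_Cn z) j)); last first.
- by move=> p; exact: F0.
- apply: measurableT_comp => //; apply/measurable_fun_tnthP => k.
  rewrite (_ : _ \o _ = fun p => if k == j then p else tnth t k).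
    by case: (k == j); [exact: measurable_id|exact: measurable_cst].
  by apply/funext => p /=; rewrite tnth_mktuple.
rewrite integral_mkcond le_eqVlt; apply/orP; left; apply/eqP.
apply: eq_integral => p _; rewrite /F !patchE.
have [ps|ps] := boolP (p \in (sq r : set P)).
  have ps' : cbox z r (cline y (xdir R j) p) by apply/incbox; rewrite inE in ps.
  rewrite -eline in ps'; rewrite (mem_set (ps' : (@Cn_of R n @^-1` cbox z r) _)).
  by rewrite eline.
rewrite memNset//= eline => /incbox h.
by move/negP : ps; apply; rewrite inE.
Qed.

End Cn_measure.

(** * Cutoff functions *)

Section flat_exponential.
Context {R : realType}.

(** The functions p(1/x) exp (-1/x), extended by 0, form a class closed under differentiation;
    smoothness at 0 then rests on the single estimate [flat_bound]. *)
Definition flat (p : {poly R}) (x : R) : R :=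
  if 0 < x then p.[x^-1] * expR (- x^-1) else 0.

Lemma poly_growth (p : {poly R}) :
  exists C d, 0 <= C /\ forall y, 1 <= y -> `|p.[y]| <= C * y ^+ d.
Proof.
elim/poly_ind: p => [|p c [C [d [C0 hC]]]].
  by exists 0, 0%N; split => // y _; rewrite horner0 normr0 mul0r.
exists (C + `|c|), d.+1; split; first by rewrite addr_ge0.
move=> y y1; rewrite hornerMXaddC; apply: le_trans (ler_normD _ _) _.
rewrite mulrDl lerD//.
  have y0 := le_trans ler01 y1.
  by rewrite normrM exprSr mulrA (ger0_norm y0) ler_wpM2r// hC.
by rewrite ler_peMr// exprn_ege1.
Qed.

Lemma flat_bound (p : {poly R}) : exists2 C, 0 <= C & forall x, x <= 1 -> `|flat p x| <= C * `|x|.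
Proof.
have [C [d [C0 hC]]] := poly_growth p.
exists (C * d.+1%:R ^+ d.+1); first by rewrite mulr_ge0// exprn_ge0.
move=> x x1; rewrite /flat; case: ifPn => [x0|_]; last first.
  by rewrite normr0 mulr_ge0// mulr_ge0// exprn_ge0.
set y := x^-1; have y0 : 0 < y by rewrite invr_gt0.
have y1 : 1 <= y by rewrite invf_ge1.
rewrite normrM (gtr0_norm (expR_gt0 _)) expRN.
(* One power of y more than the growth of p: the quotient keeps a factor 1/y = x. *)
have e1 : (y / d.+1%:R) ^+ d.+1 <= expR y.
  have -> : expR y = expR (y / d.+1%:R) ^+ d.+1.
    by rewrite -expRM_natl mulrC divfK// pnatr_eq0.
  rewrite lerXn2r ?nnegrE ?expR_ge0 ?divr_ge0 ?(ltW y0)//.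
  by apply: le_trans (expR_ge1Dx _); rewrite lerDr.
rewrite ler_pdivrMr ?expR_gt0//; apply: le_trans (hC _ y1) _.
rewrite gtr0_norm// -[x]invrK -/y.
apply: (@le_trans _ _ (C * d.+1%:R ^+ d.+1 / y * (y / d.+1%:R) ^+ d.+1)); last first.
  have k0 : 0 <= C * d.+1%:R ^+ d.+1 / y.
    by apply: mulr_ge0; [apply: mulr_ge0 => //; exact: exprn_ge0|rewrite invr_ge0 ltW].
  exact: ler_wpM2l k0 _ _ e1.
rewrite le_eqVlt; apply/orP; left; apply/eqP; rewrite expr_div_n exprS [in RHS]exprS.
have K0 : (d.+1%:R : R) != 0 by rewrite pnatr_eq0.
move: (d.+1%:R : R) K0 => K K0; have Kd : K ^+ d != 0 by rewrite expf_neq0.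
have y0' : y != 0 by rewrite gt_eqF.
by field; rewrite ?y0' ?K0 ?Kd.
Qed.

Lemma flat_le0 p (x : R) : x <= 0 -> flat p x = 0.
Proof. by rewrite /flat ltNge => ->. Qed.

Definition flat_der (p : {poly R}) : {poly R} := 'X^2 * (p - p^`()).

Lemma isd_flat p (x : R) : is_derive x 1 (flat p) (flat (flat_der p) x).
Proof.
have [x0|x0|->] := ltgtP x 0.
- rewrite (flat_le0 _ (ltW x0)).
  apply: near_eq_is_derive (isdC 0 x); near=> s.
  by rewrite flat_le0// ltW//; near: s; exact: lt_nbhsl.
- rewrite /flat x0.
  have hV : is_derive x 1 (fun s : R => s^-1) (- x ^- 2).
    by have := @is_deriveV R (fun s => s) x 1 1 (lt0r_neq0 x0) (isdI x); rewrite /GRing.scale/= mulr1.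
  have hVN : is_derive x 1 (fun s : R => - s^-1) (x ^- 2).
    have := isdB (isdC 0 x) hV; rewrite sub0r opprK; congr is_derive.
    by apply/funext => s; rewrite sub0r.
  have h1 : is_derive x 1 (fun s : R => p.[s^-1]) (p^`().[x^-1] * (- x ^- 2)).
    exact: (isd_comp (g := fun s : R => s^-1) (is_derive_poly p x^-1) hV).
  have h2 : is_derive x 1 (fun s : R => expR (- s^-1)) (expR (- x^-1) * x ^- 2).
    exact: (isd_comp (g := fun s : R => - s^-1) (is_derive_expR (- x^-1)) hVN).
  have h3 := isdM h1 h2.
  apply: near_eq_is_derive (isd_eq h3 _); last first.
    rewrite /flat_der hornerM hornerXn hornerD hornerN exprVn; ring.
  near=> s; rewrite ifT//; near: s; exact: lt_nbhsr.
(* At 0 the secant slope of [flat p] is [flat ('X * p)], which tends to 0 by [flat_bound]. *)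
rewrite flat_le0//; apply/is_derive1_caratheodory; exists (flat ('X * p)); split.
- move=> z; rewrite [flat p 0]flat_le0// !subr0 /flat; case: ifPn => [z0|_]; last by rewrite mul0r.
  by rewrite hornerM hornerX; field; rewrite gt_eqF.
- have [C C0 hC] := flat_bound ('X * p).
  have f0 : flat ('X * p) 0 = 0 by rewrite flat_le0.
  apply/cvgrPdist_lt => e e0; near=> s.
  rewrite f0 sub0r normrN; apply: (@le_lt_trans _ _ (C * `|s|)).
    by apply: hC; rewrite ltW//; near: s; apply: lt_nbhsl.
  apply: (@le_lt_trans _ _ ((C + 1) * `|s|)); first by rewrite ler_wpM2r// lerDl.
  rewrite -ltr_pdivlMl ?ltr_wpDl// mulrC.
  near: s; have := @cvgr0_norm_lt R R R (nbhs (0:R)) _ id (@cvg_id _ (nbhs (0:R))).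
  by apply; rewrite divr_gt0// ltr_wpDl.
- by rewrite flat_le0.
Unshelve. all: by end_near. Qed.

Definition flatn (k : nat) : R -> R := flat (iter k flat_der 1).

Lemma isd_flatn k (x : R) : is_derive x 1 (flatn k) (flatn k.+1 x).
Proof. exact: isd_flat. Qed.

Lemma flatn_le0 k (x : R) : x <= 0 -> flatn k x = 0.
Proof. exact: flat_le0. Qed.

Lemma flat0E (x : R) : 0 < x -> flatn 0 x = expR (- x^-1).
Proof. by move=> x0; rewrite /flatn /flat/= x0 hornerC mul1r. Qed.

Lemma flat0_gt0 (x : R) : 0 < x -> 0 < flatn 0 x.
Proof. by move=> x0; rewrite flat0E// expR_gt0. Qed.

Lemma flat0_ge0 (x : R) : 0 <= flatn 0 x.
Proof. by have [/flatn_le0 ->|/flat0_gt0/ltW] := leP x 0. Qed.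

Lemma flat0_le (x y : R) : x <= y -> flatn 0 x <= flatn 0 y.
Proof.
move=> xy; have [x0|x0] := leP x 0; first by rewrite (flatn_le0 _ x0) flat0_ge0.
rewrite !flat0E ?(lt_le_trans x0)// ler_expR lerN2 lef_pV2 ?posrE//.
exact: lt_le_trans xy.
Qed.

(* The inner function [flatn 0 (1 - s)] is at least [cut] for s <= 1/4 and
   vanishes for s >= 1, so [theta] is 1 for s <= 1/4 and 0 for s >= 1. *)
Definition cut : R := flatn 0 (1 - 4^-1).
Definition theta (s : R) : R := 1 - flatn 0 (cut - flatn 0 (1 - s)) / flatn 0 cut.
Definition theta1 (s : R) : R :=
  - (flatn 1 (cut - flatn 0 (1 - s)) * flatn 1 (1 - s)) / flatn 0 cut.
Definition theta2 (s : R) : R :=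
  - (flatn 2 (cut - flatn 0 (1 - s)) * flatn 1 (1 - s) * flatn 1 (1 - s)
     - flatn 1 (cut - flatn 0 (1 - s)) * flatn 2 (1 - s)) / flatn 0 cut.

Lemma cut_gt0 : 0 < cut.
Proof. by apply: flat0_gt0; rewrite subr_gt0 invf_lt1//; rewrite ltr1n. Qed.

Let isd_in k (s : R) : is_derive s 1 (fun s => flatn k (1 - s)) (- flatn k.+1 (1 - s)).
Proof.
have h := isd_comp (g := fun s => 1 - s) (isd_flatn k (1 - s)) (isdB (isdC 1 s) (isdI s)).
by apply: isd_eq h _; ring.
Qed.

Let isd_out k (s : R) : is_derive s 1 (fun s => flatn k (cut - flatn 0 (1 - s)))
  (flatn k.+1 (cut - flatn 0 (1 - s)) * flatn 1 (1 - s)).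
Proof.
have h := isd_comp (g := fun s => cut - flatn 0 (1 - s))
  (isd_flatn k (cut - flatn 0 (1 - s))) (isdB (isdC cut s) (isd_in 0 s)).
by apply: isd_eq h _; ring.
Qed.

Lemma isd_theta (s : R) : is_derive s 1 theta (theta1 s).
Proof.
apply: isd_eq (isdB (isdC 1 s) (isdM (isd_out 0 s) (isdC (flatn 0 cut)^-1 s))) _.
by rewrite /theta1; ring.
Qed.

Lemma isd_theta1 (s : R) : is_derive s 1 theta1 (theta2 s).
Proof.
have h := isdM (isdB (isdC 0 s) (isdM (isd_out 1 s) (isd_in 1 s))) (isdC (flatn 0 cut)^-1 s).
have -> : theta1 = fun s => (0 - flatn 1 (cut - flatn 0 (1 - s)) * flatn 1 (1 - s)) / flatn 0 cut.
  by apply/funext => t; rewrite /theta1 sub0r.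
by apply: isd_eq h _; rewrite /theta2; ring.
Qed.

Lemma theta_small (s : R) : s <= 4^-1 -> theta s = 1 /\ theta1 s = 0.
Proof.
move=> s4; have h : cut - flatn 0 (1 - s) <= 0.
  by rewrite subr_le0; apply: flat0_le; rewrite lerD2l lerN2.
by rewrite /theta /theta1 !(flatn_le0 _ h) !mul0r subr0 oppr0 mul0r.
Qed.

Lemma theta_large (s : R) : 1 <= s -> theta s = 0 /\ theta1 s = 0.
Proof.
move=> s1; have h : 1 - s <= 0 by rewrite subr_le0.
rewrite /theta /theta1 !(flatn_le0 _ h) subr0 mulr0 oppr0 mul0r divff ?subrr//.
by rewrite gt_eqF// flat0_gt0// cut_gt0.
Qed.

Lemma theta01 (s : R) : 0 <= theta s <= 1.
Proof.
have c0 : 0 < flatn 0 cut by exact/flat0_gt0/cut_gt0.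
rewrite /theta subr_ge0 ler_pdivrMr// mul1r gerBl divr_ge0 ?flat0_ge0 ?(ltW c0)// andbT.
by apply: flat0_le; rewrite gerBl flat0_ge0.
Qed.

Lemma theta1_bound : exists2 M : R, 0 < M & forall s, `|theta1 s| <= M.
Proof.
have [M hM] := @compact_bounded_for _ R _ theta1 (@segment_compact R 0 1)
  (fun s _ => isd_cont (isd_theta1 s)).
have M0 : 0 <= M by apply: le_trans (normr_ge0 _) (hM 0 _); rewrite /= in_itv/= lexx ler01.
exists (M + 1); first by rewrite ltr_wpDl.
move=> s; have [s1|s1] := leP 1 s.
  by rewrite (theta_large s1).2 normr0 addr_ge0.
have [s0|s0] := leP s 0.
  have [|_ ->] := @theta_small s; last by rewrite normr0 addr_ge0.
  by apply: le_trans s0 _; rewrite invr_ge0.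
by apply: (le_trans (hM s _)); rewrite ?lerDl// /= in_itv/= !ltW.
Qed.

End flat_exponential.

(** * A class of smooth functions closed under the needed operations *)

Section smooth_class.
Context {R : realType} {n : nat}.
Local Notation C := R[i].
Local Notation Re := (@complex.Re R).
Local Notation Im := (@complex.Im R).
Local Notation V := 'rV[R[i]]_n.

(* Every member is smooth because the class is closed under directional
   derivatives; [l k] plays the role of the k-th derivative of [l 0]. *)
Inductive sm : (V -> R) -> Prop :=
| sm_cst c : sm (fun=> c)
| sm_re j : sm (fun z => Re (z 0 j))
| sm_im j : sm (fun z => Im (z 0 j))
| sm_add f g : sm f -> sm g -> sm (fun z => f z + g z)
| sm_mul f g : sm f -> sm g -> sm (fun z => f z * g z)
| sm_comp (l : nat -> R -> R) g : sm g ->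
    (forall k z, is_derive (g z) 1 (l k) (l k.+1 (g z))) -> sm (fun z => l 0%N (g z)).

Lemma sm_cont f : sm f -> forall z, {for z, continuous f}.
Proof.
elim=> {f} [c|j|j|f g _ ihf _ ihg|f g _ ihf _ ihg|l g _ ihg hl] z.
- exact: cont_cst.
- exact: (@coord_ccont R n j z).1.
- exact: (@coord_ccont R n j z).2.
- exact: contD.
- exact: contM.
- exact: (@cont_comp _ _ _ g (l 0%N) z (ihg z) (isd_cont (hl 0%N z))).
Qed.

Lemma sm_dder f : sm f -> forall v, exists2 f', sm f' & forall z, has_dder f v z (f' z).
Proof.
elim=> {f} [c|j|j|f g _ ihf _ ihg|f g sf ihf sg ihg|l g sg ihg hl] v.
- by exists (fun=> 0); [exact: sm_cst|move=> z; exact: isdC].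
- exists (fun=> Re (v 0 j)); [exact: sm_cst|move=> z].
  have h : is_derive (0 : R) 1 (fun t => Re (z 0 j) + t * Re (v 0 j)) (Re (v 0 j)).
    by apply: isd_eq (isdD (isdC _ 0) (isdM (isdI 0) (isdC _ 0))) _; ring.
  by move: h; congr is_derive; apply/funext => t; rewrite !mxE CReD CReM/=; ring.
- exists (fun=> Im (v 0 j)); [exact: sm_cst|move=> z].
  have h : is_derive (0 : R) 1 (fun t => Im (z 0 j) + t * Im (v 0 j)) (Im (v 0 j)).
    by apply: isd_eq (isdD (isdC _ 0) (isdM (isdI 0) (isdC _ 0))) _; ring.
  by move: h; congr is_derive; apply/funext => t; rewrite !mxE CImD CImM/=; ring.
- have [f' sf' hf] := ihf v; have [g' sg' hg] := ihg v.
  exists (fun z => f' z + g' z); [exact: sm_add|move=> z].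
  exact: isdD (hf z) (hg z).
- have [f' sf' hf] := ihf v; have [g' sg' hg] := ihg v.
  exists (fun z => f' z * g z + f z * g' z); [by apply: sm_add; apply: sm_mul|move=> z].
  have := isdM (hf z) (hg z).
  by rewrite /has_dder scale0r addr0.
- have [g' sg' hg] := ihg v.
  exists (fun z => l 1%N (g z) * g' z).
    by apply: sm_mul => //; exact: (@sm_comp (fun k => l k.+1)).
  move=> z; apply: (isd_comp (g := fun t : R => g (z + t%:C%C *: v)) _ (hg z)).
  by rewrite scale0r addr0.
Qed.

Lemma sm_Ck (Om : set V) k f : sm f -> Ck k Om f.
Proof.
elim: k f => [|k ih] f sf; split => //; try by move=> z _; exact: sm_cont.
move=> v _; have [f' sf' hf] := sm_dder sf v; split.
  by move=> z _; have [] := has_dder_rderive (hf z).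
have -> : rderive v f = f' by apply/funext => z; have [] := has_dder_rderive (hf z).
exact: ih.
Qed.

Lemma sm_smooth (Om : set V) f : sm f -> smooth Om f.
Proof. by move=> sf k; exact: sm_Ck. Qed.

Lemma sm_sum (I : Type) (s : seq I) (f : I -> V -> R) :
  (forall i, sm (f i)) -> sm (fun z => \sum_(i <- s) f i z).
Proof.
move=> sf; elim: s => [|i s ih].
  by rewrite (_ : (fun _ => _) = fun=> 0); [exact: sm_cst|apply/funext => z; rewrite big_nil].
rewrite (_ : (fun _ => _) = fun z => f i z + \sum_(i <- s) f i z); first exact: sm_add.
by apply/funext => z; rewrite big_cons.
Qed.

Lemma sm_flatn k f : sm f -> sm (fun z => flatn k (f z)).
Proof.
move=> sf; have := @sm_comp (fun i => flatn (k + i)) f sf.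
by rewrite addn0; apply => i z; rewrite addnS; exact: isd_flatn.
Qed.

Lemma sm_affine a b f : sm f -> sm (fun z => a + b * f z).
Proof. by move=> sf; apply: sm_add; [exact: sm_cst|apply: sm_mul => //; exact: sm_cst]. Qed.

Lemma sm_sub a f : sm f -> sm (fun z => a - f z).
Proof.
move=> sf; rewrite (_ : (fun _ => _) = fun z => a + -1 * f z); first exact: sm_affine.
by apply/funext => z; rewrite mulN1r.
Qed.

Lemma sm_theta f : sm f -> sm (fun z => theta (f z)) /\ sm (fun z => theta1 (f z)).
Proof.
move=> sf; have s1 k : sm (fun z => flatn k (1 - f z)) by apply: sm_flatn; exact: sm_sub.
have s2 k : sm (fun z => flatn k (cut - flatn 0 (1 - f z))).
  by apply: sm_flatn; apply: sm_sub.
split.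
  by apply: sm_sub; apply: sm_mul => //; exact: sm_cst.
apply: sm_mul; last exact: sm_cst.
rewrite (_ : (fun _ => _) = fun z => 0 - flatn 1 (cut - flatn 0 (1 - f z)) * flatn 1 (1 - f z)).
  by apply: sm_sub; apply: sm_mul.
by apply/funext => z; rewrite sub0r.
Qed.

Lemma isdXn (k : nat) (t : R) : is_derive t 1 (fun s => s ^+ k.+1) (k.+1%:R * t ^+ k).
Proof.
elim: k => [|k ih].
  by rewrite expr0 mulr1; under eq_fun do rewrite expr1; exact: isdI.
under eq_fun do rewrite exprS.
apply: isd_eq (isdM (isdI t) ih) _.
by rewrite -[k.+2]addn1 natrD exprS; ring.
Qed.

(** All derivatives of [ln] on the positive half-line at once, the form required by [sm_comp]. *)
Definition lnder (k : nat) (x : R) : R :=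
  if k is k'.+1 then (-1) ^+ k' * k'`!%:R * x ^- k'.+1 else ln x.

Lemma isd_lnder k (x : R) : 0 < x -> is_derive x 1 (lnder k) (lnder k.+1 x).
Proof.
move=> x0; case: k => [|k] /=.
  by apply: isd_eq (is_derive1_ln x0) _; rewrite !mul1r expr1.
have xk : x ^+ k.+1 != 0 by rewrite expf_neq0// gt_eqF.
have := @is_deriveV R (fun s : R => s ^+ k.+1) x _ 1 xk (isdXn k x).
move=> h2; apply: isd_eq (isdM (isdC ((-1) ^+ k * k`!%:R) x) h2) _.
rewrite /GRing.scale/= factS natrM !exprS; field.
by rewrite expf_neq0 ?gt_eqF.
Qed.

Lemma sm_ln f : sm f -> (forall z, 0 < f z) -> sm (fun z => ln (f z)).
Proof. by move=> sf f0; apply: (@sm_comp lnder) => // k z; exact: isd_lnder. Qed.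

End smooth_class.

(** * Radial weights and the twisted data *)

Section radial.
Context {R : realType} {n : nat}.
Local Notation C := R[i].
Local Notation Re := (@complex.Re R).
Local Notation Im := (@complex.Im R).
Local Notation V := 'rV[R[i]]_n.
Variable w : V.
Implicit Types (z v : V).

Lemma CRe_sum (I : Type) (s : seq I) (F : I -> C) : Re (\sum_(i <- s) F i) = \sum_(i <- s) Re (F i).
Proof. by elim: s => [|i s ih]; rewrite ?big_nil// !big_cons CReD ih. Qed.

Lemma realCD (x y : R) : (x + y)%:C%C = x%:C%C + y%:C%C :> C.
Proof. by apply: Ceq; rewrite ?CReD ?CImD/= ?addr0. Qed.

Lemma realCM (x y : R) : (x * y)%:C%C = x%:C%C * y%:C%C :> C.
Proof. by apply: Ceq; rewrite ?CReM ?CImM/=; ring. Qed.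

Definition zeta (j : 'I_n) (z : V) : C := z 0 j - w 0 j.

Definition sqdist z : R := \sum_(j < n) sqmod (zeta j z).

Lemma sqdist_ge0 z : 0 <= sqdist z.
Proof. by apply: sumr_ge0 => j _; exact: sqmod_ge0. Qed.

Lemma sqmod_le_sqdist j z : sqmod (zeta j z) <= sqdist z.
Proof.
rewrite /sqdist (bigD1 j)//= lerDl; apply: sumr_ge0 => k _; exact: sqmod_ge0.
Qed.

Lemma sm_zeta j : sm (fun z => Re (zeta j z)) /\ sm (fun z => Im (zeta j z)).
Proof.
split.
  rewrite (_ : (fun _ => _) = fun z => Re (z 0 j) + - Re (w 0 j)).
    by apply: sm_add; [exact: sm_re|exact: sm_cst].
  by apply/funext => z; rewrite /zeta CReB.
rewrite (_ : (fun _ => _) = fun z => Im (z 0 j) + - Im (w 0 j)).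
  by apply: sm_add; [exact: sm_im|exact: sm_cst].
by apply/funext => z; rewrite /zeta CImB.
Qed.

Lemma sm_sqdist : sm sqdist.
Proof.
apply: sm_sum => j; have [h1 h2] := sm_zeta j.
rewrite (_ : (fun _ => _) = fun z => Re (zeta j z) * Re (zeta j z) + Im (zeta j z) * Im (zeta j z)).
  by apply: sm_add; apply: sm_mul.
by apply/funext => z; rewrite /sqmod !expr2.
Qed.

Lemma sqdist_dder v z : has_dder sqdist v z
  (2 * \sum_(j < n) (Re (zeta j z) * Re (v 0 j) + Im (zeta j z) * Im (v 0 j))).
Proof.
set B := \sum_(j < n) _; pose A := \sum_(j < n) sqmod (v 0 j).
have h : is_derive (0 : R) 1 (fun t => sqdist z + t * (2 * B) + t ^+ 2 * A) (2 * B).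
  apply: isd_eq (isdD (isdD (isdC _ 0) (isdM (isdI 0) (isdC _ 0))) (isdM (isdX2 (isdI 0)) (isdC _ 0))) _.
  by ring.
move: h; congr is_derive; apply/funext => t.
rewrite /sqdist /B /A !mulr_sumr -!big_split /=; apply: eq_bigr => j _.
by rewrite /sqmod /zeta !CReB !CImB !mxE !CReD !CImD !CReM !CImM/=; ring.
Qed.

Lemma sum_delta (F : 'I_n -> R) i : \sum_(j < n) F j * (i == j)%:R = F i.
Proof.
rewrite (bigD1 i)//= eqxx mulr1 big1 ?addr0// => j ji.
by rewrite eq_sym (negbTE ji) mulr0.
Qed.

Lemma Re_xdir (i j : 'I_n) : Re (xdir R i 0 j) = (i == j)%:R /\ Im (xdir R i 0 j) = 0.
Proof. by rewrite /xdir mxE/= eq_sym; case: (i == j). Qed.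

Lemma Re_ydir (i j : 'I_n) : Re (ydir R i 0 j) = 0 /\ Im (ydir R i 0 j) = (i == j)%:R.
Proof. by rewrite /ydir !mxE eqxx/= eq_sym; case: (i == j); rewrite ?mulr1 ?mulr0. Qed.

Lemma sqdist_dderx i z : has_dder sqdist (xdir R i) z (2 * Re (zeta i z)).
Proof.
have := sqdist_dder (xdir R i) z; congr (has_dder _ _ _ (_ * _)).
rewrite -[RHS](sum_delta (fun j => Re (zeta j z))); apply: eq_bigr => j _.
by have [-> ->] := Re_xdir i j; rewrite mulr0 addr0.
Qed.

Lemma sqdist_ddery i z : has_dder sqdist (ydir R i) z (2 * Im (zeta i z)).
Proof.
have := sqdist_dder (ydir R i) z; congr (has_dder _ _ _ (_ * _)).
rewrite -[RHS](sum_delta (fun j => Im (zeta j z))); apply: eq_bigr => j _.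
by have [-> ->] := Re_ydir i j; rewrite mulr0 add0r.
Qed.

Lemma radial_dder (l : R -> R) (a d : R) v z : is_derive (sqdist z) 1 l a ->
  has_dder sqdist v z d -> has_dder (fun y => l (sqdist y)) v z (a * d).
Proof.
move=> hl hd; apply: (isd_comp (g := fun t : R => sqdist (z + t%:C%C *: v)) _ hd).
by rewrite scale0r addr0.
Qed.

Lemma zeta_dder j v z : has_dder (fun y => Re (zeta j y)) v z (Re (v 0 j)) /\
  has_dder (fun y => Im (zeta j y)) v z (Im (v 0 j)).
Proof.
split.
  have h : is_derive (0 : R) 1 (fun t => Re (zeta j z) + t * Re (v 0 j)) (Re (v 0 j)).
    by apply: isd_eq (isdD (isdC _ 0) (isdM (isdI 0) (isdC _ 0))) _; ring.
  by move: h; congr is_derive; apply/funext => t; rewrite /zeta !CReB !mxE CReD CReM/=; ring.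
have h : is_derive (0 : R) 1 (fun t => Im (zeta j z) + t * Im (v 0 j)) (Im (v 0 j)).
  by apply: isd_eq (isdD (isdC _ 0) (isdM (isdI 0) (isdC _ 0))) _; ring.
by move: h; congr is_derive; apply/funext => t; rewrite /zeta !CImB !mxE CImD CImM/=; ring.
Qed.

Lemma cderiveE f v z a b : has_dder (fun y => Re (f y)) v z a ->
  has_dder (fun y => Im (f y)) v z b -> cderive v f z = Complex a b.
Proof.
by move=> /has_dder_rderive[_ h1] /has_dder_rderive[_ h2]; rewrite /cderive h1 h2.
Qed.

Lemma half_cderive (a b c d : R) : (Complex a b + 'i%C * Complex c d) / 2 =
  Complex ((a - d) / 2) ((b + c) / 2).
Proof.
have -> : (2 : C)^-1 = (2^-1)%:C%C by rewrite fmorphV rmorph_nat.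
by apply: Ceq; rewrite ?CReM ?CImM ?CReD ?CImD ?CReM ?CImM/=; ring.
Qed.

Lemma half_cderiveN (a b c d : R) : (Complex a b - 'i%C * Complex c d) / 2 =
  Complex ((a + d) / 2) ((b - c) / 2).
Proof.
have -> : (2 : C)^-1 = (2^-1)%:C%C by rewrite fmorphV rmorph_nat.
by apply: Ceq; rewrite ?CReM ?CImM ?CReB ?CImB ?CReM ?CImM/=; ring.
Qed.

Lemma dzbar_radial (l : R -> R) (a : R) j z : is_derive (sqdist z) 1 l a ->
  dzbar j (fun y => (l (sqdist y))%:C%C) z = a%:C%C * zeta j z.
Proof.
move=> hl; rewrite /dzbar.
rewrite (@cderiveE _ _ _ (a * (2 * Re (zeta j z))) 0); last 2 first.
- by apply: radial_dder => //; exact: sqdist_dderx.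
- exact: isdC.
rewrite (@cderiveE _ _ _ (a * (2 * Im (zeta j z))) 0); last 2 first.
- by apply: radial_dder => //; exact: sqdist_ddery.
- exact: isdC.
by rewrite half_cderive; apply: Ceq; rewrite ?CReM ?CImM/=; field.
Qed.

Lemma radial_zeta_cderive (l : R -> R) (a d : R) j v z : is_derive (sqdist z) 1 l a ->
  has_dder sqdist v z d ->
  cderive v (fun y => (l (sqdist y))%:C%C * zeta j y) z =
  Complex (a * d * Re (zeta j z) + l (sqdist z) * Re (v 0 j))
          (a * d * Im (zeta j z) + l (sqdist z) * Im (v 0 j)).
Proof.
move=> hl hd; have hr := radial_dder hl hd; have [h1 h2] := zeta_dder j v z.
apply: cderiveE.
  have := isdM hr h1; rewrite !scale0r !addr0; congr is_derive.
  by apply/funext => t; rewrite CReM/=; ring.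
have := isdM hr h2; rewrite !scale0r !addr0; congr is_derive.
by apply/funext => t; rewrite CImM/=; ring.
Qed.

Lemma dzbar_radial_zeta (l : R -> R) (a : R) i j z : is_derive (sqdist z) 1 l a ->
  dzbar i (fun y => (l (sqdist y))%:C%C * zeta j y) z = a%:C%C * zeta i z * zeta j z.
Proof.
move=> hl; rewrite /dzbar.
rewrite (radial_zeta_cderive j hl (sqdist_dderx i z)).
rewrite (radial_zeta_cderive j hl (sqdist_ddery i z)).
rewrite half_cderive; have [-> ->] := Re_xdir i j; have [-> ->] := Re_ydir i j.
by apply: Ceq; rewrite ?CReM ?CImM/= ?CReM ?CImM/=; field.
Qed.

Lemma dz_radial_zeta (l : R -> R) (a : R) i j z : is_derive (sqdist z) 1 l a ->
  dz i (fun y => (l (sqdist y))%:C%C * zeta j y) z =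
  a%:C%C * conjc (zeta i z) * zeta j z + (l (sqdist z))%:C%C * (i == j)%:R.
Proof.
move=> hl; rewrite /dz.
rewrite (radial_zeta_cderive j hl (sqdist_dderx i z)).
rewrite (radial_zeta_cderive j hl (sqdist_ddery i z)).
rewrite half_cderiveN; have [-> ->] := Re_xdir i j; have [-> ->] := Re_ydir i j.
move: (zeta i z) (zeta j z) => [p q] [s t].
by case: (i == j); rewrite ?mulr1 ?mulr0; apply: Ceq; rewrite ?CReD ?CImD ?CReM ?CImM/= ?CReM ?CImM/=; field.
Qed.

Section psi.
Variables (N : nat) (d : R).
Hypothesis d0 : 0 < d.

(* The shift [d] smooths the pole N log |z - w|^2 that makes small L^2 norms force
   small values at w. *)
Definition psi_fun (s : R) : R := s + N%:R * ln (s + d).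
Definition psi_der (s : R) : R := 1 + N%:R / (s + d).
Definition psi_der2 (s : R) : R := - N%:R / (s + d) ^+ 2.
Definition psi z : R := psi_fun (sqdist z).

Let sd0 z : 0 < sqdist z + d.
Proof. by rewrite ltr_wpDl// sqdist_ge0. Qed.

Lemma isd_psi (s : R) : 0 < s + d -> is_derive s 1 psi_fun (psi_der s).
Proof.
move=> h; have h1 := isd_comp (g := fun s => s + d) (is_derive1_ln h) (isdD (isdI s) (isdC d s)).
by apply: isd_eq (isdD (isdI s) (isdM (isdC N%:R s) h1)) _; rewrite /psi_der; ring.
Qed.

Lemma isd_psi_der (s : R) : 0 < s + d -> is_derive s 1 psi_der (psi_der2 s).
Proof.
move=> h; have h0 : s + d != 0 by rewrite gt_eqF.
have h1 := @is_deriveV R (fun s => s + d) s _ 1 h0 (isdD (isdI s) (isdC d s)).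
apply: isd_eq (isdD (isdC 1 s) (isdM (isdC N%:R s) h1)) _.
by rewrite /psi_der2 /GRing.scale/=; field.
Qed.

Lemma psi_smooth (Om : set V) : smooth Om psi.
Proof.
apply: sm_smooth; apply: sm_add; first exact: sm_sqdist.
apply: sm_mul; first exact: sm_cst.
by apply: sm_ln => //; apply: sm_add; [exact: sm_sqdist|exact: sm_cst].
Qed.

(** A scalar matrix plus one of rank one built from [zeta]. Hence [zeta] is an eigenvector, and the
    inverse matrix is explicit on the multiples of [zeta], which are the only forms used. *)
Lemma levi_psi z i j : levi psi z i j =
  (psi_der2 (sqdist z))%:C%C * conjc (zeta i z) * zeta j z +
  (psi_der (sqdist z))%:C%C * (i == j)%:R.
Proof.
rewrite mxE; have -> : dzbar j (fun y => ((psi y)%:C)%C) =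
    fun y => (psi_der (sqdist y))%:C%C * zeta j y.
  by apply/funext => y; apply: dzbar_radial; exact: isd_psi.
by apply: dz_radial_zeta; exact: isd_psi_der.
Qed.

Definition inner (xi : V) z : C := \sum_i xi 0 i * conjc (zeta i z).

Lemma cauchy_schwarz (xi : V) z :
  sqmod (inner xi z) <= (\sum_i sqmod (xi 0 i)) * sqdist z.
Proof.
set X := \sum_i _; set b := inner xi z; set Q := sqdist z.
(* This sum equals Q (X Q - |b|^2), which settles Q > 0; when Q = 0 every [zeta i z] is zero. *)
have : 0 <= \sum_i sqmod (Q%:C%C * xi 0 i - b * zeta i z).
  by apply: sumr_ge0 => i _; exact: sqmod_ge0.
have -> : \sum_i sqmod (Q%:C%C * xi 0 i - b * zeta i z) = Q * (X * Q - sqmod b).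
  rewrite (eq_bigr (fun i => Q ^+ 2 * sqmod (xi 0 i) + sqmod b * sqmod (zeta i z)
     - 2 * Q * Re (conjc b * (xi 0 i * conjc (zeta i z))))); last first.
    move=> i _; rewrite /sqmod CReB CImB !CReM !CImM.
    by case: b => ? ?; case: (xi 0 i) => ? ?; case: (zeta i z) => ? ? /=; ring.
  rewrite sumrB big_split/= -!mulr_sumr -CRe_sum -mulr_sumr -/X -/Q -/(inner xi z) -/b.
  have -> : Re (conjc b * b) = sqmod b by rewrite /sqmod; case: (b) => ? ? /=; ring.
  have -> : \sum_(i < n) sqmod (zeta i z) = Q by [].
  by ring.
have [Q0|Q0|Q0] := ltgtP 0 Q.
- by rewrite pmulr_rge0// subr_ge0.
- by have := sqdist_ge0 z; rewrite leNgt Q0.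
move=> _; rewrite -Q0 mulr0 /b /inner big1 ?/sqmod//= ?expr0n ?addr0// => i _.
have : sqmod (zeta i z) = 0.
  apply: le_anti; rewrite sqmod_ge0 andbT.
  by apply: le_trans (sqmod_le_sqdist i z) _; rewrite -/Q -Q0.
rewrite /sqmod => /eqP; rewrite paddr_eq0 ?sqr_ge0// !sqrf_eq0 => /andP[/eqP h1 /eqP h2].
by rewrite (_ : zeta i z = 0) ?conjc0 ?mulr0//; apply: Ceq.
Qed.

Lemma levi_psi_form (xi : V) z :
  \sum_i \sum_j levi psi z i j * xi 0 i * conjc (xi 0 j) =
  (psi_der (sqdist z) * (\sum_i sqmod (xi 0 i)) +
   psi_der2 (sqdist z) * sqmod (inner xi z))%:C%C.
Proof.
set a := psi_der _; set b := psi_der2 _.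
rewrite (eq_bigr (fun i => b%:C%C * (xi 0 i * conjc (zeta i z)) * conjc (inner xi z)
   + a%:C%C * (sqmod (xi 0 i))%:C%C)); last first.
  move=> i _; rewrite (eq_bigr (fun j => b%:C%C * (xi 0 i * conjc (zeta i z)) *
     conjc (xi 0 j * conjc (zeta j z)) + a%:C%C * (xi 0 i * conjc (xi 0 j)) * (i == j)%:R)); last first.
    move=> j _; rewrite levi_psi -/a -/b.
    have -> : conjc (xi 0 j * conjc (zeta j z)) = conjc (xi 0 j) * zeta j z by rewrite rmorphM/= conjcK.
    by ring.
  rewrite big_split/= -mulr_sumr /inner rmorph_sum; congr (_ + _).
  rewrite (bigD1 i)//= eqxx mulr1 big1 ?addr0; last first.
    by move=> j ji; rewrite eq_sym (negbTE ji) mulr0.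
  congr (_ * _); case: (xi 0 i) => p q; apply: Ceq; rewrite ?CReM ?CImM /sqmod/=; ring.
rewrite big_split/= -mulr_suml -!mulr_sumr -/(inner xi z).
have -> : \sum_(i < n) (sqmod (xi 0 i))%:C%C = (\sum_i sqmod (xi 0 i))%:C%C :> C by rewrite rmorph_sum.
have -> : b%:C%C * inner xi z * conjc (inner xi z) = b%:C%C * (sqmod (inner xi z))%:C%C.
  by case: (inner xi z) => p q; apply: Ceq; rewrite ?CReM ?CImM ?CReM ?CImM /sqmod/=; ring.
by rewrite -!realCM -realCD addrC.
Qed.

(** The summand |z - w|^2 contributes exactly |xi|^2, and the Levi form of the logarithm is
    nonnegative by Cauchy-Schwarz. *)
Lemma psi_form_ge (xi : V) z : \sum_i sqmod (xi 0 i) <=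
  psi_der (sqdist z) * (\sum_i sqmod (xi 0 i)) + psi_der2 (sqdist z) * sqmod (inner xi z).
Proof.
have CS := cauchy_schwarz xi z; have Q0 := sqdist_ge0 z; have h := sd0 z.
set X := \sum_i _ in CS *; set Q := sqdist z in CS Q0 h *; set b := sqmod _ in CS *.
have X0 : 0 <= X by apply: sumr_ge0 => i _; exact: sqmod_ge0.
have -> : psi_der Q * X + psi_der2 Q * b = X + N%:R / (Q + d) ^+ 2 * ((Q + d) * X - b).
  by rewrite /psi_der /psi_der2; field; rewrite gt_eqF.
rewrite lerDl mulr_ge0 ?divr_ge0 ?sqr_ge0// subr_ge0; apply: le_trans CS _.
by rewrite mulrC ler_wpM2r// lerDl ltW.
Qed.

Lemma sumsq_gt0 (xi : V) : xi != 0 -> 0 < \sum_i sqmod (xi 0 i).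
Proof.
move=> xi0; rewrite lt_def; apply/andP; split; last first.
  by apply: sumr_ge0 => i _; exact: sqmod_ge0.
apply: contra xi0 => /eqP /psumr_eq0P h; apply/eqP/rowP => i; rewrite mxE.
have := h (fun i _ => sqmod_ge0 _) i isT.
rewrite /sqmod => /eqP; rewrite paddr_eq0 ?sqr_ge0// !sqrf_eq0 => /andP[/eqP h1 /eqP h2].
exact: Ceq.
Qed.

Lemma psi_strictly_psh (Om : set V) : strictly_psh Om psi.
Proof.
move=> z _ xi xi0; rewrite levi_psi_form ltcR.
exact: lt_le_trans (sumsq_gt0 xi0) (psi_form_ge xi z).
Qed.

(** A nonzero row killed by the Levi matrix would be a zero of the positive Levi form. *)
Lemma levi_psi_unit z : levi psi z \in unitmx.
Proof.
rewrite -row_free_unit -kermx_eq0; apply/negPn/negP => /rowV0Pn[v /sub_kermxP vL v0].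
have := @psi_strictly_psh setT z I v v0.
rewrite (eq_bigr (fun i => \sum_j v 0 i * levi psi z i j * conjc (v 0 j))); last first.
  by move=> i _; apply: eq_bigr => j _; rewrite [_ * v 0 i]mulrC.
rewrite exchange_big/= big1 ?ltxx// => j _; rewrite -mulr_suml.
by have := congr1 (fun M : V => M 0 j) vL; rewrite !mxE => ->; rewrite mul0r.
Qed.

(** The row of the [zeta j z] is an eigenvector of the Levi matrix with eigenvalue k = 1 + N d / (Q
    + d)^2, where Q = |z - w|^2. The norm is therefore c^2 Q / k, and k >= 1 gives a bound uniform
    in d. *)
Lemma form_sqnorm_radial (c : V -> R) z :
  0 <= form_sqnorm psi (fun j y => (c y)%:C%C * zeta j y) z <= c z ^+ 2 * sqdist z.
Proof.
have Q0 := sqdist_ge0 z; have h := sd0 z.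
pose k := psi_der (sqdist z) + psi_der2 (sqdist z) * sqdist z.
have k1 : 1 <= k.
  rewrite /k /psi_der /psi_der2; set Q := sqdist z in Q0 h *.
  have -> : 1 + N%:R / (Q + d) + - N%:R / (Q + d) ^+ 2 * Q = 1 + N%:R * d / (Q + d) ^+ 2.
    by field; rewrite gt_eqF.
  by rewrite lerDl divr_ge0 ?sqr_ge0// mulr_ge0// ltW.
pose Z : V := \row_j zeta j z.
have sumc : \sum_i zeta i z * conjc (zeta i z) = (sqdist z)%:C%C.
  rewrite /sqdist rmorph_sum; apply: eq_bigr => i _.
  case: (zeta i z) => p q; apply: Ceq; rewrite ?CReM ?CImM /sqmod/=; ring.
have ZL : Z *m levi psi z = k%:C%C *: Z.
  apply/rowP => j; rewrite !mxE.
  rewrite (eq_bigr (fun i => (psi_der2 (sqdist z))%:C%C * zeta j z * (zeta i z * conjc (zeta i z))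
     + (psi_der (sqdist z))%:C%C * (zeta i z * (i == j)%:R))); last first.
    by move=> i _; rewrite mxE levi_psi; ring.
  rewrite big_split/= -!mulr_sumr sumc.
  have -> : \sum_i zeta i z * (i == j)%:R = zeta j z.
    by rewrite (bigD1 j)//= eqxx mulr1 big1 ?addr0// => i ij; rewrite (negbTE ij) mulr0.
  have -> : k%:C%C = (psi_der (sqdist z))%:C%C + (psi_der2 (sqdist z))%:C%C * (sqdist z)%:C%C.
    by rewrite -realCM -realCD.
  by rewrite mulrDl addrC; congr (_ + _); rewrite mulrAC.
have k0 : k%:C%C != 0 :> C by rewrite fmorph_eq0 gt_eqF// (lt_le_trans ltr01).
have ZI : Z *m invmx (levi psi z) = (k%:C%C)^-1 *: Z.
  have h1 : k%:C%C *: (Z *m invmx (levi psi z)) = Z by rewrite scalemxAl -ZL mulmxK// levi_psi_unit.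
  by rewrite -[in RHS]h1 scalerA mulVf// scale1r.
have -> : form_sqnorm psi (fun j y => (c y)%:C%C * zeta j y) z = c z ^+ 2 * sqdist z / k.
  rewrite /form_sqnorm exchange_big/=.
  rewrite (eq_bigr (fun j => (c z ^+ 2 / k)%:C%C * (zeta j z * conjc (zeta j z)))); last first.
    move=> j _; have := congr1 (fun M : V => M 0 j) ZI; rewrite !mxE => e.
    have -> : (c z ^+ 2 / k)%:C%C * (zeta j z * conjc (zeta j z)) =
      (c z)%:C%C * conjc ((c z)%:C%C * zeta j z) * ((k%:C%C)^-1 * zeta j z).
      have -> : conjc ((c z)%:C%C * zeta j z) = (c z)%:C%C * conjc (zeta j z).
        by case: (zeta j z) => p q; apply: Ceq; rewrite ?CReM ?CImM/=; ring.
      have -> : (c z ^+ 2 / k)%:C%C = (c z)%:C%C * (c z)%:C%C * (k%:C%C)^-1.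
        by rewrite realCM expr2 realCM fmorphV.
      by move: (k%:C%C)^-1 ((c z)%:C%C) => x y; ring.
    rewrite -e mulr_sumr; apply: eq_bigr => i _; rewrite mxE.
    have gen (x y t s : C) : t * (y * s) * x = y * x * (s * t) by ring.
    exact: gen.
  rewrite -mulr_sumr sumc CReM/=; ring.
have kp : 0 < k by exact: lt_le_trans k1.
have A0 : 0 <= c z ^+ 2 * sqdist z by apply: mulr_ge0 => //; exact: sqr_ge0.
by rewrite divr_ge0 ?(ltW kp)//= ler_pdivrMr// ler_peMr.
Qed.

End psi.

Section cutoff.
Variable e : R.
Hypothesis e0 : 0 < e.

Definition chi z : R := theta (sqdist z / e ^+ 2).
Definition chi_der (s : R) : R := theta1 (s / e ^+ 2) / e ^+ 2.
Definition alpha : form01 R n := fun j z => (chi_der (sqdist z))%:C%C * zeta j z.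

Lemma sm_scaled : sm (fun z => sqdist z / e ^+ 2).
Proof. by apply: sm_mul; [exact: sm_sqdist|exact: sm_cst]. Qed.

Lemma sm_chi : sm chi.
Proof. exact: (sm_theta sm_scaled).1. Qed.

Lemma isd_scaled (s : R) : is_derive s 1 (fun s => s / e ^+ 2) (e ^- 2).
Proof. by apply: isd_eq (isdM (isdI s) (isdC _ s)) _; ring. Qed.

Lemma dbar_chi j z : dzbar j (fun y => (chi y)%:C%C) z = alpha j z.
Proof.
apply: (@dzbar_radial (fun s => theta (s / e ^+ 2))).
exact: (isd_comp (g := fun s => s / e ^+ 2) (isd_theta _) (isd_scaled _)).
Qed.

Lemma alpha_smooth (Om : set V) : smooth_form Om alpha.
Proof.
move=> j; have s1 : sm (fun z => chi_der (sqdist z)).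
  by apply: sm_mul; [exact: (sm_theta sm_scaled).2|exact: sm_cst].
have [z1 z2] := sm_zeta j.
split; apply: sm_smooth.
  rewrite (_ : (fun _ => _) = fun z => chi_der (sqdist z) * Re (zeta j z)); first exact: sm_mul.
  by apply/funext => z; rewrite /alpha CReM/=; ring.
rewrite (_ : (fun _ => _) = fun z => chi_der (sqdist z) * Im (zeta j z)); first exact: sm_mul.
by apply/funext => z; rewrite /alpha CImM/=; ring.
Qed.

Lemma alpha_closed (Om : set V) : dbar_closed Om alpha.
Proof.
move=> i j z _; have h : is_derive (sqdist z) 1 chi_der (theta2 (sqdist z / e ^+ 2) / e ^+ 2 / e ^+ 2).
  have h1 := isd_comp (g := fun s => s / e ^+ 2) (isd_theta1 _) (isd_scaled (sqdist z)).
  by apply: isd_eq (isdM h1 (isdC (e ^- 2) _)) _; ring.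
by rewrite !(dzbar_radial_zeta _ _ h); ring.
Qed.

(** [alpha] lives on the shell e^2 / 4 < |z - w|^2 < e^2. The outer radius keeps it where phi is
    controlled; the hole makes the solution holomorphic near w and keeps psi bounded below on the
    support. *)
Lemma chi_der0 s : s <= e ^+ 2 / 4 \/ e ^+ 2 <= s -> chi_der s = 0.
Proof.
have e2 : 0 < e ^+ 2 by rewrite exprn_gt0.
rewrite /chi_der => -[h|h].
  have [|_ ->] := @theta_small R (s / e ^+ 2); last by rewrite mul0r.
  by rewrite ler_pdivrMr// mulrC.
have [|_ ->] := @theta_large R (s / e ^+ 2); last by rewrite mul0r.
by rewrite ler_pdivlMr// mul1r.
Qed.

Lemma sqdist_cbox z : sqdist z <= e ^+ 2 -> cbox w e z.
Proof.
move=> h j; have := le_trans (sqmod_le_sqdist j z) h; rewrite /sqmod /zeta CReB CImB => h1.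
by split; rewrite -(@ler_pXn2r _ 2) ?nnegrE ?(ltW e0)// real_normK ?num_real//;
  apply: le_trans h1; rewrite ?lerDl ?lerDr sqr_ge0.
Qed.

Lemma alpha_compact (Om : set V) : cbox w e `<=` Om -> compact_support Om alpha.
Proof.
move=> eO; have sub : closure [set z | Om z /\ exists j, alpha j z != 0] `<=` cbox w e.
  rewrite [X in _ `<=` X](closure_id _).1; last exact: closed_cbox.
  apply: closureS => z [_ [j aj]]; apply: sqdist_cbox; rewrite leNgt; apply/negP => h.
  by move/negP : aj; apply; rewrite /alpha chi_der0 ?mul0r//; right; exact: ltW.
rewrite /compact_support setIidr; last by move=> z /sub; exact: eO.
by apply: (subclosed_compact _ (@compact_cbox R n w e) sub); exact: closed_closure.
Qed.

End cutoff.

(** * Differences of smooth functions on an open set *)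

Section Ck_closure.
Variable Om : set V.
Hypothesis oO : open Om.

Lemma Ck_ext k f g : (forall z, Om z -> f z = g z) -> Ck k Om f -> Ck k Om g.
Proof.
have near_line z v : Om z -> \forall t \near (0 : R), Om (z + t%:C%C *: v).
  move=> Oz; have c : {for (0 : R), continuous (fun t : R => z + t%:C%C *: v)}.
    apply: cont_coordP => j; split.
      apply: (continuous_for_ext (g := fun t : R => Re (z 0 j) + t * Re (v 0 j))).
        by move=> t; rewrite !mxE CReD CReM/=; ring.
      by apply: contD; [exact: cont_cst|apply: contM; [exact: cvg_id|exact: cont_cst]].
    apply: (continuous_for_ext (g := fun t : R => Im (z 0 j) + t * Im (v 0 j))).
      by move=> t; rewrite !mxE CImD CImM/=; ring.
    by apply: contD; [exact: cont_cst|apply: contM; [exact: cvg_id|exact: cont_cst]].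
  have z0 : z + (0 : R)%:C%C *: v = z by rewrite scale0r addr0.
  by apply: (c Om); rewrite z0; exact: open_nbhs_nbhs.
have cont_ext (f' g' : V -> R) : (forall z, Om z -> f' z = g' z) ->
    forall z, Om z -> {for z, continuous f'} -> {for z, continuous g'}.
  move=> fg z Oz cfz U; rewrite -(fg z Oz) => Uf.
  have [e1 e10 h1] := (nbhs_boxP z _).1 (cfz U Uf).
  have [e2 e20 h2] := open_box oO Oz.
  have H : nbhs z (g' @^-1` U).
    apply/nbhs_boxP; exists (Num.min e1 e2); first by rewrite lt_min e10.
    move=> y hy; have Oy : Om y.
      by apply: h2 => j; have := hy j; rewrite !lt_min => -[/andP[_ ?] /andP[_ ?]].
    rewrite /= -(fg y Oy); apply: h1 => j.
    by have := hy j; rewrite !lt_min => -[/andP[? _] /andP[? _]].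
  exact: H.
elim: k f g => [|k ih] f g fg [cf hf]; split=> //.
- by move=> z Oz; apply: (cont_ext _ _ fg _ Oz); exact: cf.
- by move=> z Oz; apply: (cont_ext _ _ fg _ Oz); exact: cf.
move=> v hv; have [df Cf] := hf v hv.
have key z : Om z -> has_dder g v z (rderive v f z).
  move=> Oz; apply: near_eq_is_derive (rderivable_dder (df z Oz)).
  by apply: filterS (near_line z v Oz) => t; exact: fg.
split; first by move=> z Oz; have [] := has_dder_rderive (key z Oz).
apply: ih Cf => z Oz; by have [_ ->] := has_dder_rderive (key z Oz).
Qed.

Lemma CkB k f g : Ck k Om f -> Ck k Om g -> Ck k Om (fun z => f z - g z).
Proof.
elim: k f g => [|k ih] f g [cf hf] [cg hg]; split => //.
- by move=> z Oz; apply: contB; [exact: cf|exact: cg].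
- by move=> z Oz; apply: contB; [exact: cf|exact: cg].
move=> v hv; have [df Cf] := hf v hv; have [dg Cg] := hg v hv.
have key z : Om z -> has_dder (fun z => f z - g z) v z (rderive v f z - rderive v g z).
  move=> Oz; exact: (isdB (rderivable_dder (df z Oz)) (rderivable_dder (dg z Oz))).
split; first by move=> z Oz; have [] := has_dder_rderive (key z Oz).
apply: Ck_ext (ih _ _ Cf Cg) => z Oz; by have [_ ->] := has_dder_rderive (key z Oz).
Qed.

Lemma csmoothB f g : csmooth Om f -> csmooth Om g -> csmooth Om (fun z => f z - g z).
Proof.
move=> [f1 f2] [g1 g2]; split=> k.
  by apply: Ck_ext (CkB (f1 k) (g1 k)) => z _; rewrite CReB.
by apply: Ck_ext (CkB (f2 k) (g2 k)) => z _; rewrite CImB.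
Qed.

Lemma dzbarB f g j z : csmooth Om f -> csmooth Om g -> Om z ->
  dzbar j (fun z => f z - g z) z = dzbar j f z - dzbar j g z.
Proof.
move=> [f1 f2] [g1 g2] Oz.
have h (v : V) : (exists j, v = xdir R j \/ v = ydir R j) ->
    cderive v (fun z => f z - g z) z = cderive v f z - cderive v g z.
  move=> hv; have d1 h (Ch : Ck 1 Om h) : has_dder h v z (rderive v h z).
    by apply: rderivable_dder; have [_ /(_ v hv)[+ _]] := Ch; apply.
  rewrite (@cderiveE _ _ _ (rderive v (fun w => Re (f w)) z - rderive v (fun w => Re (g w)) z)
     (rderive v (fun w => Im (f w)) z - rderive v (fun w => Im (g w)) z)).
  - by apply: Ceq; rewrite ?CReB ?CImB.
  - have := isdB (d1 _ (f1 1%N)) (d1 _ (g1 1%N)); congr is_derive.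
    by apply/funext => t; rewrite CReB.
  - have := isdB (d1 _ (f2 1%N)) (d1 _ (g2 1%N)); congr is_derive.
    by apply/funext => t; rewrite CImB.
rewrite /dzbar !h; [|by exists j; right|by exists j; left].
by rewrite -mulrBl mulrBr opprD addrACA.
Qed.

End Ck_closure.
End radial.

(** * Weighted extension from a point *)

(** Nonnegative integrals are suprema over simple functions, so monotonicity needs no measurability
    of [f] and [g]. Weights containing phi are compared only in this way. The alternative [f x = 0]
    lets the domain shrink to the support of [f]. *)
Lemma ge0_integral_mono d (T : measurableType d) (R : realType)
    (mu : {measure set T -> \bar R}) (D D' : set T) (f g : T -> \bar R) :
  (forall x, D x -> 0 <= f x)%E -> (forall x, D' x -> 0 <= g x)%E ->
  (forall x, D x -> f x = 0%E \/ D' x /\ (f x <= g x)%E) ->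
  (\int[mu]_(x in D) f x <= \int[mu]_(x in D') g x)%E.
Proof.
move=> f0 g0 fg; rewrite !ge0_integralE//.
apply: le_ereal_sup => _ [h hf <-]; exists h => // x; apply: le_trans (hf x) _.
have g0' : (0 <= (g \_ D') x)%E by rewrite patchE; case: ifPn => // /set_mem; exact: g0.
rewrite patchE; case: ifPn => // /set_mem/fg[->//|[D'x fgx]].
by rewrite patchE mem_set.
Qed.

Section Cn_integral.
Context {R : realType} {n : nat}.
Local Notation C := R[i].
Local Notation Re := (@complex.Re R).
Local Notation Im := (@complex.Im R).
Local Notation V := 'rV[R[i]]_n.
Local Notation P := (measurableTypeR R * measurableTypeR R)%type.
Implicit Types (z : V) (D : set V).

Lemma integral_Cn_mono D D' (f g : V -> \bar R) :
  (forall z, D z -> 0 <= f z)%E -> (forall z, D' z -> 0 <= g z)%E ->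
  (forall z, D z -> f z = 0%E \/ D' z /\ (f z <= g z)%E) -> (integral_Cn D f <= integral_Cn D' g)%E.
Proof.
by move=> f0 g0 fg; apply: ge0_integral_mono => t; [exact: f0|exact: g0|exact: fg].
Qed.

Definition tbox m (c : m.-tuple P) (r : R) : set (m.-tuple P) := [set t | forall j,
  `|(tnth t j).1 - (tnth c j).1| <= r /\ `|(tnth t j).2 - (tnth c j).2| <= r].

Lemma power_measure_box m (c : m.-tuple P) (r : R) : 0 <= r ->
  (\int[power_measure (@lebesgue_C R) m]_(t in tbox c r) 1%:E
   = (((2 * r) ^+ 2) ^+ m)%:E)%E.
Proof.
move=> r0; have shiftK (a b : R) : a + b - a = b by rewrite addrAC subrr add0r.
have mT (p : P) : measurable (translate p @` sq r : set P).
  rewrite (_ : _ @` _ = `[p.1 - r, p.1 + r]%classic `*` `[p.2 - r, p.2 + r]%classic :> set P).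
    by apply: measurableX; exact: measurable_itv.
  apply/seteqP; split => [_ [q [h1 h2] <-]|[x y] [h1 h2]]; rewrite /= !in_itv/= in h1 h2.
    by split; rewrite /= in_itv/=; lra.
  exists (x - p.1, y - p.2); first by split; rewrite /= in_itv/=; lra.
  by rewrite /translate/= !subrKC.
have mB k (c' : k.-tuple P) : measurable (tbox c' r).
  rewrite (_ : tbox c' r = \bigcap_(j in [set: 'I_k]) ((fun t : k.-tuple P => tnth t j) @^-1`
     (translate (tnth c' j) @` sq r))).
    apply: fin_bigcap_measurable => // j _; rewrite -[X in measurable X]setTI.
    by apply: measurable_tnth => //; exact: mT.
  apply/seteqP; split => [t h j _|t h j].
    have [h1 h2] := h j; exists ((tnth t j).1 - (tnth c' j).1, (tnth t j).2 - (tnth c' j).2).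
      by split; rewrite /= in_itv/= -ler_norml.
    by rewrite /translate/= !subrKC -surjective_pairing.
  have [q [/= q1 q2] <-] := h j I.
  by rewrite /= !shiftK; move: q1 q2; rewrite !in_itv/= -!ler_norml.
have mI k (c' : k.-tuple P) : measurable_fun setT ((fun=> 1%:E : \bar R) \_ (tbox c' r)).
  have H : measurable_fun (tbox c' r) (fun=> 1%:E : \bar R) by exact: measurable_cst.
  by move/(measurable_restrictT _ (mB k c')) : H.
elim: m c => [|m ih] c.
  have -> : tbox c r = setT by apply/seteqP; split => // t _; case.
  by rewrite integral_cst// mul1e expr0; exact: diracT.
case/tupleP: c => p c.
rewrite integral_mkcond integral_tcons; last 2 first.
- exact: (mI _ _).
- by move=> t; rewrite patchE; case: ifPn.
rewrite exprS EFinM -(ih c) muleC.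
rewrite [in RHS]integral_mkcond -ge0_integralZr//; last 3 first.
- exact: (mI _ _).
- by move=> t _; rewrite patchE; case: ifPn.
- by rewrite lee_fin sqr_ge0.
apply: eq_integral => t _.
have inB q : (tcons (q, t) \in tbox [tuple of p :: c] r) =
    (t \in tbox c r) && (q \in (translate p @` sq r : set P)).
  apply/idP/andP => [/set_mem h|[/set_mem h /set_mem [q' [q1 q2] <-]]].
    split; apply/mem_set.
      by move=> j; have := h (lift ord0 j); rewrite !tnthS.
    have [h1 h2] := h ord0.
    exists (q.1 - p.1, q.2 - p.2); first by split; rewrite /= in_itv/= -ler_norml.
    by rewrite /translate/= !subrKC -surjective_pairing.
  apply/mem_set => j; case: (unliftP ord0 j) => [k ->|->]; first by rewrite !tnthS; exact: h.
  rewrite /= !shiftK; move: q1 q2; rewrite /= !in_itv/= -!ler_norml.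
  by [].
under eq_integral do rewrite patchE inB.
rewrite patchE; case: ifPn => /= tB; last by rewrite integral0 mul0e.
rewrite mul1e.
rewrite (@integral_translate _ p); last 2 first.
- have H : measurable_fun (translate p @` sq r : set P) (fun=> 1%:E : \bar R) by exact: measurable_cst.
  exact: ((measurable_restrictT _ (mT p)).1 H).
- by move=> q; case: ifPn.
transitivity (\int[@lebesgue_C R]_(q in (sq r : set P)) 1%:E)%E.
  rewrite [RHS]integral_mkcond; apply: eq_integral => q _; rewrite patchE.
  congr (if _ then _ else _); apply/idP/idP => /set_mem h; apply/mem_set.
    move: h => [q' q's]; rewrite /translate => -[/addrI e1 /addrI e2].
    by move: q's; case: q' e1 e2 => ? ? /= -> ->; case: q.
  by exists q.
have ms : measurable (sq r : set P) by exact: measurable_sq.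
by rewrite integral_cst// mul1e; exact: lebesgue_C_sq.
Qed.

Lemma integral_cbox z r : 0 <= r ->
  (integral_Cn (cbox z r) (fun=> 1%:E) = (((2 * r) ^+ 2) ^+ n)%:E)%E.
Proof.
move=> r0; rewrite -(power_measure_box (of_Cn z) r0) /integral_Cn; congr (integral _ _ _).
apply/seteqP; split => t h j; have := h j; rewrite !mxE !tnth_mktuple//.
Qed.

Lemma integral_CnZl D (f : V -> R) (k : R) : 0 <= k -> (forall z, 0 <= f z) ->
  measurable (@Cn_of R n @^-1` D) -> (forall z, D z -> {for z, continuous f}) ->
  (integral_Cn D (fun z => (k * f z)%:E) = k%:E * integral_Cn D (fun z => (f z)%:E))%E.
Proof.
move=> k0 f0 mD cf; rewrite /integral_Cn -ge0_integralZl//.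
- exact: (@measurable_fun_Cn_cont R n D f cf).
- by move=> t _; rewrite lee_fin.
Qed.

Lemma area_weighted (Om D : set V) (f : V -> C) (W : V -> \bar R) z (r r1 k A : R) :
  open Om -> csmooth Om f -> (forall j y, Om y -> dzbar j f y = 0) ->
  0 < r -> r < r1 -> box z r1 `<=` Om -> 0 <= k ->
  (forall y, D y -> 0 <= W y)%E ->
  (forall y, cbox z r y -> D y /\ (k%:E <= W y)%E) ->
  (integral_Cn D (fun y => (sqmod (f y))%:E * W y) <= A%:E)%E ->
  (r ^+ 2 / 4) ^+ n * (k * sqmod (f z)) <= A.
Proof.
move=> oO Cf hf r0 rr1 zO k0 W0 kW IA.
have cO : cbox z r `<=` Om by move=> y /(box_cbox rr1); exact: zO.
have cf y : cbox z r y -> {for y, continuous (fun y => sqmod (f y))}.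
  move=> /cO Oy; apply: contD; apply: contX.
    exact: (@Ck_cont R n Om 0 _ (Cf.1 0%N) _ Oy).
  exact: (@Ck_cont R n Om 0 _ (Cf.2 0%N) _ Oy).
have := Cn_area oO Cf hf r0 rr1 zO => H.
rewrite -lee_fin mulrCA EFinM.
apply: (@le_trans _ _ (k%:E * integral_Cn (cbox z r) (fun y => (sqmod (f y))%:E))%E).
  by rewrite lee_wpmul2l.
rewrite -integral_CnZl//; [|by move=> y; exact: sqmod_ge0|exact: measurable_cbox].
apply: le_trans IA; apply: integral_Cn_mono.
- by move=> y _; rewrite lee_fin mulr_ge0// sqmod_ge0.
- by move=> y Dy; rewrite mule_ge0 ?W0// lee_fin sqmod_ge0.
- move=> y /kW[Dy ky]; right; split => //.
  by rewrite mulrC EFinM lee_wpmul2l// lee_fin sqmod_ge0.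
Qed.

Lemma weight_ge m phi (psi : V -> R) z (S : R) : (phi z <= S%:E)%E ->
  ((expR (- (m%:R * S + psi z)))%:E <= weight m phi psi z)%E.
Proof.
move=> h; rewrite /weight (_ : (expR _)%:E = expeR (- (m%:R * S + psi z))%:E)//.
rewrite lee_expeR EFinN leeN2 EFinD leeD2r// EFinM lee_wpmul2l//.
Qed.

Lemma weight_le m phi (psi : V -> R) z (S : R) : (S%:E <= phi z)%E ->
  (weight m phi psi z <= (expR (- (m%:R * S + psi z)))%:E)%E.
Proof.
move=> h; rewrite /weight (_ : (expR _)%:E = expeR (- (m%:R * S + psi z))%:E)//.
rewrite lee_expeR EFinN leeN2 EFinD leeD2r// EFinM lee_wpmul2l//.
Qed.

Lemma weight_ge0 m phi (psi : V -> R) z : (0 <= weight m phi psi z)%E.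
Proof. exact: expeR_ge0. Qed.

End Cn_integral.

Section extension.
Context {R : realType} {n : nat}.
Local Notation C := R[i].
Local Notation Re := (@complex.Re R).
Local Notation Im := (@complex.Im R).
Local Notation V := 'rV[R[i]]_n.
Implicit Types (z w : V) (D : set V).
Local Notation N := n.+1.

Lemma expR_Nln (x : R) k : 0 < x -> expR (- (k%:R * ln x)) = x ^- k.
Proof. by move=> x0; rewrite expRN expRM_natl lnK. Qed.

Lemma Ck_sub k (Om D : set V) f : D `<=` Om -> Ck k Om f -> Ck k D f.
Proof.
move=> DO; elim: k f => [|k ih] f [cf hf]; split => //; try by move=> z /DO; exact: cf.
by move=> v /hf[df Cf]; split; [move=> z /DO; exact: df|exact: ih].
Qed.

Lemma csmooth_sub (Om D : set V) f : D `<=` Om -> csmooth Om f -> csmooth D f.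
Proof. by move=> DO [h1 h2]; split => k; [exact: Ck_sub DO (h1 k)|exact: Ck_sub DO (h2 k)]. Qed.

Lemma sqdist_cbox_le w z (r : R) : cbox w r z -> sqdist w z <= n%:R * (2 * r ^+ 2).
Proof.
move=> h; rewrite /sqdist (_ : n%:R * _ = \sum_(j < n) (2 * r ^+ 2)); last first.
  by rewrite sumr_const card_ord mulr_natl.
apply: ler_sum => j _; have [h1 h2] := h j; rewrite /sqmod /zeta CReB CImB.
rewrite -[(Re _ - _) ^+ 2]real_normK ?num_real// -[(Im _ - _) ^+ 2]real_normK ?num_real//.
have r0 : 0 <= r by exact: le_trans h1.
by rewrite mulr_natl mulr2n lerD// lerXn2r// nnegrE.
Qed.

Lemma integral_CnD D (f g : V -> R) : (forall z, 0 <= f z) -> (forall z, 0 <= g z) ->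
  measurable (@Cn_of R n @^-1` D) -> (forall z, D z -> {for z, continuous f}) ->
  (forall z, D z -> {for z, continuous g}) ->
  (integral_Cn D (fun z => (f z + g z)%:E) =
   integral_Cn D (fun z => (f z)%:E) + integral_Cn D (fun z => (g z)%:E))%E.
Proof.
move=> f0 g0 mD cf cg; rewrite /integral_Cn -ge0_integralD//.
- by move=> t _; rewrite lee_fin.
- exact: (@measurable_fun_Cn_cont R n D f cf).
- by move=> t _; rewrite lee_fin.
- exact: (@measurable_fun_Cn_cont R n D g cg).
Qed.

Variables (Om : set V) (phi : V -> \bar R) (w : V) (fw M : R).
Hypotheses (oOm : open Om) (hh : twisted_hormander Om phi).
Hypotheses (M0 : 0 < M) (hM : forall s : R, `|theta1 s| <= M).

Section step.
Variables (m : nat) (e d c : R).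
Hypotheses (m0 : (0 < m)%N) (e0 : 0 < e) (e1 : e <= 1) (d0 : 0 < d) (de : 16 * d <= e ^+ 2).
Hypothesis phi_e : forall z, cbox w e z ->
  Om z /\ ((fw - c)%:E <= phi z <= (fw + c)%:E)%E.

Let psid := psi w N d.
Let W := weight m phi psid.
Let e2 : 0 < e ^+ 2. Proof. by rewrite exprn_gt0. Qed.

(** Origin of the factors: |alpha|^2 <= (M / e^2)^2 e^2; psi >= N ln (e^2 / 4) on the shell; phi >=
    fw - c there; and the volume of the box of half-side e. Nothing depends on d, which can thus be
    chosen small afterwards. *)
Definition step_bound : R :=
  M ^+ 2 / e ^+ 2 * (4 / e ^+ 2) ^+ N * expR (m%:R * c) * expR (- (m%:R * fw)) *
  ((2 * e) ^+ 2) ^+ n.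

Lemma hormander_solution : exists u : V -> C,
  [/\ csmooth Om u, forall j z, Om z -> dzbar j u z = alpha w e j z &
      (integral_Cn Om (fun z => (sqmod (u z))%:E * W z) <= step_bound%:E)%E].
Proof.
have eO : cbox w e `<=` Om by move=> z /phi_e[].
pose B := M ^+ 2 / e ^+ 2 * (4 / e ^+ 2) ^+ N * expR (m%:R * c) * expR (- (m%:R * fw)).
have B0 : 0 <= B.
  rewrite /B mulr_ge0 ?expR_ge0// mulr_ge0 ?expR_ge0// mulr_ge0//.
    by rewrite divr_ge0 ?sqr_ge0 ?(ltW e2).
  by rewrite exprn_ge0// divr_ge0 ?(ltW e2).
have Iub : (integral_Cn Om (fun z => (form_sqnorm psid (alpha w e) z)%:E * W z) <= step_bound%:E)%E.
  have -> : step_bound%:E = (B%:E * integral_Cn (cbox w e) (fun=> 1%:E))%E.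
    by rewrite integral_cbox ?(ltW e0)// -EFinM.
  have -> : (B%:E * integral_Cn (cbox w e) (fun=> 1%:E) = integral_Cn (cbox w e) (fun=> (B * 1)%:E))%E.
    rewrite (@integral_CnZl _ _ _ (fun=> 1))//; [exact: measurable_cbox|].
    by move=> z _; exact: cont_cst.
  apply: integral_Cn_mono.
  - move=> z _; have /andP[h _] := @form_sqnorm_radial R n w N d d0 (fun y => chi_der e (sqdist w y)) z.
    by rewrite mule_ge0 ?weight_ge0// lee_fin.
  - by move=> z _; rewrite mulr1 lee_fin.
  move=> z Oz; have /andP[f0 f1] := @form_sqnorm_radial R n w N d d0 (fun y => chi_der e (sqdist w y)) z.
  have [h|h] := leP (sqdist w z) (e ^+ 2 / 4).
    left; move: f0 f1; rewrite (chi_der0 e0 (or_introl h)) expr0n/= mul0r => f0 f1.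
    by rewrite (_ : form_sqnorm _ _ _ = 0) ?mul0e//; apply: le_anti; rewrite f0 f1.
  have [h'|h'] := leP (e ^+ 2) (sqdist w z).
    left; move: f0 f1; rewrite (chi_der0 e0 (or_intror h')) expr0n/= mul0r => f0 f1.
    by rewrite (_ : form_sqnorm _ _ _ = 0) ?mul0e//; apply: le_anti; rewrite f0 f1.
  right; have wz : cbox w e z by apply: sqdist_cbox => //; exact: ltW.
  split => //; have [_ /andP[p1 p2]] := phi_e wz.
  have Wle := weight_le m psid p1.
  have fle : form_sqnorm psid (alpha w e) z <= M ^+ 2 / e ^+ 2.
    apply: le_trans f1 _.
    apply: (@le_trans _ _ ((M / e ^+ 2) ^+ 2 * e ^+ 2)).
      apply: ler_pM; rewrite ?sqr_ge0 ?sqdist_ge0 ?(ltW h')//.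
      rewrite -[chi_der _ _ ^+ 2]real_normK ?num_real// lerXn2r ?nnegrE ?divr_ge0 ?(ltW M0) ?(ltW e2)//.
      rewrite /chi_der normrM [X in _ * X]gtr0_norm ?invr_gt0// ler_wpM2r ?invr_ge0 ?(ltW e2)//.
    by rewrite le_eqVlt; apply/orP; left; apply/eqP; field; rewrite gt_eqF.
  (* The hole in the support pays here: |z - w|^2 > e^2 / 4 bounds psi below independently of d. *)
  have psige : N%:R * ln (e ^+ 2 / 4) <= psid z.
    rewrite /psid /psi /psi_fun; apply: ler_wpDl; first exact: sqdist_ge0.
    have h4 : 0 < e ^+ 2 / 4 by rewrite divr_gt0.
    rewrite ler_wpM2l// ler_ln ?posrE//.
      by apply: ltW; apply: lt_le_trans h _; rewrite lerDl ltW.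
    by apply: lt_trans h4 _; apply: lt_le_trans h _; rewrite lerDl ltW.
  apply: (@le_trans _ _ ((M ^+ 2 / e ^+ 2)%:E * (expR (- (m%:R * (fw - c) + psid z)))%:E)%E).
    by apply: lee_pmul; rewrite ?lee_fin ?weight_ge0.
  rewrite -EFinM lee_fin mulr1 /B -!mulrA.
  rewrite ler_wpM2l ?(ltW M0)// ler_wpM2l ?(ltW M0)// ler_wpM2l ?invr_ge0 ?(ltW e2)//.
  have -> : (4 / e ^+ 2) ^+ N = expR (- (N%:R * ln (e ^+ 2 / 4))).
    by rewrite expR_Nln ?divr_gt0// -[RHS]exprVn invf_div.
  by rewrite -!expRD ler_expR; lra.
have [u [Cu du Iu]] : exists u : V -> C,
    [/\ csmooth Om u, forall j z, Om z -> dzbar j u z = alpha w e j z &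
      (integral_Cn Om (fun z => (sqmod (u z))%:E * W z) <=
       integral_Cn Om (fun z => (form_sqnorm psid (alpha w e) z)%:E * W z))%E].
  apply: hh.
  - exact: m0.
  - exact: psi_smooth.
  - exact: psi_strictly_psh.
  - exact: alpha_smooth.
  - exact: alpha_closed.
  - exact: alpha_compact.
  - by apply: le_lt_trans Iub _; rewrite ltry.
exists u; split => //; exact: le_trans Iub.
Qed.

(** [alpha] vanishes for |z - w| < e / 2, so [u] is holomorphic there and the area inequality
    applies around w, on a box where |z - w|^2 <= d and hence psi <= d + N ln (2 d). *)
Lemma solution_at_center u :
  csmooth Om u -> (forall j z, Om z -> dzbar j u z = alpha w e j z) ->
  (integral_Cn Om (fun z => (sqmod (u z))%:E * W z) <= step_bound%:E)%E ->
  (d / (4 * (2 * n%:R + 1))) ^+ n *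
    (expR (- (m%:R * (fw + c) + (d + N%:R * ln (2 * d)))) * sqmod (u w)) <= step_bound.
Proof.
move=> Cu du Iu.
(* On the box of half-side rho one has |z - w|^2 <= 2 n rho^2 <= q rho^2 = d. On the box of
   half-side 2 rho it is at most 8 n rho^2, which is less than 4 d <= e^2 / 4 by [de]. The 1 in q
   keeps the division legitimate when n = 0. *)
pose q : R := 2 * n%:R + 1; have q0 : 0 < q by rewrite ltr_wpDl// mulr_ge0.
pose rho := Num.sqrt (d / q).
have dq0 : 0 < d / q by rewrite divr_gt0.
have rho0 : 0 < rho by rewrite sqrtr_gt0.
have rho2 : rho ^+ 2 = d / q by rewrite sqr_sqrtr// ltW.
have dE : d = q * rho ^+ 2 by rewrite rho2 mulrC divfK// gt_eqF.
pose D := Om `&` [set z | sqdist w z < e ^+ 2 / 4].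
have oD : open D.
  apply: openI => //; apply: (@open_comp _ _ (sqdist w) [set x | x < e ^+ 2 / 4]).
    by move=> z _; exact: (sm_cont (sm_sqdist w)).
  exact: open_lt.
have DO : D `<=` Om by move=> z [].
have boxD : box w (2 * rho) `<=` D.
  move=> z wz; have h : cbox w (2 * rho) z by move=> j; have [h1 h2] := wz j; rewrite !ltW.
  have := sqdist_cbox_le h => h1.
  have h2 : sqdist w z < e ^+ 2 / 4.
    have r2 : 0 < rho ^+ 2 by rewrite exprn_gt0.
    move: de; rewrite dE /q => de'; apply: le_lt_trans h1 _; rewrite exprMn; nra.
  have e2' := e2.
  split => //; have [] // := @phi_e z; apply: sqdist_cbox => //.
  by apply: ltW; apply: lt_trans h2 _; lra.
have du0 j z : D z -> dzbar j u z = 0.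
  by move=> [Oz h]; rewrite du// /alpha chi_der0 ?mul0r//; left; exact: ltW.
have rr : rho < 2 * rho by lra.
have := @area_weighted R n D Om u W w rho (2 * rho)
  (expR (- (m%:R * (fw + c) + (d + N%:R * ln (2 * d))))) step_bound
  oD (csmooth_sub DO Cu) du0 rho0 rr boxD (expR_ge0 _) _ _ Iu.
rewrite rho2 (_ : d / q / 4 = d / (4 * q)); last by field; rewrite gt_eqF.
apply; first by move=> y _; exact: weight_ge0.
move=> y wy; have [Oy hy] := boxD _ (box_cbox rr wy); split => //.
have yd : sqdist w y <= d.
  have := sqdist_cbox_le wy => h; apply: le_trans h _; rewrite dE /q.
  have r2 : 0 < rho ^+ 2 by rewrite exprn_gt0.
  nra.
have e2' := e2.
have ye : cbox w e y by apply: sqdist_cbox => //; apply: ltW; apply: lt_trans hy _; lra.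
have [_ /andP[_ p2]] := phi_e ye.
apply: le_trans (weight_ge m psid p2); rewrite lee_fin ler_expR lerN2 lerD2l.
have y0 := sqdist_ge0 w y; have d0' := d0.
rewrite /psid /psi /psi_fun; apply: lerD => //; apply: ler_wpM2l => //.
by rewrite ler_ln ?posrE; lra.
Qed.

(** The area inequality for chi - u around an arbitrary point, with |chi - u|^2 <= 2 chi^2 + 2
    |u|^2. The u part is bounded by the Hormander estimate. In the chi part the weight is at most
    e^(m c) e^(- m fw) d^-N on the support of chi, and the box has volume at most 4^n. *)
Lemma extension_value u z (r r1 S T : R) :
  csmooth Om u -> (forall j z, Om z -> dzbar j u z = alpha w e j z) ->
  (integral_Cn Om (fun z => (sqmod (u z))%:E * W z) <= step_bound%:E)%E ->
  0 < r -> r <= 1 -> r < r1 -> box z r1 `<=` Om ->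
  (forall y, cbox z r y -> sqdist w y <= T /\ (phi y <= S%:E)%E) ->
  (r ^+ 2 / 4) ^+ n * (expR (- (m%:R * S + N.+1%:R * T)) * sqmod ((chi w e z)%:C%C - u z)) <=
  2 * (expR (m%:R * c) * expR (- (m%:R * fw)) * d ^- N) * 4 ^+ n + 2 * step_bound.
Proof.
move=> Cu du Iu r0 rle1 rr1 zO hy.
have d1 : d <= 1 by move: e1 de e0; nra.
pose f y := (chi w e y)%:C%C - u y.
have Cchi : csmooth Om (fun y => (chi w e y)%:C%C).
  by split; [apply: sm_smooth; exact: sm_chi|apply: sm_smooth; exact: sm_cst].
have Cf : csmooth Om f by exact: csmoothB.
have hf j y : Om y -> dzbar j f y = 0.
  by move=> Oy; rewrite (@dzbarB _ _ Om)// dbar_chi du// subrr.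
have cO : cbox z r `<=` Om by move=> y /(box_cbox rr1); exact: zO.
pose k := expR (- (m%:R * S + N.+1%:R * T)).
have k0 : 0 <= k by exact: expR_ge0.
have kW y : cbox z r y -> (k%:E <= W y)%E.
  move=> zy; have [yT yS] := hy y zy.
  apply: le_trans (weight_ge m psid yS); rewrite lee_fin ler_expR lerN2 lerD2l.
  (* Since d <= 1, psi <= T + N ln (1 + T) <= (N + 1) T on the box. *)
  rewrite /psid /psi /psi_fun -[N.+1]addn1 natrD mulrDl mul1r addrC lerD//.
  rewrite ler_wpM2l//; apply: (@le_trans _ _ (ln (1 + T))).
    have h0 := sqdist_ge0 w y; have d0' := d0.
    by rewrite ler_ln ?posrE; lra.
  by apply: le_ln1Dx; have := sqdist_ge0 w y; lra.
pose E1 := expR (m%:R * c) * expR (- (m%:R * fw)) * d ^- N.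
have E10 : 0 <= E1 by rewrite /E1 !mulr_ge0 ?expR_ge0// invr_ge0 exprn_ge0// ltW.
have kchi y : cbox z r y -> k * chi w e y ^+ 2 <= E1.
  move=> zy; have /andP[t0 t1] := theta01 (sqdist w y / e ^+ 2).
  have [h|h] := leP (e ^+ 2) (sqdist w y).
    rewrite /chi; have [|-> _] := @theta_large R (sqdist w y / e ^+ 2).
      by rewrite ler_pdivlMr// mul1r.
    by rewrite expr0n/= mulr0.
  have wy : cbox w e y by apply: sqdist_cbox => //; exact: ltW.
  have [_ /andP[p1 _]] := phi_e wy.
  have := le_trans (kW _ zy) (weight_le m psid p1); rewrite lee_fin => kle.
  apply: (@le_trans _ _ (k * 1)); first by rewrite ler_wpM2l// expr_le1.
  rewrite mulr1; apply: le_trans kle _; rewrite /E1 -expR_Nln// -!expRD ler_expR.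
  have : N%:R * ln d <= psid y.
    rewrite /psid /psi /psi_fun; apply: ler_wpDl; first exact: sqdist_ge0.
    rewrite ler_wpM2l// ler_ln ?posrE//; first by rewrite lerDr sqdist_ge0.
    by rewrite ltr_wpDl// sqdist_ge0.
  lra.
have cu y : cbox z r y -> {for y, continuous (fun y => sqmod (u y))}.
  move=> /cO Oy; apply: contD; apply: contX.
    exact: (@Ck_cont R n Om 0 _ (Cu.1 0%N) _ Oy).
  exact: (@Ck_cont R n Om 0 _ (Cu.2 0%N) _ Oy).
have cf y : cbox z r y -> {for y, continuous (fun y => sqmod (f y))}.
  move=> /cO Oy; apply: contD; apply: contX.
    exact: (@Ck_cont R n Om 0 _ (Cf.1 0%N) _ Oy).
  exact: (@Ck_cont R n Om 0 _ (Cf.2 0%N) _ Oy).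
have mz := measurable_cbox z r.
have A1 := Cn_area oOm Cf hf r0 rr1 zO.
rewrite -/k -/f -/E1 mulrCA -lee_fin EFinM; clearbody E1.
apply: (@le_trans _ _ (k%:E * integral_Cn (cbox z r) (fun y => (sqmod (f y))%:E))%E).
  by rewrite lee_wpmul2l.
rewrite -integral_CnZl//; last by move=> y; exact: sqmod_ge0.
apply: (@le_trans _ _ (integral_Cn (cbox z r) (fun y => (2 * E1 * 1 + 2 * (k * sqmod (u y)))%:E))%E).
  apply: integral_Cn_mono.
  - by move=> y _; rewrite lee_fin mulr_ge0// sqmod_ge0.
  - move=> y _; rewrite lee_fin mulr1.
    have h : 0 <= k * sqmod (u y) by rewrite mulr_ge0// sqmod_ge0.
    by apply: addr_ge0; apply: mulr_ge0.
  move=> y zy; right; split => //; rewrite lee_fin.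
  have h := kchi y zy.
  apply: (@le_trans _ _ (2 * (k * chi w e y ^+ 2) + 2 * (k * sqmod (u y)))); last by lra.
  rewrite -mulrDr -mulrDr mulrCA ler_wpM2l// /f /sqmod CReB CImB /=.
  have := sqr_ge0 (chi w e y + Re (u y)); have := sqr_ge0 (Im (u y)); nra.
rewrite (@integral_CnD _ (fun=> 2 * E1 * 1) (fun y => 2 * (k * sqmod (u y))))//; last 4 first.
- by move=> y; rewrite mulr1 mulr_ge0.
- by move=> y; rewrite !mulr_ge0// sqmod_ge0.
- by move=> y _; exact: cont_cst.
- by move=> y zy; apply: contM; [exact: cont_cst|apply: contM; [exact: cont_cst|exact: cu]].
rewrite EFinD leeD//.
  rewrite (@integral_CnZl _ _ _ (fun=> 1))// ?mulr_ge0//; last by move=> y _; exact: cont_cst.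
  rewrite integral_cbox ?(ltW r0)// -EFinM lee_fin ler_wpM2l ?mulr_ge0//.
  rewrite lerXn2r ?nnegrE ?sqr_ge0//; nra.
rewrite (@integral_CnZl _ _ _ (fun y => k * sqmod (u y)))//; last 2 first.
- by move=> y; rewrite mulr_ge0// sqmod_ge0.
- by move=> y zy; apply: contM; [exact: cont_cst|exact: cu].
rewrite EFinM lee_wpmul2l//; apply: le_trans Iu; apply: integral_Cn_mono.
- by move=> y _; rewrite lee_fin mulr_ge0// sqmod_ge0.
- by move=> y _; rewrite mule_ge0 ?weight_ge0// lee_fin sqmod_ge0.
move=> y zy; right; split; first exact: cO.
by rewrite mulrC EFinM lee_wpmul2l// ?kW// lee_fin sqmod_ge0.
Qed.

(** Because N = n + 1, the powers of e combine to e^-4 in every dimension: e^-2 from [alpha],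
    e^(-2n-2) from the weight, e^(2n) from the volume. *)
Lemma step_boundE : step_bound =
  M ^+ 2 * 4 ^+ N * 4 ^+ n * expR (m%:R * c) * e ^- 4 / expR (m%:R * fw).
Proof.
rewrite /step_bound expRN.
have -> : (4 / e ^+ 2) ^+ N = 4 ^+ N / (e ^+ 2 * (e ^+ 2) ^+ n) by rewrite expr_div_n -exprS.
have -> : ((2 * e) ^+ 2) ^+ n = 4 ^+ n * (e ^+ 2) ^+ n.
  by rewrite -exprMn; congr (_ ^+ _); ring.
have : (e ^+ 2) ^+ n != 0 by rewrite !expf_neq0 ?gt_eqF.
move: ((e ^+ 2) ^+ n) (expR_gt0 (m%:R * fw)) (expR (m%:R * c)) (4 ^+ N) (4 ^+ n) => E.
move: (expR (m%:R * fw)) => X X0 Y Z T E0; field.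
by rewrite E0 !gt_eqF.
Qed.

Definition center_const : R := M ^+ 2 * 4 ^+ N * 4 ^+ n * expR (m%:R * c) *
  ((4 * (2 * n%:R + 1)) ^+ n * expR (m%:R * c) * expR 1 * 2 ^+ N).

(** The area inequality costs d^-n and the weight at w gains d^N; as N = n + 1, one factor d
    survives, and it can be chosen to beat e^-4. *)
Lemma solution_center_small u :
  csmooth Om u -> (forall j z, Om z -> dzbar j u z = alpha w e j z) ->
  (integral_Cn Om (fun z => (sqmod (u z))%:E * W z) <= step_bound%:E)%E ->
  sqmod (u w) <= d * e ^- 4 * center_const.
Proof.
move=> Cu du Iu; have := solution_at_center Cu du Iu.
have d1 : d <= 1 by move: e1 de e0; nra.
have q0 : 0 < 4 * (2 * n%:R + 1) :> R by rewrite mulr_gt0// ltr_wpDl// mulr_ge0.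
rewrite step_boundE /center_const expr_div_n.
rewrite (_ : expR (- _) = (expR (m%:R * fw) * expR (m%:R * c) * expR d * (2 ^+ N * (d * d ^+ n)))^-1); last first.
  rewrite expRN; congr (_^-1); rewrite mulrDr !expRD (expRM_natl N) lnK ?posrE ?mulr_gt0//.
  by rewrite exprMn [d ^+ N]exprS -!mulrA.
have k0 : 0 <= M ^+ 2 * 4 ^+ N * 4 ^+ n * expR (m%:R * c).
  by rewrite !mulr_ge0 ?expR_ge0 ?exprn_ge0 ?(ltW M0).
move: k0; move: (M ^+ 2 * 4 ^+ N * 4 ^+ n * expR (m%:R * c)) => k k0.
have := exprn_gt0 n q0; have := exprn_gt0 n d0; have := exprn_gt0 N (ltr0n R 2).
have := expR_gt0 (m%:R * fw); have := expR_gt0 (m%:R * c); have := expR_gt0 d.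
have : expR d <= expR 1 by rewrite ler_expR.
move: (expR d) (expR 1) (expR (m%:R * c)) (expR (m%:R * fw)) => a b X Y ab a0 X0 Y0.
move: (2 ^+ N) (d ^+ n) ((4 * (2 * n%:R + 1)) ^+ n) (sqmod (u w)) => t D q s t0 D0 qp h.
have dp := d0; have ep := e0.
have P0 : 0 <= q * Y * X * a * t * d by rewrite !mulr_ge0// ltW.
have -> : s = D / q * ((Y * X * a * (t * (d * D)))^-1 * s) * (q * Y * X * a * t * d).
  by field; rewrite !gt_eqF.
apply: le_trans (ler_wpM2r P0 h) _.
have -> : k * e ^- 4 / Y * (q * Y * X * a * t * d) = d * e ^- 4 * (k * (q * X * t)) * a.
  by field; rewrite !gt_eqF.
have -> : d * e ^- 4 * (k * (q * X * b * t)) = d * e ^- 4 * (k * (q * X * t)) * b by ring.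
apply: ler_wpM2l => //; apply: mulr_ge0; first by rewrite mulr_ge0 ?ltW// invr_gt0 exprn_gt0.
by rewrite mulr_ge0// !mulr_ge0// ltW.
Qed.

End step.

(** The functions f_m with constants independent of m. Since the oscillation allowed at scale r0 /
    m^K is C0 / m, the factor e^(m c) is e^C0 for every m, and m is otherwise felt only through
    powers of e. *)
Lemma extension (r0 C0 : R) (K : nat) : 0 < r0 -> r0 <= 1 ->
  (forall m, (0 < m)%N -> forall z, cbox w (r0 / m%:R ^+ K) z ->
    Om z /\ ((fw - C0 / m%:R)%:E <= phi z <= (fw + C0 / m%:R)%:E)%E) ->
  exists (A : R) (p : nat), 0 < A /\ forall m, (0 < m)%N -> exists f : V -> C,
    [/\ csmooth Om f, forall j z, Om z -> dzbar j f z = 0, 4^-1 <= sqmod (f w) &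
      forall z (r r1 S T : R), 0 < r -> r <= 1 -> r < r1 -> box z r1 `<=` Om ->
        (forall y, cbox z r y -> sqdist w y <= T /\ (phi y <= S%:E)%E) ->
        (r ^+ 2 / 4) ^+ n * sqmod (f z) <=
        A * m%:R ^+ p * expR (m%:R * (S - fw) + N.+1%:R * T)].
Proof.
move=> r00 r01 hphi.
pose k : R := M ^+ 2 * 4 ^+ N * 4 ^+ n * expR C0.
pose G : R := k * ((4 * (2 * n%:R + 1)) ^+ n * expR C0 * expR 1 * 2 ^+ N).
have k0 : 0 < k.
  by rewrite mulr_gt0 ?expR_gt0// mulr_gt0 ?exprn_gt0// mulr_gt0 ?exprn_gt0.
have G0 : 0 < G.
  by rewrite mulr_gt0// mulr_gt0 ?exprn_gt0// mulr_gt0 ?expR_gt0// mulr_gt0 ?expR_gt0.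
have G16 : 0 < 4 * G + 16 by rewrite addr_gt0// mulr_gt0.
pose A0 : R := 2 * expR C0 * 4 ^+ n * (4 * G + 16) ^+ N + 2 * k.
have A00 : 0 < A0.
  by rewrite addr_gt0 ?mulr_gt0// ?exprn_gt0 ?mulr_gt0 ?expR_gt0 ?exprn_gt0.
(* The worst factor is d^-N with d proportional to e^4 and e = r0 / m^K, hence the power m^(4 K
   N). *)
exists (A0 / (r0 ^+ 4) ^+ N), (K * 4 * N)%N; split; first by rewrite divr_gt0// !exprn_gt0.
move=> m m0; have mp : 0 < m%:R :> R by rewrite ltr0n.
have mK : 1 <= m%:R ^+ K :> R by rewrite exprn_ege1// ler1n.
have mK0 : 0 < m%:R ^+ K :> R by rewrite exprn_gt0.
(* In d the term 4 G yields |u w|^2 <= G / (4 G + 16) <= 1/4, and the term 16 yields 16 d <= e^4 <=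
   e^2. *)
pose e := r0 / m%:R ^+ K; pose c := C0 / m%:R; pose d := e ^+ 4 / (4 * G + 16).
have e0 : 0 < e by rewrite divr_gt0.
have e1 : e <= 1 by rewrite ler_pdivrMr// mul1r (le_trans r01).
have d0 : 0 < d by rewrite divr_gt0// exprn_gt0.
have mc : m%:R * c = C0 by rewrite /c mulrC divfK// gt_eqF.
have e4 : e ^+ 4 <= e ^+ 2.
  by rewrite -[4%N]/(2 + 2)%N exprD -[leRHS]mulr1 ler_wpM2l ?sqr_ge0// exprn_ile1// ltW.
have de : 16 * d <= e ^+ 2.
  apply: le_trans e4; rewrite /d mulrA ler_pdivrMr// mulrC ler_wpM2l ?exprn_ge0 ?(ltW e0)//.
  by rewrite lerDr mulr_ge0// ltW.
have he : forall z, cbox w e z -> Om z /\ ((fw - c)%:E <= phi z <= (fw + c)%:E)%E.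
  exact: hphi.
have [u [Cu du Iu]] := hormander_solution m0 e0 d0 he.
pose f y := (chi w e y)%:C%C - u y.
have Cchi : csmooth Om (fun y => (chi w e y)%:C%C).
  by split; [apply: sm_smooth; exact: sm_chi|apply: sm_smooth; exact: sm_cst].
have Cf : csmooth Om f by exact: csmoothB.
have small : sqmod (u w) <= 4^-1.
  apply: le_trans (@solution_center_small m e d c e0 e1 d0 de he u Cu du Iu) _.
  rewrite /center_const mc -/k -/G /d.
  rewrite (_ : _ * G = G / (4 * G + 16)); last by field; rewrite !gt_eqF.
  by rewrite ler_pdivrMr//; lra.
exists f; split => //.
- by move=> j y Oy; rewrite (@dzbarB _ _ Om)// dbar_chi du// subrr.
- have -> : f w = 1 - u w.
    rewrite /f /chi (_ : sqdist w w = 0) ?mul0r; last first.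
      by rewrite /sqdist big1// => j _; rewrite /zeta subrr /sqmod/= expr0n addr0.
    by have [|-> _] := @theta_small R 0; first by rewrite invr_ge0.
  move: small; rewrite /sqmod CReB CImB /= => small.
  have := sqr_ge0 (Im (u w)); have := sqr_ge0 (2 * Re (u w) - 1); nra.
move=> z r r1 S T rp rle1 rr1 zO hy.
have := extension_value e0 e1 d0 de he Cu du Iu rp rle1 rr1 zO hy.
rewrite -/(f z) step_boundE// mc [expR (- (m%:R * fw))]expRN -/k.
set X := expR (m%:R * fw); set Y := expR (- _).
have X0 : 0 < X by exact: expR_gt0.
have Y0 : 0 < Y by exact: expR_gt0.
have -> : expR (m%:R * (S - fw) + N.+1%:R * T) = X^-1 * Y^-1.
  by rewrite /X /Y -!expRN opprK -expRD; congr expR; ring.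
have E4 : (e ^+ 4) ^+ N <= e ^+ 4.
  by rewrite -[leRHS]expr1 ler_wiXn2l// ?exprn_ge0 ?exprn_ile1 ?(ltW e0).
have -> : (r0 ^+ 4) ^+ N = (e ^+ 4) ^+ N * m%:R ^+ (K * 4 * N).
  rewrite !(exprM (m%:R : R)) -exprMn -exprMn; congr (_ ^+ _ ^+ _).
  by rewrite /e divfK// gt_eqF.
have EN0 : 0 < (e ^+ 4) ^+ N by rewrite !exprn_gt0.
have mp0 : 0 < m%:R ^+ (K * 4 * N) :> R by rewrite exprn_gt0.
have E0 : 0 < e ^+ 4 by rewrite exprn_gt0.
have H0 : 0 < (4 * G + 16) ^+ N by rewrite exprn_gt0.
rewrite mulrCA /d [(e ^+ 4 / _) ^+ N]expr_div_n /A0 => h.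
move: X Y X0 Y0 h => X Y X0 Y0 h.
rewrite -ler_pdivlMl// in h; apply: le_trans h _.
move: (e ^+ 4) E4 EN0 E0 mp0 H0 => E.
move: (E ^+ N) => EN E4 EN0 E0.
move: (_ ^+ (K * 4 * N)) ((4 * G + 16) ^+ N) (4 ^+ n) (expR C0) => mq H P C1 mq0 H0.
have hk : k / E <= k / EN by rewrite ler_wpM2l ?(ltW k0)// lef_pV2 ?posrE.
rewrite (_ : _ * (X^-1 * Y^-1) = Y^-1 * (2 * (C1 * X^-1 * (EN / H)^-1) * P + 2 * (k / EN / X))); last first.
  by field; rewrite !gt_eqF.
by rewrite ler_wpM2l ?invr_ge0 ?(ltW Y0)// lerD2l ler_wpM2l// ler_wpM2r// invr_ge0 ltW.
Qed.

End extension.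

(** * Riemann sums and the maximum principle *)

Section holder_local.
Context {R : realType} {n : nat}.
Local Notation V := 'rV[R[i]]_n.
Variables (Om : set V) (phi : V -> \bar R) (w : V) (fw : R).
Hypotheses (oOm : open Om) (hpole : closed_in Om (Pole Om phi))
  (hh : locally_holder (Om `\` Pole Om phi) phi) (Ow : Om w) (phiw : phi w = fw%:E).

Lemma cnorm_cbox z (e : R) : cbox w e z -> 0 <= e -> cnorm (z - w) <= (2 * n%:R + 1) * e.
Proof.
move=> wz e0; rewrite /cnorm (_ : \sum_(j < n) _ = sqdist w z); last first.
  by apply: eq_bigr => j _; rewrite !mxE.
have q0 : 0 <= (2 * n%:R + 1) * e by rewrite mulr_ge0// addr_ge0// mulr_ge0.
rewrite -(ger0_norm q0) -sqrtr_sqr ler_wsqrtr//.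
apply: le_trans (sqdist_cbox_le wz) _; rewrite exprMn mulrA ler_wpM2r ?sqr_ge0//.
have : 0 <= n%:R :> R by [].
nra.
Qed.

(** As the pole set is relatively closed, a closed box around w avoids it, and one Hoelder exponent
    serves on that box; points are compared with w only. *)
Lemma holder_local : exists (r0 C0 : R) (K : nat), [/\ 0 < r0, r0 <= 1 &
  forall m, (0 < m)%N -> forall z, cbox w (r0 / m%:R ^+ K) z ->
    Om z /\ ((fw - C0 / m%:R)%:E <= phi z <= (fw + C0 / m%:R)%:E)%E].
Proof.
have [F cF PF] := hpole.
have oU : open (Om `&` ~` F) by apply: openI => //; exact: closed_openC.
have Uw : (Om `&` ~` F) w.
  split => // Fw; have : Pole Om phi w by rewrite PF.
  by rewrite /Pole/= phiw => -[].
have [e1 e10 he1] := open_box oU Uw.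
pose r0 : R := Num.min 1 (e1 / 2).
have r00 : 0 < r0 by rewrite lt_min ltr01 divr_gt0.
have r01 : r0 <= 1 by rewrite ge_min lexx.
have r0e : r0 < e1.
  have : r0 <= e1 / 2 by rewrite ge_min lexx orbT.
  lra.
have cU : cbox w r0 `<=` Om `&` ~` F by move=> z /(box_cbox r0e); exact: he1.
have rc : relatively_compact (cbox w r0) (Om `\` Pole Om phi).
  have E : closure (cbox w r0) = cbox w r0 by apply/esym/closure_id; exact: closed_cbox.
  rewrite /relatively_compact E; split; first exact: compact_cbox.
  by move=> z /cU[Oz nF]; split => //; rewrite PF => -[].
have [a [C [a0 a1 C0 hC]]] := hh rc.
pose Q : R := 2 * n%:R + 1; have Q0 : 0 <= Q by rewrite addr_ge0// mulr_ge0.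
(* With K a >= 1, a distance of order m^-K raised to the power a is of order 1/m. *)
have [K Ka] : exists K : nat, 1 <= K%:R * a.
  exists (Num.truncn a^-1).+1; rewrite -ler_pdivrMr// mul1r ltW//.
  exact: truncnS_gt.
exists r0, (C * Q `^ a), K; split => // m m0 z wz.
have m1 : 1 <= m%:R :> R by rewrite ler1n.
have mp : 0 < m%:R :> R by rewrite ltr0n.
have mK : 0 < m%:R ^+ K :> R by rewrite exprn_gt0.
have mK1 : 1 <= m%:R ^+ K :> R by rewrite exprn_ege1.
set e := r0 / m%:R ^+ K in wz *.
have e0 : 0 < e by rewrite divr_gt0.
have er : e <= r0 by rewrite ler_pdivrMr// ler_peMr// ltW.
have wz0 : cbox w r0 z by move=> j; have [h1 h2] := wz j; split; exact: le_trans er.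
have ww0 : cbox w r0 w by move=> j; rewrite !subrr !normr0 ltW.
have [Oz _] := cU _ wz0; split => //.
have := hC z w wz0 ww0; rewrite phiw.
have nz : cnorm (z - w) `^ a <= Q `^ a / m%:R.
  have n0 : 0 <= cnorm (z - w) by exact: sqrtr_ge0.
  have nQ : cnorm (z - w) * m%:R ^+ K <= Q.
    rewrite -ler_pdivlMr//; apply: le_trans (cnorm_cbox wz (ltW e0)) _.
    by rewrite -/Q ler_wpM2l// /e -[leRHS]mul1r ler_wpM2r// invr_ge0 ltW.
  rewrite ler_pdivlMr//; apply: (@le_trans _ _ ((cnorm (z - w) * m%:R ^+ K) `^ a)); last first.
    by apply: ge0_ler_powR; rewrite ?nnegrE ?mulr_ge0 ?(ltW a0) ?(ltW mK).
  rewrite powRM ?(ltW mK)// ler_wpM2l ?powR_ge0//.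
  rewrite -powR_mulrn ?(ltW mp)// -powRrM -[leLHS]powRr1 ?(ltW mp)//.
  exact: ler_powR.
case: (phi z) => [x| |] //=.
rewrite !lee_fin => h.
have : `|x - fw| <= C * Q `^ a / m%:R.
  by apply: le_trans h _; rewrite -mulrA ler_wpM2l// ltW.
by rewrite ler_norml => /andP[h1 h2]; apply/andP; split; lra.
Qed.

End holder_local.

(** * Riemann sums of a periodic Lipschitz function *)

Section riemann_sum.
Context {R : realType}.
Local Notation mu := (@lebesgue_measure R).
Variables (h : R -> R) (L : R).
Hypotheses (hL : forall x y, `|h x - h y| <= L * `|x - y|)
  (hper : forall x, h (x + 2 * pi) = h x).

Let L0 : 0 <= L.
Proof. by have := hL 1 0; rewrite subr0 normr1 mulr1; apply: le_trans. Qed.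

Lemma lipschitz_cont (x : R) : {for x, continuous h}.
Proof.
apply/cvgrPdist_le => e e0.
have L1 : 0 < L + 1 by rewrite ltr_wpDl.
have d0 : 0 < (L + 1)^-1 * e by rewrite mulr_gt0 ?invr_gt0.
apply: filterS (nbhsx_ballx x _ d0) => y; rewrite -ball_normE/= => /ltW xy.
apply: le_trans (hL x y) _.
apply: (@le_trans _ _ ((L + 1) * `|x - y|)); first by rewrite ler_wpM2r// lerDl.
by rewrite -ler_pdivlMl.
Qed.

Lemma lipschitz_integrable (a b : R) : mu.-integrable `[a, b] (EFin \o h).
Proof.
apply: continuous_compact_integrable; first exact: segment_compact.
apply: continuous_subspaceT => x; exact: lipschitz_cont.
Qed.

Section step.
Variable N : nat.
Hypothesis N0 : (0 < N)%N.
Let p : R := 2 * pi / N%:R.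
Let p0 : 0 < p. Proof. by rewrite divr_gt0 ?mulr_gt0 ?pi_gt0 ?ltr0n. Qed.
Let pN : N%:R * p = 2 * pi. Proof. by rewrite mulrC divfK// pnatr_eq0 -lt0n. Qed.
Let S (x : R) : R := \sum_(j < N) h (x + j%:R * p).

(** A shift by one step permutes the sample points modulo the period of [h]. *)
Let SD (x : R) : S (x + p) = S x.
Proof.
apply: (@addrI _ (h (x + 0%:R * p))).
have -> : h (x + 0%:R * p) + S (x + p) = \sum_(j < N.+1) h (x + j%:R * p).
  rewrite big_ord_recl; congr (_ + _); apply: eq_bigr => j _; congr h.
  by rewrite /= /bump/= natrD; ring.
by rewrite big_ord_recr/= pN hper mul0r addr0 addrC.
Qed.

Let SDn (k : nat) (x : R) : S (x + k%:R * p) = S x.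
Proof.
elim: k => [|k ih]; first by rewrite mul0r addr0.
by rewrite -[k.+1]addn1 natrD mulrDl mul1r addrA SD.
Qed.

Let SDz (k : int) (x : R) : S (x + k%:~R * p) = S x.
Proof.
case: k => k; first by rewrite -pmulrn; exact: SDn.
rewrite NegzE -(SDn k.+1 (x + _)) mulrNz -pmulrn; congr S; ring.
Qed.

Let S_le (x : R) : S x <= S 0 + N%:R * (L * p).
Proof.
pose k := Num.floor (x / p); pose y := x - k%:~R * p.
have -> : S x = S y by rewrite -(SDz k y) /y subrK.
have /andP[h1 h2] : 0 <= y <= p.
  have k1 : k%:~R <= x / p by exact: floor_le_tmp.
  have k2 : x / p < (k + 1)%:~R by exact: floorD1_gt.
  move: k1 k2; rewrite ler_pdivlMr// ltr_pdivrMr// intrD mulrDl mul1r /y => k1 k2.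
  by apply/andP; split; lra.
have -> : N%:R * (L * p) = \sum_(j < N) (L * p).
  by rewrite sumr_const card_ord mulr_natl.
rewrite /S -big_split/=; apply: ler_sum => j _.
have := hL (y + j%:R * p) (0 + j%:R * p); rewrite ler_norml => /andP[_].
rewrite add0r addrK ger0_norm// => h3.
have : L * y <= L * p by rewrite ler_wpM2l.
lra.
Qed.

Let lower (k : nat) :
  \sum_(j < k) p * (h (j%:R * p) - L * p) <= (\int[mu]_(x in `[0%R, k%:R * p]) h x)%R.
Proof.
elim: k => [|k ih]; first by rewrite big_ord0 mul0r set_itv1 Rintegral_set1.
have kp : k%:R * p <= k.+1%:R * p by rewrite ler_wpM2r ?(ltW p0)// ler_nat.
have kp0 : 0 <= k%:R * p by rewrite mulr_ge0// ltW.
rewrite big_ord_recr/=.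
rewrite -[leRHS](subrK (\int[mu]_(x in `[0%R, k%:R * p]) h x)%R) Rintegral_itvB//; last exact: lipschitz_integrable.
rewrite addrC lerD//.
have -> : p * (h (k%:R * p) - L * p) = (\int[mu]_(x in `]k%:R * p, k.+1%:R * p]%classic) (h (k%:R * p) - L * p))%R.
  rewrite Rintegral_cst//.
  have E : mu `]k%:R * p, k.+1%:R * p]%classic = p%:E.
    rewrite lebesgue_measure_itv/= lte_fin ltr_pM2r// ltr_nat leqnn -EFinB.
    by congr EFin; rewrite -[k.+1]addn1 natrD; ring.
  by rewrite mulrC; congr (_ * _); exact: (esym (congr1 fine E)).
apply: le_Rintegral => //.
- apply: (@integrableS _ _ _ mu `[k%:R * p, k.+1%:R * p]%classic) => //; first by apply: subset_itvr; rewrite bnd_simp.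
  apply: continuous_compact_integrable; first exact: segment_compact.
  by apply: continuous_subspaceT => x; exact: cvg_cst.
- apply: (@integrableS _ _ _ mu `[k%:R * p, k.+1%:R * p]%classic) => //; first by apply: subset_itvr; rewrite bnd_simp.
  exact: lipschitz_integrable.
move=> x/=; rewrite in_itv/= => /andP[x1 x2].
have := hL x (k%:R * p); rewrite ler_norml => /andP[h1 _].
have : `|x - k%:R * p| <= p.
  move: x2; rewrite -[k.+1]addn1 natrD => x2; rewrite ger0_norm; lra.
move/(ler_wpM2l L0); lra.
Qed.

(** The unnormalised error is bounded uniformly in N and in the starting point. Moving the start to
    0 costs N L p = 2 pi L, where p is the step; comparing with the integral costs as much again. *)
Lemma riemann_sum_le (x : R) : \sum_(j < N) h (x + j%:R * p) <=
  N%:R * ((\int[mu]_(x in `[0%R, (2 * pi)%R]) h x)%R / (2 * pi)) + 4 * pi * L.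
Proof.
have pi0 : 0 < 2 * pi :> R by rewrite mulr_gt0 ?pi_gt0.
have Np : 0 < N%:R :> R by rewrite ltr0n.
apply: le_trans (S_le x) _; have := lower N; rewrite pN -mulr_sumr.
set I := (\int[mu]_(x in _) h x)%R; rewrite sumrB sumr_const card_ord => hI.
have -> : S 0 = \sum_(j < N) h (j%:R * p) by apply: eq_bigr => j _; rewrite add0r.
move: hI; set T := \sum_(j < N) _; rewrite -ler_pdivlMl// => hI.
have -> : N%:R * (I / (2 * pi)) = p^-1 * I by rewrite /p invf_div [RHS]mulrAC mulrA.
move: hI; rewrite -[_ *+ N]mulr_natl.
have -> : N%:R * (L * p) = 2 * pi * L by rewrite -pN; ring.
lra.
Qed.

End step.
End riemann_sum.

(** * The maximum principle for products of rotated copies *)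

Section jensen.
Context {R : realType} {n : nat}.
Local Notation V := 'rV[R[i]]_n.
Local Notation mu := (@lebesgue_measure R).
Variables (Om : set V) (w v : V) (r : R).
Hypotheses (oOm : open Om) (r1 : 1 < r) (hr : disc r `<=` cline w v @^-1` Om).

Let circ (th : R) : V := cline w v (cos th, sin th).

Lemma jensen_step (f : V -> R[i]) (N : nat) (b : R -> R) (B : R) : csmooth Om f ->
  (forall j z, Om z -> dzbar j f z = 0) ->
  (forall th, sqmod (f (circ th)) <= b th) ->
  (forall th, \prod_(j < N) b (th + j%:R * (2 * pi / N%:R)) <= B) ->
  sqmod (f w) ^+ N <= B.
Proof.
move=> Cf df fb bB.
pose c (j : 'I_N) : R := j%:R * (2 * pi / N%:R).
(* Rotations are absorbed into the direction, so that all factors are holomorphic on the same disc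
   and agree at its centre. *)
pose vj j : V := Complex (cos (c j)) (sin (c j)) *: v.
have rotE j p : cline w (vj j) p = cline w v (p.1 * cos (c j) - p.2 * sin (c j), p.1 * sin (c j) + p.2 * cos (c j)).
  by rewrite /cline /vj scalerA.
have hj j : exists G', hol (disc r) (fun p => f (cline w (vj j) p)) G'.
  have [G' hG'] := hol_line oOm Cf df w (vj j); exists G' => p dp; apply: hG'.
  rewrite /preimage/= rotE; apply: hr; rewrite /disc/=.
  have := cos2Dsin2 (c j); move: dp; rewrite /disc/=; move: (cos _) (sin _) => x y dp xy.
  have -> : (p.1 * x - p.2 * y) ^+ 2 + (p.1 * y + p.2 * x) ^+ 2 =
    (p.1 ^+ 2 + p.2 ^+ 2) * (x ^+ 2 + y ^+ 2) by ring.
  by rewrite xy mulr1.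
have [G' hG'] := choice hj.
have [H' hH'] := @hol_prod R (disc r) _ (index_enum 'I_N) (fun j p => f (cline w (vj j) p)) G' hG'.
have sqmod_prod (I : Type) (s : seq I) (F : I -> R[i]) :
    sqmod (\prod_(i <- s) F i) = \prod_(i <- s) sqmod (F i).
  elim: s => [|i s ih]; first by rewrite !big_nil /sqmod/= expr1n expr0n addr0.
  by rewrite !big_cons sqmodM ih.
have := @max_principle R r B _ H' r1 hH'; rewrite !sqmod_prod.
have -> : \prod_(j < N) sqmod (f (cline w (vj j) (0, 0))) = sqmod (f w) ^+ N.
  rewrite (eq_bigr (fun=> sqmod (f w))) ?prodr_const ?card_ord// => j _.
  by rewrite rotE /cline/= !mul0r subr0 addr0 scale0r addr0.
apply => th; rewrite sqmod_prod; apply: le_trans (bB th).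
apply: ler_prod => j _; rewrite sqmod_ge0/= rotE/=.
by rewrite -cosD [X in (_, X)]addrC -sinD; exact: fb.
Qed.

(** Uses e^x >= (x / q)^q with q = p + 1, one power above the polynomial. *)
Lemma exp_gt_poly (d C : R) (p : nat) : 0 < d -> exists2 m : nat, (0 < m)%N & C * m%:R ^+ p < expR (m%:R * d).
Proof.
move=> d0; pose q := p.+1; pose e := (d / q%:R) ^+ q.
have e0 : 0 < e by rewrite exprn_gt0// divr_gt0.
exists (Num.truncn (C / e)).+1 => //; set m := _.+1.
have hm : C / e < m%:R by exact: truncnS_gt.
have mp : 0 < m%:R :> R by rewrite ltr0n.
apply: (@lt_le_trans _ _ ((m%:R * e) * m%:R ^+ p)).
  by rewrite ltr_pM2r ?exprn_gt0// -ltr_pdivrMr.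
have -> : m%:R * d = q%:R * (m%:R * d / q%:R) by field; rewrite pnatr_eq0.
rewrite expRM_natl; apply: (@le_trans _ _ ((m%:R * d / q%:R) ^+ q)).
  by rewrite -[m%:R * d / _]mulrA exprMn -/e [m%:R ^+ q]exprS mulrAC.
have h0 : 0 <= m%:R * d / q%:R by rewrite divr_ge0// mulr_ge0// ltW.
rewrite lerXn2r ?nnegrE ?expR_ge0//.
by apply: le_trans (expR_ge1Dx _); rewrite lerDr.
Qed.

(** Suppose fw exceeds the mean of [h] by d > 0. With m rotated copies of f_m the product bound is
    the m-th power of D m^p e^(4 pi L - m d): the Riemann error stays a constant in the exponent.
    Taking the root, 1/4 <= D m^p e^(4 pi L - m d), which fails for large m. *)
Lemma jensen_limit (D fw L : R) (h : R -> R) (p : nat) :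
  (forall x y, `|h x - h y| <= L * `|x - y|) -> (forall x, h (x + 2 * pi) = h x) ->
  (forall m, (0 < m)%N -> exists f : V -> R[i],
    [/\ csmooth Om f, forall j z, Om z -> dzbar j f z = 0, 4^-1 <= sqmod (f w) &
      forall th, sqmod (f (circ th)) <= D * m%:R ^+ p * expR (m%:R * (h th - fw))]) ->
  2 * pi * fw <= (\int[mu]_(x in `[0%R, (2 * pi)%R]) h x)%R.
Proof.
move=> hL hper hf; rewrite leNgt; apply/negP => lt_I.
have pi0 : 0 < 2 * pi :> R by rewrite mulr_gt0 ?pi_gt0.
have R1 := riemann_sum_le hL hper; move: lt_I R1.
set I := (\int[mu]_(x in _) h x)%R => lt_I R1.
pose d := fw - I / (2 * pi).
have d0 : 0 < d by rewrite subr_gt0 ltr_pdivrMr// mulrC.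
have [m m0] := exp_gt_poly (4 * D * expR (4 * pi * L)) p d0.
have [f [Cf df fw4 fb]] := hf m m0.
rewrite ltNge => /negP; apply.
have mp : 0 < m%:R :> R by rewrite ltr0n.
pose B : R := D * m%:R ^+ p * expR (4 * pi * L - m%:R * d).
have D0 : 0 <= D * m%:R ^+ p.
  have := le_trans (sqmod_ge0 _) (fb 0); by rewrite pmulr_lge0 ?expR_gt0.
have B0 : 0 <= B by rewrite mulr_ge0 ?expR_ge0.
have := jensen_step Cf df fb (N := m) (B := B ^+ m).
have hB th : \prod_(j < m) (D * m%:R ^+ p * expR (m%:R * (h (th + j%:R * (2 * pi / m%:R)) - fw))) <= B ^+ m.
  rewrite big_split/= prodr_const card_ord /B [(D * m%:R ^+ p * _) ^+ m]exprMn ler_wpM2l ?exprn_ge0//.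
  rewrite -expR_sum -expRM_natl ler_expR -mulr_sumr ler_wpM2l// sumrB sumr_const card_ord.
  have := R1 m m0 th; rewrite -mulr_natl /d; lra.
move=> /(_ hB) h1.
have : 4^-1 <= B.
  have h4 : (4^-1 : R) ^+ m <= B ^+ m.
    apply: le_trans h1; rewrite lerXn2r ?nnegrE ?sqmod_ge0//.
  by rewrite ler_pXn2r ?nnegrE// in h4.
rewrite /B expRD expRN; move: (expR_gt0 (m%:R * d)); move: (expR (m%:R * d)) (expR _) (m%:R ^+ p) => x y z x0.
rewrite mulrA ler_pdivlMr//; lra.
Qed.

End jensen.

(** * Sup-convolutions along a circle *)

Section coordinate_distance.
Context {R : realType} {n : nat}.
Local Notation Re := (@complex.Re R).
Local Notation Im := (@complex.Im R).
Local Notation V := 'rV[R[i]]_n.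
Implicit Types (x y z v : V).

(** An l1 distance: its triangle inequality holds term by term, and it compares directly with
    boxes. *)
Definition dist1 y z : R :=
  \sum_(j < n) (`|Re (y 0 j) - Re (z 0 j)| + `|Im (y 0 j) - Im (z 0 j)|).

Definition norm1 v : R := \sum_(j < n) (`|Re (v 0 j)| + `|Im (v 0 j)|).

Lemma dist1_ge0 y z : 0 <= dist1 y z.
Proof. by apply: sumr_ge0 => j _; rewrite addr_ge0. Qed.

Lemma norm1_ge0 v : 0 <= norm1 v.
Proof. by apply: sumr_ge0 => j _; rewrite addr_ge0. Qed.

Lemma dist1_trans x y z : dist1 y z <= dist1 y x + dist1 x z.
Proof.
rewrite /dist1 -big_split/=; apply: ler_sum => j _.
rewrite addrACA lerD// ?(le_trans (ler_distD _ _ _))//; exact: ler_distD.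
Qed.

Lemma dist1_coord y z j :
  `|Re (y 0 j) - Re (z 0 j)| <= dist1 y z /\ `|Im (y 0 j) - Im (z 0 j)| <= dist1 y z.
Proof.
rewrite /dist1 (bigD1 j)//=.
have : 0 <= \sum_(i < n | i != j) (`|Re (y 0 i) - Re (z 0 i)| + `|Im (y 0 i) - Im (z 0 i)|).
  by apply: sumr_ge0 => i _; rewrite addr_ge0.
have := normr_ge0 (Re (y 0 j) - Re (z 0 j)); have := normr_ge0 (Im (y 0 j) - Im (z 0 j)).
by move=> *; split; lra.
Qed.

Lemma dist1_box y z (e : R) : dist1 y z < e -> box z e y.
Proof. by move=> h j; have [h1 h2] := dist1_coord y z j; split; exact: le_lt_trans h. Qed.

Lemma dist1_cbox y z (e : R) : dist1 y z <= e -> cbox z e y.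
Proof. by move=> h j; have [h1 h2] := dist1_coord y z j; split; exact: le_trans h. Qed.

Lemma cbox_dist1 y z (e : R) : cbox z e y -> dist1 y z <= 2 * n%:R * e.
Proof.
move=> h; have -> : 2 * n%:R * e = \sum_(j < n) (e + e).
  by rewrite sumr_const card_ord -mulr_natl; ring.
by apply: ler_sum => j _; have [h1 h2] := h j; rewrite lerD.
Qed.

Lemma dist1_cline z v (p q : R * R) (d : R) : `|p.1 - q.1| <= d -> `|p.2 - q.2| <= d ->
  dist1 (cline z v p) (cline z v q) <= 2 * d * norm1 v.
Proof.
move=> h1 h2; rewrite /norm1 mulr_sumr; apply: ler_sum => j _.
rewrite !mxE !CReD !CImD !CReM !CImM /=.
move: (Re (v 0 j)) (Im (v 0 j)) (Re (z 0 j)) (Im (z 0 j)) => a b s t.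
have -> : s + (p.1 * a - p.2 * b) - (s + (q.1 * a - q.2 * b)) =
  (p.1 - q.1) * a + - ((p.2 - q.2) * b) by ring.
have -> : t + (p.1 * b + p.2 * a) - (t + (q.1 * b + q.2 * a)) =
  (p.1 - q.1) * b + (p.2 - q.2) * a by ring.
have := ler_normD ((p.1 - q.1) * a) (- ((p.2 - q.2) * b)).
have := ler_normD ((p.1 - q.1) * b) ((p.2 - q.2) * a).
rewrite normrN !normrM.
have := ler_wpM2r (normr_ge0 a) h1; have := ler_wpM2r (normr_ge0 b) h1.
have := ler_wpM2r (normr_ge0 a) h2; have := ler_wpM2r (normr_ge0 b) h2.
lra.
Qed.

Lemma box_add x y z (e e' : R) : box z e y -> box y e' x -> box z (e + e') x.
Proof.
move=> h h' j; have [a b] := h j; have [c d] := h' j.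
by split; apply: le_lt_trans (ler_distD _ _ _) _; rewrite addrC; apply: ltrD; eassumption.
Qed.

Lemma box_le z (e e' : R) : e <= e' -> box z e `<=` box z e'.
Proof. by move=> ee' y h j; have [a b] := h j; split; exact: lt_le_trans ee'. Qed.

Lemma cos_sin_lipschitz (a b : R) : `|cos a - cos b| <= `|a - b| /\ `|sin a - sin b| <= `|a - b|.
Proof.
have [c _ ->] := @mvt_between R cos (fun s : R => - sin s) b a (fun s _ => is_derive_cos s).
have [d _ ->] := @mvt_between R sin cos b a (fun s _ => is_derive_sin s).
split; rewrite normrM -[leRHS]mul1r ler_wpM2r// ?normrN ler_norml.
  by rewrite sin_geN1 sin_le1.
by rewrite cos_geN1 cos_le1.
Qed.

End coordinate_distance.

Section circle.
Context {R : realType} {n : nat}.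
Local Notation V := 'rV[R[i]]_n.
Local Notation mu := (@lebesgue_measure R).
Variables (Om : set V) (phi : V -> \bar R) (w v : V).
Hypotheses (oOm : open Om) (hphi : forall z, Om z -> (phi z < +oo)%E)
  (husc : upper_semicontinuous_on Om phi)
  (hv : forall t : R[i], `|t| <= 1 -> Om (w + t *: v)).

Let circ (th : R) : V := cline w v (cos th, sin th).

Let unit_disc : set (R * R) := [set p | p.1 ^+ 2 + p.2 ^+ 2 <= 1].

Let compact_unit_disc : compact unit_disc.
Proof.
have cQ : compact (sq (1 : R)) by apply: compact_setX; exact: segment_compact.
apply: (subclosed_compact _ cQ).
- apply: (@closed_comp _ _ (fun p : R * R => p.1 ^+ 2 + p.2 ^+ 2) [set x : R | x <= 1]); last exact: closed_le.
  move=> p _; suff : {for p, continuous (fun p : R * R => p.1 ^+ 2 + p.2 ^+ 2)} by [].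
  by apply: contD; apply: contX; [exact: cont_fst|exact: cont_snd].
- move=> [a b]; rewrite /unit_disc/= => h.
  have := sqr_ge0 a; have := sqr_ge0 b => b0 a0.
  by split; rewrite /= in_itv/=; apply/andP; split; nra.
Qed.

Let Om_cline p : unit_disc p -> Om (cline w v p).
Proof.
move=> h; apply: hv; rewrite normc_def/= -[1]/(1%:C%C) lecR.
by rewrite -sqrtr1 ler_wsqrtr.
Qed.

Lemma local_bound z : Om z -> exists (a e : R),
  0 < e /\ forall y, box z e y -> Om y /\ (phi y < a%:E)%E.
Proof.
move=> Oz; have [a za] : exists a : R, (phi z < a%:E)%E.
  have := hphi Oz; case: (phi z) => [x| |]// _; last by exists 0; rewrite ltNyr.
  by exists (x + 1); rewrite lte_fin ltrDl.
have h1 := husc Oz za; have h2 : nbhs z Om by exact: (oOm Oz).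
have [e e0 he] := (nbhs_boxP _ _).1 (filterI h1 h2).
by exists a, e; split => // y /he[h3 h4]; split => //; exact: h3.
Qed.

(** Compactness of the closed disc. One number serves both as the width of the tube and, inverted,
    as the upper bound of phi, so a single limit rho -> 0 handles both. *)
Lemma tube : exists rho : R, [/\ 0 < rho, rho <= 1 & forall p, unit_disc p ->
  forall y, box (cline w v p) rho y -> Om y /\ (phi y < (rho^-1)%:E)%E].
Proof.
pose P (rho : R) (p : R * R) := forall y, box (cline w v p) rho y -> Om y /\ (phi y < (rho^-1)%:E)%E.
have cov : \forall rho \near 0^'+, unit_disc `<=` P rho.
  move/compact_near_coveringP : compact_unit_disc; apply => p /Om_cline Op.
  have [a [e [e0 he]]] := local_bound Op.
  (* Half of e is spent on moving the centre and half on the box around it; the other bound ensures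
     a <= 1 / rho. *)
  pose c : R := Num.min (e / 2) (`|a| + 1)^-1.
  have a1 : 0 < `|a| + 1 by rewrite ltr_wpDl.
  have c0 : 0 < c by rewrite lt_min divr_gt0//= invr_gt0.
  have nb : nbhs (cline w v p) (box (cline w v p) (e / 2)).
    by apply/nbhs_boxP; exists (e / 2) => //; rewrite divr_gt0.
  exists ([set q | box (cline w v p) (e / 2) (cline w v q)], [set rho | 0 < rho /\ rho < c]).
    split => /=; first exact: (@cline_cont R n w v p _ nb).
    by apply: filterI; [exact: nbhs_right_gt|exact: nbhs_right_lt].
  move=> [q rho] [/= hq [r0 rc]] y hy.
  have re : rho < e / 2 by apply: lt_le_trans rc _; rewrite ge_min lexx.
  have ra : rho < (`|a| + 1)^-1 by apply: lt_le_trans rc _; rewrite ge_min lexx orbT.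
  have [|Oy ya] := he y.
    by apply: box_le (box_add hq hy); lra.
  split => //; apply: lt_le_trans ya _; rewrite lee_fin.
  apply: (@le_trans _ _ (`|a| + 1)); first by have := ler_norm a; lra.
  by rewrite -[leLHS]invrK lef_pV2 ?posrE ?invr_gt0// ltW.
have [rho [[h1 h2] h3]] := filter_ex (filterI (filterI (nbhs_right_gt (0 : R)) (nbhs_right_lt (ltr01 : (0 : R) < 1))) cov).
by exists rho; split => //; exact: ltW.
Qed.

Section sup_convolution.
Variable rho : R.
Hypotheses (rho0 : 0 < rho) (rho1 : rho <= 1) (hrho : forall p, unit_disc p ->
  forall y, box (cline w v p) rho y -> Om y /\ (phi y < (rho^-1)%:E)%E).

Let B := rho^-1.
Let B0 : 0 < B. Proof. by rewrite invr_gt0. Qed.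
(** The supremum in the convolution is confined to this tube around the circle, which lies in [Om]
    and where phi < B. *)
Let U : set V := [set y | exists th, box (circ th) rho y].

Let UB y : U y -> Om y /\ (phi y < B%:E)%E.
Proof. by move=> [th]; apply: hrho; rewrite /unit_disc/= cos2Dsin2. Qed.

Let Ucirc th : U (circ th).
Proof. by exists th; exact: boxI. Qed.

Definition trunc (k : nat) (y : V) : R := fine (maxe (phi y) (- k%:R)%:E).

Lemma truncE k y : U y -> maxe (phi y) (- k%:R)%:E = (trunc k y)%:E.
Proof.
move=> /UB[Oy _]; have := hphi Oy; rewrite /trunc.
by case: (phi y) => [x| |]// _; rewrite -?EFin_max//= maxNye.
Qed.

Lemma phi_le_trunc k y : U y -> (phi y <= (trunc k y)%:E)%E.
Proof. by move=> Uy; rewrite -truncE// le_max lexx. Qed.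

Lemma trunc_le_B k y : U y -> trunc k y <= B.
Proof.
move=> Uy; rewrite -lee_fin -truncE// ge_max lee_fin; apply/andP; split.
  by have [_ /ltW] := UB Uy.
by apply: le_trans (ltW B0); rewrite oppr_le0.
Qed.

Lemma trunc_le k k' y : (k <= k')%N -> U y -> trunc k' y <= trunc k y.
Proof.
move=> kk Uy; rewrite -lee_fin -!truncE// ge_max !le_max lexx/= lee_fin.
by rewrite lerN2 ler_nat kk orbT.
Qed.

(* Truncating phi at - k keeps the supremum finite where phi is -oo. *)
Definition sup_conv (k : nat) (th : R) : R :=
  sup [set trunc k y - k%:R * dist1 y (circ th) | y in U].

Lemma sup_conv_le k th c : (forall y, U y -> trunc k y - k%:R * dist1 y (circ th) <= c) ->
  sup_conv k th <= c.
Proof.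
move=> h; apply: ge_sup; first by exists (trunc k (circ th) - k%:R * dist1 (circ th) (circ th)); exists (circ th).
by move=> _ [y Uy <-]; exact: h.
Qed.

Lemma le_sup_conv k th y : U y -> trunc k y - k%:R * dist1 y (circ th) <= sup_conv k th.
Proof.
move=> Uy; apply: ub_le_sup; last by exists y.
exists B => _ [z Uz <-]; have := trunc_le_B k Uz.
have : 0 <= k%:R * dist1 z (circ th) by rewrite mulr_ge0 ?dist1_ge0.
lra.
Qed.

Lemma sup_conv_lipschitz k th th' :
  `|sup_conv k th - sup_conv k th'| <= k%:R * (2 * norm1 v) * `|th - th'|.
Proof.
have half a b : sup_conv k a - sup_conv k b <= k%:R * (2 * norm1 v) * `|a - b|.
  rewrite lerBlDl; apply: sup_conv_le => y Uy.
  have := le_sup_conv k b Uy; have := dist1_trans (circ a) y (circ b).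
  have : dist1 (circ a) (circ b) <= 2 * `|a - b| * norm1 v.
    by have [h1 h2] := cos_sin_lipschitz a b; exact: (@dist1_cline R n w v (cos a, sin a) (cos b, sin b) _ h1 h2).
  have aux (t s q d1 d2 d3 l : R) : 0 <= q -> d2 <= l -> d3 <= d1 + d2 -> t - q * d3 <= s ->
      t - q * d1 <= s + q * l by nra.
  have -> : k%:R * (2 * norm1 v) * `|a - b| = k%:R * (2 * `|a - b| * norm1 v) by ring.
  by move=> *; apply: aux; eassumption || exact: ler0n.
have h1 := half th th'; have := half th' th; rewrite [X in _ * X]distrC => h2.
by rewrite ler_norml h1 andbT lerNl opprB.
Qed.

Lemma circ_periodic th : circ (th + 2 * pi) = circ th.
Proof. by rewrite /circ mulr_natl cosD2pi sinD2pi. Qed.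

Lemma sup_conv_periodic k th : sup_conv k (th + 2 * pi) = sup_conv k th.
Proof. by rewrite /sup_conv circ_periodic. Qed.

Lemma sup_conv_anti k k' th : (k <= k')%N -> sup_conv k' th <= sup_conv k th.
Proof.
move=> kk; apply: sup_conv_le => y Uy; apply: le_trans (le_sup_conv k th Uy).
apply: lerB; first exact: trunc_le.
by rewrite ler_wpM2r ?dist1_ge0// ler_nat.
Qed.

Lemma sup_conv_le_B k th : sup_conv k th <= B.
Proof.
apply: sup_conv_le => y Uy; have := trunc_le_B k Uy.
have : 0 <= k%:R * dist1 y (circ th) by rewrite mulr_ge0 ?dist1_ge0.
lra.
Qed.

Lemma dist1xx (y : V) : dist1 y y = 0 :> R.
Proof. by rewrite /dist1 big1// => j _; rewrite !subrr !normr0 addr0. Qed.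

Lemma phi_le_sup_conv k th : (phi (circ th) <= (sup_conv k th)%:E)%E.
Proof.
apply: le_trans (phi_le_trunc k (Ucirc th)) _; rewrite lee_fin.
by have := le_sup_conv k th (Ucirc th); rewrite dist1xx mulr0 subr0.
Qed.

(** Together with [phi_le_sup_conv] and monotonicity in k, this says that the convolutions decrease
    to phi on the circle, to -oo where phi is -oo. *)
Lemma sup_conv_lt (a : R) th : (phi (circ th) < a%:E)%E ->
  exists k, sup_conv k th <= a.
Proof.
move=> ha; have Oc : Om (circ th) by have [] := UB (Ucirc th).
have /nbhs_boxP[e e0 he] := husc Oc ha.
(* k > |a| puts the truncation level - k below a; k e >= B + |a| brings points at distance at least
   e below a through the penalty. Nearer points are handled by upper semicontinuity. *)
pose k := (Num.truncn (`|a| + (B + `|a|) / e)).+1.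
have hk : `|a| + (B + `|a|) / e < k%:R by exact: truncnS_gt.
have q0 : 0 <= (B + `|a|) / e by rewrite divr_ge0 ?addr_ge0 ?(ltW B0) ?(ltW e0).
exists k; apply: sup_conv_le => y Uy; have d0 := dist1_ge0 y (circ th).
have [h|h] := ltP (dist1 y (circ th)) e.
  have [Oy _] := UB Uy; have := he y (dist1_box h) Oy => ya.
  have : trunc k y <= a.
    rewrite -lee_fin -truncE// ge_max ltW//= lee_fin.
    have := ler_norm (- a); rewrite normrN; lra.
  have : 0 <= k%:R * dist1 y (circ th) by rewrite mulr_ge0.
  lra.
have := trunc_le_B k Uy.
have : k%:R * e <= k%:R * dist1 y (circ th) by rewrite ler_wpM2l.
have : (B + `|a|) / e * e <= k%:R * e.
  by rewrite ler_wpM2r ?(ltW e0)//; have := normr_ge0 a; lra.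
rewrite divfK ?gt_eqF//; have := ler_norm (- a); rewrite normrN; lra.
Qed.

(** The maximum principle wants a disc of radius above 1. A point slightly outside the unit disc is
    close to its radial projection to the circle, hence inside the tube. *)
Lemma disc_extended : exists2 r, 1 < r & disc r `<=` cline w v @^-1` Om.
Proof.
have v0 := norm1_ge0 v.
pose d := rho / (2 * norm1 v + 1).
have d0 : 0 < d by rewrite divr_gt0// ltr_wpDl// mulr_ge0.
have dv : 2 * d * norm1 v < rho.
  have : d * (2 * norm1 v + 1) = rho by rewrite divfK// gt_eqF// ltr_wpDl// mulr_ge0.
  lra.
exists (1 + d); first by rewrite ltrDl.
move=> [q1 q2]; rewrite /disc/= => hq.
have [h|h] := leP (q1 ^+ 2 + q2 ^+ 2) 1; first exact: Om_cline.
pose s := Num.sqrt (q1 ^+ 2 + q2 ^+ 2).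
have s2 : s ^+ 2 = q1 ^+ 2 + q2 ^+ 2 by rewrite sqr_sqrtr// addr_ge0 ?sqr_ge0.
have s0 : 0 <= s by exact: sqrtr_ge0.
have s1 : 1 < s by nra.
have sd : s < 1 + d by nra.
have sp : 0 < s by lra.
have qs (x : R) : x ^+ 2 <= s ^+ 2 -> `|x - x / s| <= d.
  move=> xs; have -> : x - x / s = x * ((s - 1) / s) by field; rewrite gt_eqF.
  have sg : 0 <= (s - 1) / s by rewrite divr_ge0//; lra.
  rewrite normrM (ger0_norm sg); apply: (@le_trans _ _ (s * ((s - 1) / s))).
    by rewrite ler_wpM2r// -[s](ger0_norm s0) -!sqrtr_sqr ler_wsqrtr.
  by rewrite mulrC divfK ?gt_eqF//; lra.
have pd : unit_disc (q1 / s, q2 / s).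
  by rewrite /unit_disc/= !expr_div_n -mulrDl -s2 divff// gt_eqF// exprn_gt0.
have [] // := hrho pd (y := cline w v (q1, q2)).
apply: dist1_box; apply: le_lt_trans dv; apply: dist1_cline => /=; apply: qs; rewrite s2.
  by rewrite lerDl sqr_ge0.
by rewrite lerDr sqr_ge0.
Qed.

Section sub_mean.
Variables (fw : R).
Hypotheses (phiw : phi w = fw%:E) (hpole : closed_in Om (Pole Om phi))
  (hholder : locally_holder (Om `\` Pole Om phi) phi) (hh : twisted_hormander Om phi).

Lemma sup_conv_sub_mean k :
  2 * pi * fw <= (\int[mu]_(th in `[0%R, (2 * pi)%R]) sup_conv k th)%R.
Proof.
have Ow : Om w by have := hv (t := 0); rewrite scale0r addr0; apply; rewrite normr0.
have [r0 [C0 [K [r00 r01 hK]]]] := holder_local oOm hpole hholder Ow phiw.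
have [M M0 hM] := @theta1_bound R.
have [A [p [A0 hA]]] := extension oOm hh M0 hM r00 r01 hK.
have [r r1 hr] := disc_extended.
(* A bound for the l1 distance to w of every point in a box used below: the box contributes at most
   2 n rho, the radius of the circle at most 2 [norm1 v]. *)
pose Q := 2 * n%:R * rho + 2 * norm1 v.
pose T := n%:R * (2 * Q ^+ 2).
pose D := (16 / rho ^+ 2) ^+ n * A * expR (k%:R * n%:R * rho + n.+2%:R * T).
apply: (@jensen_limit R n Om w v r oOm r1 hr D fw (k%:R * (2 * norm1 v)) _ (p + 2 * n)%N).
- exact: sup_conv_lipschitz.
- exact: sup_conv_periodic.
move=> m m0; have [f [Cf df f4 hf]] := hA m m0; exists f; split => // th.
have mp : 0 < m%:R :> R by rewrite ltr0n.
have m1 : 1 <= m%:R :> R by rewrite ler1n.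
(* At scale 1/m the penalty k costs m * k * (2 n s) = k n rho in the exponent, a constant, while
   (s^2 / 4)^-n is (16 / rho^2)^n m^(2 n), one more power of m. *)
pose s := rho / (2 * m%:R).
have s0 : 0 < s by rewrite divr_gt0// mulr_gt0.
have srho : s < rho by rewrite ltr_pdivrMr ?mulr_gt0// ltr_pMr//; lra.
have s1 : s <= 1 by rewrite ltW// (lt_le_trans srho).
have cU y : cbox (circ th) s y -> U y by move=> /(box_cbox srho) h; exists th.
have := hf (circ th) s rho (sup_conv k th + k%:R * (2 * n%:R * s)) T s0 s1 srho.
have bO : box (circ th) rho `<=` Om by move=> y hy; have [] := UB (ex_intro _ th hy : U y).
move=> /(_ bO) /[dup] _ hz; have {}hz := hz _.
have yT y : cbox (circ th) s y -> sqdist w y <= T /\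
    (phi y <= (sup_conv k th + k%:R * (2 * n%:R * s))%:E)%E.
  move=> hy; have yd := cbox_dist1 hy; split; last first.
    apply: le_trans (phi_le_trunc k (cU y hy)) _; rewrite lee_fin.
    have := le_sup_conv k th (cU y hy).
    have : k%:R * dist1 y (circ th) <= k%:R * (2 * n%:R * s) by rewrite ler_wpM2l.
    lra.
  apply: sqdist_cbox_le; apply: dist1_cbox.
  apply: le_trans (dist1_trans (circ th) y w) _; rewrite /Q lerD//.
    by apply: le_trans yd _; rewrite ler_wpM2l ?mulr_ge0// ltW.
  have -> : w = cline w v (0, 0) by rewrite /cline/= scale0r addr0.
  rewrite -[2]mulr1; apply: dist1_cline; rewrite /= subr0 ler_norml.
    by rewrite cos_geN1 cos_le1.
  by rewrite sin_geN1 sin_le1.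
move: (hz yT).
have -> : m%:R * (sup_conv k th + k%:R * (2 * n%:R * s) - fw) + n.+2%:R * T =
  (k%:R * n%:R * rho + n.+2%:R * T) + m%:R * (sup_conv k th - fw).
  have : m%:R * s * 2 = rho by rewrite /s; field; rewrite gt_eqF.
  move: (s) => t <-; ring.
rewrite expRD => h.
have E : (s ^+ 2 / 4) ^+ n * ((16 / rho ^+ 2) ^+ n * m%:R ^+ (2 * n)) = 1.
  rewrite exprM -exprMn -exprMn (_ : _ * _ = 1) ?expr1n// /s.
  by field; rewrite !gt_eqF.
have P0 : 0 <= (16 / rho ^+ 2) ^+ n * m%:R ^+ (2 * n).
  by rewrite mulr_ge0 ?exprn_ge0// divr_ge0// sqr_ge0.
have := ler_wpM2r P0 h; rewrite mulrAC E mul1r => {}h.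
by apply: le_trans h _; rewrite exprD /D le_eqVlt; apply/orP; left; apply/eqP; ring.
Qed.

(** Monotone convergence applied to the nonnegative increasing functions B - sup_conv. It also
    yields what the mean of phi needs: measurability along the circle as a pointwise limit, and
    integrability from the bound 2 pi (B - fw). *)
Lemma sub_mean : (phi w <= circle_mean phi w v)%E.
Proof.
have pi0 : 0 < 2 * pi :> R by rewrite mulr_gt0 ?pi_gt0.
pose I : set R := `[0%R, (2 * pi)%R]%classic.
have mI : measurable I by exact: measurable_itv.
have muI : mu I = (2 * pi)%:E by rewrite lebesgue_measure_itv/= lte_fin pi0 -EFinB subr0.
pose h := sup_conv.
have hint k : mu.-integrable I (EFin \o h k).
  apply: lipschitz_integrable; exact: sup_conv_lipschitz.
have cint (c : R) : mu.-integrable I (EFin \o (fun=> c)).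
  by apply: continuous_compact_integrable; [exact: segment_compact|apply: continuous_subspaceT => x; exact: cvg_cst].
pose g k (th : R) : \bar R := (B - h k th)%:E.
have gint k : mu.-integrable I (g k).
  have -> : g k = (fun th => (EFin \o (fun=> B)) th - (EFin \o h k) th)%E by apply/funext => th; rewrite /g EFinB.
  exact: integrableB.
have mg k : measurable_fun I (g k) by exact: measurable_int (gint k).
have g0 k th : (0 <= g k th)%E by rewrite lee_fin subr_ge0 sup_conv_le_B.
have ndg th : {homo g^~ th : k k' / (k <= k')%N >-> (k <= k')%E}.
  by move=> k k' kk; rewrite lee_fin lerD2l lerN2 sup_conv_anti.
pose G (th : R) : \bar R := (B%:E - phi (circ th))%E.
have gG th : g^~ th @ \oo --> G th.
  have := ereal_nondecreasing_cvgn (ndg th).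
  suff -> : ereal_sup (range (g^~ th)) = G th by [].
  have le_G k : (g k th <= G th)%E.
    by rewrite /g EFinB leeB// phi_le_sup_conv.
  have ge_g k : (g k th <= ereal_sup (range (g^~ th)))%E by apply: ereal_sup_ubound; exists k.
  apply: le_anti; apply/andP; split.
    by apply: ge_ereal_sup => _ [k _ <-]; exact: le_G.
  have Oc : Om (circ th) by have [] := UB (Ucirc th).
  have := hphi Oc; have ap := @sup_conv_lt _ th; rewrite /G.
  case: (phi (circ th)) ap => [x| |]// ap _.
    apply/lee_addgt0Pr => e e0.
    have [|k hk] := ap (x + e); first by rewrite lte_fin ltrDl.
    apply: (@le_trans _ _ (g k th + e%:E)%E); last by rewrite leeD2r.
    by rewrite /g -EFinB -EFinD lee_fin; rewrite /h; lra.
  (* Where phi is -oo the limit is +oo: the convolution falls below B - a for every real a. *)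
  rewrite (@eq_infty _ (ereal_sup _)) ?leey// => a.
  have [|k hk] := ap (B - a); first by rewrite ltNyr.
  by apply: le_trans (ge_g k); rewrite lee_fin /h; lra.
have G0 th : (0 <= G th)%E by apply: le_trans (g0 0%N th) _; rewrite /g EFinB leeB// phi_le_sup_conv.
have mG : measurable_fun I G.
  by apply: (emeasurable_fun_cvg g) => // th _; exact: gG.
have intg k : (\int[mu]_(th in I) g k th <= (2 * pi * (B - fw))%:E)%E.
  rewrite /g -[leLHS]fineK; last first.
    by apply: integrable_fin_num => //; exact: gint.
  rewrite lee_fin (_ : fine _ = (\int[mu]_(th in I) (B - h k th))%R)//.
  rewrite RintegralB// Rintegral_cst//.
  have E : fine (mu I) = 2 * pi by rewrite muI.
  have := sup_conv_sub_mean k; rewrite -/I -/h; rewrite (_ : fine _ = 2 * pi)//; lra.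
have intG : (\int[mu]_(th in I) G th <= (2 * pi * (B - fw))%:E)%E.
  have E : (fun th => limn (g^~ th)) = G by apply/funext => th; apply/cvg_lim => //; exact: gG.
  have cvgI := @cvg_monotone_convergence _ _ _ mu I mI g mg (fun k th _ => g0 k th) (fun th _ => ndg th).
  have := cvg_lim (@ereal_hausdorff R) cvgI; rewrite E => <-.
  apply: lime_le; first exact: cvgP cvgI.
  by apply: nearW => k; exact: intg.
have iG : mu.-integrable I G.
  apply/integrableP; split => //.
  have -> : (fun th => `|G th|)%E = G by apply/funext => th; rewrite gee0_abs.
  by apply: le_lt_trans intG _; rewrite ltry.
have phiE : (fun th => phi (circ th)) = (fun th => (EFin \o (fun=> B)) th - G th)%E.
  apply/funext => th; rewrite /G/= oppeB ?fin_num_adde_defr//; last first.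
  by rewrite addeA -EFinB subrr add0e.
rewrite /circle_mean phiw (_ : (fun th => _) = (fun th => phi (circ th))) // phiE.
rewrite integralB//.
have -> : (\int[mu]_(th in I) (EFin \o (fun=> B)) th)%E = (B * (2 * pi))%:E.
  by rewrite integral_cst//= EFinM; congr (_ * _)%E; exact: muI.
have finG : (\int[mu]_(th in I) G th)%E \is a fin_num by exact: integrable_fin_num.
move: intG; rewrite -(fineK finG); move: (fine _) => J; rewrite !lee_fin => hJ.
rewrite -ler_pdivrMl ?invr_gt0// invrK; lra.
Qed.

End sub_mean.
End sup_convolution.
End circle.

Unset Implicit Arguments.

Theorem theorem1p3 (R : realType) (n : nat)
  (Omega : set 'rV[R[i]]_n) (phi : 'rV[R[i]]_n -> \bar R)
  (hOmega : domain Omega)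
  (hphi : forall z, Omega z -> (phi z < +oo)%E)
  (husc : upper_semicontinuous_on Omega phi)
  (hpole : closed_in Omega (Pole Omega phi))
  (hholder : locally_holder (Omega `\` Pole Omega phi) phi)
  (hhormander : twisted_hormander Omega phi) :
  psh Omega phi.
Proof.
have [oO _ _] := hOmega; split => // z v hv.
have Oz : Omega z by have := hv 0; rewrite scale0r addr0; apply; rewrite normr0.
have := hphi z Oz; case phiz : (phi z) => [x| |]// _; last by rewrite leNye.
have [rho [rho0 rho1 hrho]] := tube oO hphi husc hv.
rewrite -phiz; exact: sub_mean rho0 rho1 hrho x phiz hpole hholder hhormander.
Qed.
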